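(* Let $s\ge1$ and let $M\subset\mathbb{C}^n$ be a totally real submanifold of Gevrey class $G^s$. Let $X$ be a non-empty compact subset of $M$. If $\dim M=m$, then the Kolmogorov dimension of $X$ satisfies $\mathcal{K}\text{-}\mathrm{dim}\,X\le ms$.
   Context: Kolmogorov dimension: for a non-empty totally bounded metric space $E$ and $\varepsilon>0$, let $N_\varepsilon(E)$ be the smallest cardinality of a family of sets of diameter at most $2\varepsilon$ covering $E$, and let $\mathscr{H}_\varepsilon(E)=\log N_\varepsilon(E)$ (natural logarithm) be the $\varepsilon$-entropy. For a compact subset $X$ of a bounded domain $D\subset\mathbb{C}^n$, let $A_X^D\subset C(X)$ be the set of restrictions to $X$ of holomorphic functions $F$ on $D$ with $\sup_D|F|\le 1$, with the sup-norm metric of $C(X)$ (it is compact, hence totally bounded). Put $$\Psi(X,D)=\limsup_{\varepsilon\to0}\frac{\log\mathscr{H}_\varepsilon(A_X^D)}{\log\log\frac1\varepsilon}-1 .$$ The Kolmogorov dimension of a non-empty compact $X\subset\mathbb{C}^n$ is $\mathcal{K}\text{-}\mathrm{dim}\,X=\Psi(X,D)$, where $D$ is any bounded domain containing $X$ (the value does not depend on the choice of $D$). Gevrey class: let $U\subset\mathbb{R}^d$ be open and $s\ge 1$. A function $f\in C^\infty(U)$ belongs to the Gevrey class $G^s(U)$ if for every compact $K\subset U$ there is a constant $C_K>0$ such that $\sup_{x\in K}|\partial^\alpha f(x)|\le C_K^{|\alpha|+1}(\alpha!)^s$ for every multi-index $\alpha$, where $|\alpha|=\sum_j\alpha_j$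 and $\alpha!=\prod_j\alpha_j!$. The class $G^s$ is closed under composition and the Implicit Function Theorem holds in it, so (sub)manifolds of class $G^s$ are defined in the usual way: a real $m$-dimensional submanifold $M$ of $\mathbb{C}^n\cong\mathbb{R}^{2n}$ is of class $G^s$ if near each of its points it is the common zero set of $2n-m$ real-valued functions of class $G^s$ with linearly independent differentials (equivalently, it is locally a graph of a $G^s$ map over an open subset of an $m$-dimensional real coordinate subspace). $\dim M$ is the real dimension of $M$. A submanifold $M\subset\mathbb{C}^n$ is totally real if for every $p\in M$ the tangent space $T_pM$ contains no complex line. *)

(* Defs.v *)
From HB Require Import structures.
From mathcomp Require Import all_boot all_order all_algebra complex.
From mathcomp Require Import all_classical all_reals all_analysis.

Set Implicit Arguments.
Unset Strict Implicit.
Unset Printing Implicit Defensive.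

Import Order.TTheory GRing.Theory Num.Theory.
Import numFieldNormedType.Exports.

Local Open Scope classical_set_scope.
Local Open Scope ring_scope.
Local Open Scope complex_scope.

(* R[i] with the topology of its modulus.  Since R[i] is then a normed module
   over itself, [differentiable] on 'rV[R[i]]_n is complex differentiability. *)
HB.instance Definition _ (R : realType) := NormedModule.copy R[i] R[i]^o.

Section MetricEntropy.
Context {R : realType} {T : Type} (d : T -> T -> \bar R).
Local Open Scope ereal_scope.

Definition diameter (A : set T) : \bar R :=
  ereal_sup [set d x y | x in A & y in A].

(* The minimum over finite covers; it is +oo if there is none, that is, if E is
   not totally bounded. *)
Definition covering_number (E : set T) (eps : R) : \bar R :=
  ereal_inf [set k%:R%:E | k in
    [set k : nat | exists C : 'I_k -> set T,
      (forall i, diameter (C i) <= (2 * eps)%:E) /\ E `<=` \bigcup_i C i]].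

Definition entropy (E : set T) (eps : R) : \bar R :=
  lne (covering_number E eps).

End MetricEntropy.

Section KolmogorovDimension.
Context {R : realType} {n : nat}.
Implicit Types X D : set 'rV[R[i]]_n.

Definition bounded_domain D := [/\ open D, connected D & bounded_set D].

Definition holomorphic_on D (F : 'rV[R[i]]_n -> R[i]) :=
  forall z, D z -> differentiable F z.

Definition sup_dist {T : Type} (f g : T -> R[i]) : \bar R :=
  ereal_sup (range (fun x => (complex.Re `|f x - g x|)%:E)).

Definition holomorphic_unit_ball X D : set (X -> R[i]) :=
  [set sigL X F | F in
    [set F | holomorphic_on D F /\ forall z, D z -> `|F z| <= 1]].

(* Psi(X, D).  For X nonempty and compact its value is the same for all bounded
   domains D containing X; this value is the Kolmogorov dimension of X. *)
Definition kolmogorov_dim X D : \bar R :=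
  (limf_esup (fun eps : R =>
     lne (entropy sup_dist (@holomorphic_unit_ball X D) eps)
       * ((ln (ln eps^-1))^-1)%:E) 0^'+ - 1)%E.

End KolmogorovDimension.

Section Gevrey.
Context {R : realType} {d : nat}.
Implicit Types (U : set 'rV[R]_d) (f : 'rV[R]_d -> R).

Definition partial (i : 'I_d) f : 'rV[R]_d -> R := fun x => 'D_('e_i) f x.

Definition partials (w : seq 'I_d) f : 'rV[R]_d -> R := foldr partial f w.

Definition mpartial (a : 'I_d -> nat) f : 'rV[R]_d -> R :=
  partials (flatten [seq nseq (a i) i | i <- enum 'I_d]) f.

Definition smooth_on U f := forall (w : seq 'I_d) x, U x ->
  {for x, continuous (partials w f)} /\
  forall i, derivable (partials w f) x 'e_i.

Definition gevrey (s : R) U f :=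
  smooth_on U f /\
  forall K : set 'rV[R]_d, compact K -> K `<=` U ->
    exists2 C : R, 0 < C & forall (a : 'I_d -> nat) x, K x ->
      `|mpartial a f x| <=
        C ^+ (\sum_i a i)%N.+1 * ((\prod_i (a i)`!)%N%:R `^ s).

End Gevrey.

Section Submanifold.
Context {R : realType} {d : nat}.
Implicit Types (S U : set 'rV[R]_d) (p : 'rV[R]_d).

Definition local_equations (s : R) (k : nat) S p U
    (rho : 'I_k -> 'rV[R]_d -> R) :=
  [/\ open U, U p, forall i, gevrey s U (rho i),
      S `&` U = [set x | U x /\ forall i, rho i x = 0] &
      forall x, U x -> row_free (\matrix_(i, j) 'd (rho i) x 'e_j)].

Definition gevrey_submanifold (s : R) (m : nat) S :=
  (m <= d)%N /\ forall p, S p ->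
    exists U (rho : 'I_(d - m) -> 'rV[R]_d -> R), local_equations s S p U rho.

(* The common kernel of the differentials at p of a system of local equations;
   it does not depend on the system. *)
Definition tangent_space (s : R) (m : nat) S p : set 'rV[R]_d :=
  [set v | exists U (rho : 'I_(d - m) -> 'rV[R]_d -> R),
     local_equations s S p U rho /\ forall i, 'd (rho i) p v = 0].

End Submanifold.

Section TotallyReal.
Context {R : realType} {n : nat}.

Definition realify (z : 'rV[R[i]]_n) : 'rV[R]_(n + n) :=
  row_mx (map_mx (@complex.Re R) z) (map_mx (@complex.Im R) z).

Definition totally_real (s : R) (m : nat) (M : set 'rV[R[i]]_n) :=
  forall p, M p -> ~ exists2 w : 'rV[R[i]]_n, w != 0 &
    forall c : R[i],
      tangent_space s m (realify @` M) (realify p) (realify (c *: w)).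

End TotallyReal.

(* Main.v *)
From HB Require Import structures.
Require Import Defs.
From mathcomp Require Import all_boot all_order all_algebra complex.
From mathcomp Require Import all_classical all_reals all_analysis.
From mathcomp Require Import ring lra.

(** Fix N and work at the scale r = c N^(1-s).  The derivative of order alpha of a defining
    function of M is at most C^(|alpha|+1) (alpha!)^s.  In the Taylor polynomial of order N
    the quotient (alpha!)^(s-1) is at most N^((s-1)|alpha|), which r absorbs, so at this
    scale Taylor polynomials converge geometrically, as for analytic functions
    [taylor_error].

    Near a point x0 of M, the manifold is the set of fixed points of a contraction
    depending on m parameters t.  With Taylor polynomials in place of the defining
    functions the Picard iterates become polynomials in t.  They remain of size r for
    complex t [chart_bound], and for real t the N-th iterate is within a multiple of 2^-N of M
    [chart_error]: M is replaced by the image of a polynomial map, whose complexification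
    takes a polydisc of radius about r in C^m into D.

    A holomorphic function on D bounded by 1, composed with this map and rescaled, is a
    holomorphic function on the unit polydisc of C^m bounded by 1.  On the polydisc of
    radius 1/16 it is determined up to (3/4)^N by N^m functionals of size at most C^N
    [newton_functional_norming].  These are divided differences rather than Taylor
    coefficients: being finite combinations of values they depend holomorphically on the
    other variables, and their bounds only need a maximum principle with removable
    singularities [maximum_principle].  That follows from Goursat's theorem [flux_eq0]
    through a crude form of Cauchy's inequality [square_center_bound], sharpened by
    applying it to high powers.

    Since M is a Lipschitz graph over the parameters, about r^-m, that is N^((s-1)m), such
    charts cover a neighbourhood of a point of M, so by compactness a constant times N^(ms)
    functionals determine the functions on X up to (3/4)^N [local_approximation,
    finitely_determined_compact].  Take N proportional to log (1/eps).  Rounding a functional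
    to a precision comparable to eps C^-N leaves exp (O (log (1/eps))) possibilities, so the
    eps-entropy is O ((log (1/eps))^(ms+1)) [entropy_bound], and the dimension is at
    most ms [kolmogorov_dim_le]. *)

Import Order.TTheory GRing.Theory Num.Theory.
Import numFieldNormedType.Exports.

Local Open Scope classical_set_scope.
Local Open Scope ring_scope.
Local Open Scope complex_scope.

Set Implicit Arguments.
Unset Strict Implicit.
Unset Printing Implicit Defensive.

(** * The modulus as a real number, and complex differentiability *)

Section Modulus.
Context {R : realType}.
Implicit Types (z w : R[i]) (r : R).

(** The norm of R[i] takes its values in R[i]; estimates are made with its real part. *)
Definition cmod z : R := complex.Re `|z|.

Lemma normE z : `|z| = (cmod z)%:C.
Proof. by rewrite /cmod normc_def. Qed.

Lemma ltr0c r : (0 < r%:C) = (0 < r).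
Proof. by rewrite ltcE /= eqxx. Qed.

Lemma cmod_le z w : (cmod z <= cmod w) = (`|z| <= `|w|).
Proof. by rewrite !normE lecR. Qed.

Lemma cmod_ge0 z : 0 <= cmod z.
Proof. by rewrite -ler0c -normE. Qed.

Lemma cmodD z w : cmod (z + w) <= cmod z + cmod w.
Proof. by rewrite -lecR rmorphD /= -!normE ler_normD. Qed.

Lemma cmodN z : cmod (- z) = cmod z.
Proof. by rewrite /cmod normrN. Qed.

Lemma cmodB z w : cmod (z - w) <= cmod z + cmod w.
Proof. by rewrite -(cmodN w) cmodD. Qed.

Lemma cmod_distC z w : cmod (z - w) = cmod (w - z).
Proof. by rewrite /cmod distrC. Qed.

Lemma cmodM z w : cmod (z * w) = cmod z * cmod w.
Proof. by apply: complexI; rewrite rmorphM /= -!normE normrM. Qed.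

Lemma cmod0 : cmod 0 = 0.
Proof. by rewrite /cmod normr0. Qed.

Lemma cmod1 : cmod 1 = 1.
Proof. by rewrite /cmod normr1. Qed.

Lemma cmodX z n : cmod (z ^+ n) = cmod z ^+ n.
Proof. by elim: n => [|n IH]; rewrite ?expr0 ?cmod1 // !exprS cmodM IH. Qed.

Lemma cmod_eq0 z : (cmod z == 0) = (z == 0).
Proof. by rewrite -[RHS]normr_eq0 normE eq_complex /= eqxx andbT. Qed.

Lemma cmod_gt0 z : (0 < cmod z) = (z != 0).
Proof. by rewrite lt0r cmod_ge0 andbT cmod_eq0. Qed.

Lemma cmodV z : cmod z^-1 = (cmod z)^-1.
Proof.
have [->|z0] := eqVneq z 0; first by rewrite invr0 cmod0 invr0.
have zn : cmod z != 0 by rewrite cmod_eq0.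
by apply: (mulfI zn); rewrite -cmodM !divff // cmod1.
Qed.

Lemma cmodR r : cmod r%:C = `|r|.
Proof. by rewrite /cmod normc_def /= expr0n /= addr0 sqrtr_sqr. Qed.

Lemma cmod_Re z : `|complex.Re z| <= cmod z.
Proof. by rewrite -lecR -normE normc_ge_Re. Qed.

Lemma cmod_i : cmod 'i = 1.
Proof. by rewrite /cmod normc_def /= expr0n expr1n add0r sqrtr1. Qed.

Lemma cmod_Im z : `|complex.Im z| <= cmod z.
Proof.
have := cmod_Re (z * 'i); rewrite cmodM cmod_i mulr1; apply: le_trans.
by rewrite ReiNIm normrN.
Qed.

Lemma cmod_ReIm z : cmod z <= `|complex.Re z| + `|complex.Im z|.
Proof.
rewrite [in leLHS](complexE z) (le_trans (cmodD _ _)) // cmodM cmod_i mul1r.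
by rewrite !cmodR.
Qed.

Lemma cmod_sum (I : Type) (s : seq I) (P : pred I) (F : I -> R[i]) :
  cmod (\sum_(i <- s | P i) F i) <= \sum_(i <- s | P i) cmod (F i).
Proof.
apply: (big_ind2 (fun x y => cmod x <= y)) => // [|x1 x2 y1 y2 h1 h2].
  by rewrite cmod0.
by rewrite (le_trans (cmodD _ _)) // lerD.
Qed.

(** With real epsilon and delta, the form in which Goursat's theorem uses the derivative. *)
Lemma differentiable_estimate (f : R[i] -> R[i]) z : differentiable f z ->
  exists D, forall e, 0 < e -> exists2 d : R, 0 < d &
    forall w, cmod (w - z) < d -> cmod (f w - f z - D * (w - z)) <= e * cmod (w - z).
Proof.
move=> /derivable1_diffP /= df.
exists ('D_1 f z) => e e0.
move/cvgrPdist_le : df => /(_ e%:C).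
rewrite ltr0c => /(_ e0).
rewrite near_withinE => /nbhs_ballP [] [d di] /=.
rewrite ltcE /= => /andP[/eqP -> d0] H.
exists d => // w wd.
have [->|wz] := eqVneq w z; first by rewrite !subrr mulr0 subr0 !cmod0 mulr0.
have wz0 : w - z != 0 by rewrite subr_eq0.
have := H (w - z); rewrite /ball /= sub0r normrN normE ltcR => /(_ wd wz0).
rewrite normE lecR /= scaler1 subrK => h.
have -> : f w - f z - 'D_1 f z * (w - z) =
   - (w - z) * ('D_1 f z - (w - z)^-1 *: (f w - f z)).
  rewrite -[_ *: _]/((w - z)^-1 * (f w - f z)).
  by move: (w - z) wz0 (f w - f z) => k k0 A; field.
by rewrite cmodM cmodN mulrC ler_wpM2r // cmod_ge0.
Qed.

Lemma differentiable_from_estimate (f : R[i] -> R[i]) z D :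
  (forall e, 0 < e -> exists2 d : R, 0 < d &
    forall w, cmod (w - z) < d -> cmod (f w - f z - D * (w - z)) <= e * cmod (w - z)) ->
  differentiable f z.
Proof.
move=> H; apply/derivable1_diffP.
apply/cvg_ex; exists D; apply/cvgrPdist_le => -[e ei].
rewrite ltcE /= => /andP[/eqP -> e0].
have [d d0 {}H] := H e e0.
rewrite near_withinE; apply/nbhs_ballP; exists d%:C => /=; first by rewrite ltr0c.
move=> w; rewrite /ball /= sub0r normrN normE ltcR => wd w0.
rewrite normE lecR.
have := H (w + z); rewrite addrK => /(_ wd).
have -> : D - w^-1 *: (f (w *: 1 + z) - f z) =
   - w^-1 * (f (w + z) - f z - D * w).
  rewrite scaler1 -[_ *: _]/(w^-1 * (f (w + z) - f z)).
  by move: (f (w + z) - f z) => A; field.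
rewrite cmodM cmodN cmodV => h.
by rewrite mulrC ler_pdivrMr // cmod_gt0.
Qed.

Lemma differentiable_near (f : R[i] -> R[i]) z : differentiable f z ->
  exists2 K : R, 0 < K & exists2 d : R, 0 < d &
    forall w, cmod (w - z) < d -> cmod (f w - f z) <= K * cmod (w - z).
Proof.
move=> /differentiable_estimate [D /(_ 1 ltr01) [d d0 H]].
exists (1 + cmod D); first by rewrite ltr_pwDl // cmod_ge0.
exists d => // w wd; rewrite -(subrK (D * (w - z)) (f w - f z)).
rewrite (le_trans (cmodD _ _)) // mulrDl lerD ?H // cmodM //.
Qed.

End Modulus.

(** * Goursat's theorem for rectangles *)

Section SegmentIntegral.
Context {R : realType}.
Implicit Types (f : R -> R) (a b c M : R).

Definition segint f a b : R := \int[lebesgue_measure]_(y in `[a, b]) f y.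

(** Two-sided continuity also at the end points; the integrands come from functions
    differentiable at every point of a closed edge. *)
Definition continuous_on_segment f a b :=
  forall y, a <= y <= b -> {for y, continuous f}.

Lemma segment_integrable f a b : continuous_on_segment f a b ->
  lebesgue_measure.-integrable [set` `[a, b]] (EFin \o f).
Proof.
move=> cf; apply: continuous_compact_integrable; first exact: segment_compact.
apply: continuous_in_subspaceT => y; rewrite inE /= in_itv /= => /cf //.
Qed.

Lemma segint_split f a c b : a <= c -> c <= b -> continuous_on_segment f a b ->
  segint f a b = segint f a c + segint f c b.
Proof.
move=> ac cb cf; rewrite /segint.
have h := @Rintegral_itvB R f (BLeft a) (BRight b) c (segment_integrable cf).
rewrite -(Rintegral_itv_obnd_cbnd (r := c)); last first.
  apply: integrableS (segment_integrable cf) => //.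
  by move=> y /=; rewrite !in_itv /= => /andP[cy ->]; rewrite andbT (le_trans ac) // ltW.
by rewrite -h ?bnd_simp // addrC subrK.
Qed.

Lemma segint_cst a b M : a <= b -> segint (fun=> M) a b = M * (b - a).
Proof.
move=> ab; rewrite /segint Rintegral_cst //= lebesgue_measure_itv /= lte_fin.
case: ltP => // ba; have -> : a = b by apply/eqP; rewrite eq_le ab ba.
by rewrite subrr.
Qed.

Lemma segint_le f a b M : a <= b -> continuous_on_segment f a b ->
  (forall y, a <= y <= b -> f y <= M) -> segint f a b <= M * (b - a).
Proof.
move=> ab cf fM; rewrite -segint_cst //; apply: le_Rintegral => //.
- exact: segment_integrable.
- by apply: segment_integrable => y _; exact: cst_continuous.
Qed.

Lemma segint_ge f a b M : a <= b -> continuous_on_segment f a b ->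
  (forall y, a <= y <= b -> M <= f y) -> M * (b - a) <= segint f a b.
Proof.
move=> ab cf fM; rewrite -segint_cst //; apply: le_Rintegral => //.
- by apply: segment_integrable => y _; exact: cst_continuous.
- exact: segment_integrable.
Qed.

Lemma segintB_near f1 f2 a b k e : a <= b ->
  continuous_on_segment f1 a b -> continuous_on_segment f2 a b ->
  (forall y, a <= y <= b -> `|f2 y - f1 y - k| <= e) ->
  `|segint f2 a b - segint f1 a b - k * (b - a)| <= e * (b - a).
Proof.
move=> ab c1 c2 H.
have -> : segint f2 a b - segint f1 a b = segint (fun y => f2 y - f1 y) a b.
  by rewrite /segint RintegralB //; exact: segment_integrable.
have cf : continuous_on_segment (fun y => f2 y - f1 y) a b.
  by move=> y hy; apply: continuousB; [exact: c2|exact: c1].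
rewrite ler_distl; apply/andP; split.
  rewrite -mulrBl; apply: segint_ge => // y /H; rewrite ler_distl.
  by move=> /andP[].
rewrite -mulrDl; apply: segint_le => // y /H; rewrite ler_distl.
by move=> /andP[].
Qed.

End SegmentIntegral.

Section Goursat.
Context {R : realType}.
Implicit Types (g : R[i] -> R[i]) (a b s h x y : R).

(** The imaginary part of the integral of g dz over the boundary of
    [a, a'] x [b, b'].  This real part of Cauchy's theorem suffices for the maximum
    principle, and only real functions have to be integrated. *)
Definition flux g a a' b b' : R :=
  (segint (fun y => complex.Re (g (a' +i* y))) b b' -
   segint (fun y => complex.Re (g (a +i* y))) b b') -
  (segint (fun x => complex.Im (g (x +i* b'))) a a' -
   segint (fun x => complex.Im (g (x +i* b))) a a').

Definition differentiable_on_rect g a a' b b' :=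
  forall x y, a <= x <= a' -> b <= y <= b' -> differentiable g (x +i* y).

Lemma differentiable_continuous_path g (p : R -> R[i]) x :
  (forall y, cmod (p y - p x) = `|y - x|) -> differentiable g (p x) ->
  {for x, continuous (fun y => complex.Re (g (p y)))} /\
  {for x, continuous (fun y => complex.Im (g (p y)))}.
Proof.
move=> pE /differentiable_near [K K0 [d d0 H]].
suff N e : 0 < e -> \forall t \near x, cmod (g (p t) - g (p x)) <= e.
  split; apply/cvgrPdist_le => e e0; near=> t; rewrite distrC -raddfB /=.
    by rewrite (le_trans (cmod_Re _)) //; near: t; exact: N.
  by rewrite (le_trans (cmod_Im _)) //; near: t; exact: N.
move=> e0; near=> t; have xt : `|t - x| < Num.min d (e / K).
  near: t; have m0 : 0 < Num.min d (e / K) by rewrite lt_min d0 divr_gt0.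
  by apply/nbhs_ballP; exists (Num.min d (e / K)) => //= u; rewrite /ball /= distrC.
move: xt; rewrite lt_min => /andP[xd xe].
have := H (p t); rewrite pE => /(_ xd) /le_trans; apply.
by rewrite mulrC -ler_pdivlMr // ltW.
Unshelve. all: by end_near. Qed.

Lemma cmod_vert (x y y' : R) : cmod ((x +i* y) - (x +i* y')) = `|y - y'|.
Proof.
have -> : (x +i* y) - (x +i* y') = (y - y')%:C * 'i.
  by apply/eqP; rewrite eq_complex /=; apply/andP; split; apply/eqP; ring.
by rewrite cmodM cmod_i mulr1 cmodR.
Qed.

Lemma cmod_horiz (x x' y : R) : cmod ((x +i* y) - (x' +i* y)) = `|x - x'|.
Proof.
have -> : (x +i* y) - (x' +i* y) = (x - x')%:C.
  by apply/eqP; rewrite eq_complex /=; apply/andP; split; apply/eqP; ring.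
by rewrite cmodR.
Qed.

Lemma vert_continuous g x b b' :
  (forall y, b <= y <= b' -> differentiable g (x +i* y)) ->
  continuous_on_segment (fun y => complex.Re (g (x +i* y))) b b'.
Proof.
move=> dg y /dg dgy.
by have [] := @differentiable_continuous_path g (fun y => x +i* y) y
  (fun t => cmod_vert _ _ _) dgy.
Qed.

Lemma horiz_continuous g y a a' :
  (forall x, a <= x <= a' -> differentiable g (x +i* y)) ->
  continuous_on_segment (fun x => complex.Im (g (x +i* y))) a a'.
Proof.
move=> dg x /dg dgx.
by have [] := @differentiable_continuous_path g (fun x => x +i* y) x
  (fun t => cmod_horiz _ _ _) dgx.
Qed.

Lemma flux_cut_vert g a c a' b b' : a <= c -> c <= a' ->
  (forall x, a <= x <= a' -> differentiable g (x +i* b)) ->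
  (forall x, a <= x <= a' -> differentiable g (x +i* b')) ->
  flux g a a' b b' = flux g a c b b' + flux g c a' b b'.
Proof.
move=> ac ca' d1 d2; rewrite /flux.
rewrite (@segint_split _ _ a c a') //; last exact: horiz_continuous.
rewrite [X in _ - (_ - X) = _](@segint_split _ _ a c a') //; first by ring.
exact: horiz_continuous.
Qed.

Lemma flux_cut_horiz g a a' b c b' : b <= c -> c <= b' ->
  (forall y, b <= y <= b' -> differentiable g (a +i* y)) ->
  (forall y, b <= y <= b' -> differentiable g (a' +i* y)) ->
  flux g a a' b b' = flux g a a' b c + flux g a a' c b'.
Proof.
move=> bc cb' d1 d2; rewrite /flux.
rewrite (@segint_split _ _ b c b') //; last exact: vert_continuous.
rewrite [X in (_ - X) - _ = _](@segint_split _ _ b c b') //; first by ring.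
exact: vert_continuous.
Qed.

Lemma sub_rect g a a' b b' a1 a1' b1 b1' :
  a <= a1 -> a1' <= a' -> b <= b1 -> b1' <= b' ->
  differentiable_on_rect g a a' b b' -> differentiable_on_rect g a1 a1' b1 b1'.
Proof.
move=> h1 h2 h3 h4 dg x y /andP[x1 x2] /andP[y1 y2]; apply: dg.
  by rewrite (le_trans h1 x1) (le_trans x2 h2).
by rewrite (le_trans h3 y1) (le_trans y2 h4).
Qed.

Lemma Re_affine_step (e1 e2 c D z0 : R[i]) a s y :
  complex.Re (e1 + (c + D * ((a + s) +i* y - z0))) -
  complex.Re (e2 + (c + D * (a +i* y - z0))) - complex.Re D * s =
  complex.Re (e1 - e2).
Proof. by case: e1 e2 c D z0 => [? ?] [? ?] [? ?] [? ?] [? ?] /=; ring. Qed.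

Lemma Im_affine_step (e1 e2 c D z0 : R[i]) x b h :
  complex.Im (e1 + (c + D * (x +i* (b + h) - z0))) -
  complex.Im (e2 + (c + D * (x +i* b - z0))) - complex.Re D * h =
  complex.Im (e1 - e2).
Proof. by case: e1 e2 c D z0 => [? ?] [? ?] [? ?] [? ?] [? ?] /=; ring. Qed.

(** The affine part of g contributes nothing: by the Cauchy-Riemann equations both
    differences of edges contribute Re D times the area.  Only the error term of the
    derivative remains. *)
Lemma flux_small g a s b h x0 y0 D e : 0 <= s -> 0 <= h -> 0 <= e ->
  differentiable_on_rect g a (a + s) b (b + h) ->
  a <= x0 <= a + s -> b <= y0 <= b + h ->
  (forall x y, a <= x <= a + s -> b <= y <= b + h ->
    cmod (g (x +i* y) - g (x0 +i* y0) - D * ((x +i* y) - (x0 +i* y0))) <=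
    e * cmod ((x +i* y) - (x0 +i* y0))) ->
  `|flux g a (a + s) b (b + h)| <= 2 * e * (s + h) ^+ 2.
Proof.
move=> s0 h0 e0 dg hx0 hy0 H.
pose z0 := x0 +i* y0.
pose E z := g z - g z0 - D * (z - z0).
have HE x y : a <= x <= a + s -> b <= y <= b + h -> cmod (E (x +i* y)) <= e * (s + h).
  move=> hx hy; rewrite (le_trans (H x y hx hy)) // ler_wpM2l //.
  rewrite (le_trans (cmod_ReIm _)) //= lerD //; rewrite ler_distl; lra.
have gE z : g z = E z + (g z0 + D * (z - z0)) by rewrite /E; ring.
have V : `|segint (fun y => complex.Re (g ((a + s) +i* y))) b (b + h) -
    segint (fun y => complex.Re (g (a +i* y))) b (b + h) -
    (complex.Re D * s) * (b + h - b)| <= 2 * e * (s + h) * (b + h - b).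
  apply: segintB_near => [|||y hy]; first lra.
  - by apply: vert_continuous => y hy; apply: dg => //; lra.
  - by apply: vert_continuous => y hy; apply: dg => //; lra.
  have -> : complex.Re (g ((a + s) +i* y)) - complex.Re (g (a +i* y)) - complex.Re D * s =
     complex.Re (E ((a + s) +i* y) - E (a +i* y)).
    by rewrite (gE ((a + s) +i* y)) (gE (a +i* y)) Re_affine_step.
  rewrite (le_trans (cmod_Re _)) // (le_trans (cmodB _ _)) //.
  have := HE (a + s) y; have := HE a y; move=> /(_ _ hy) h1 /(_ _ hy) h2.
  have {}h1 := h1 ltac:(lra); have {}h2 := h2 ltac:(lra).
  by rewrite (le_trans (lerD h2 h1)) //; lra.
have W : `|segint (fun x => complex.Im (g (x +i* (b + h)))) a (a + s) -
    segint (fun x => complex.Im (g (x +i* b))) a (a + s) -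
    (complex.Re D * h) * (a + s - a)| <= 2 * e * (s + h) * (a + s - a).
  apply: segintB_near => [|||x hx]; first lra.
  - by apply: horiz_continuous => x hx; apply: dg => //; lra.
  - by apply: horiz_continuous => x hx; apply: dg => //; lra.
  have -> : complex.Im (g (x +i* (b + h))) - complex.Im (g (x +i* b)) - complex.Re D * h =
     complex.Im (E (x +i* (b + h)) - E (x +i* b)).
    by rewrite (gE (x +i* (b + h))) (gE (x +i* b)) Im_affine_step.
  rewrite (le_trans (cmod_Im _)) // (le_trans (cmodB _ _)) //.
  have := HE x (b + h); have := HE x b; move=> /(_ hx) h1 /(_ hx) h2.
  have {}h1 := h1 ltac:(lra); have {}h2 := h2 ltac:(lra).
  by rewrite (le_trans (lerD h2 h1)) //; lra.
move: V W; rewrite /flux ler_norml !ler_distl => /andP[V1 V2] /andP[W1 W2].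
by apply/andP; split; lra.
Qed.

Lemma quarter_rect g a s b h : 0 <= s -> 0 <= h ->
  differentiable_on_rect g a (a + s) b (b + h) ->
  exists p : R * R, [/\ a <= p.1 <= a + s / 2, b <= p.2 <= b + h / 2 &
    `|flux g a (a + s) b (b + h)| <=
      4 * `|flux g p.1 (p.1 + s / 2) p.2 (p.2 + h / 2)|].
Proof.
move=> s0 h0 dg.
have E1 : a + s / 2 + s / 2 = a + s by lra.
have E2 : b + h / 2 + h / 2 = b + h by lra.
pose F1 := flux g a (a + s / 2) b (b + h / 2).
pose F2 := flux g a (a + s / 2) (b + h / 2) (b + h / 2 + h / 2).
pose F3 := flux g (a + s / 2) (a + s / 2 + s / 2) b (b + h / 2).
pose F4 := flux g (a + s / 2) (a + s / 2 + s / 2) (b + h / 2) (b + h / 2 + h / 2).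
have S : flux g a (a + s) b (b + h) = F1 + F2 + (F3 + F4).
  rewrite /F1 /F2 /F3 /F4 E1 E2 (@flux_cut_vert _ _ (a + s / 2)); first last.
  - by move=> x hx; apply: dg => //; lra.
  - by move=> x hx; apply: dg => //; lra.
  - lra.
  - lra.
  by congr (_ + _); apply: flux_cut_horiz; try lra; move=> y hy; apply: dg => //; lra.
have [/existsP|/existsPn N] := boolP [exists i : bool * bool,
   `|flux g a (a + s) b (b + h)| <=
    4 * `|flux g (a + i.1%:R * (s / 2)) (a + i.1%:R * (s / 2) + s / 2)
       (b + i.2%:R * (h / 2)) (b + i.2%:R * (h / 2) + h / 2)|].
  move=> [i Hi]; exists (a + i.1%:R * (s / 2), b + i.2%:R * (h / 2)); split => //=.
    by case: (i.1) => /=; lra.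
  by case: (i.2) => /=; lra.
have := N (false, false); have := N (false, true).
have := N (true, false); have := N (true, true).
rewrite /= !mul1r !mul0r !addr0 -!ltNge => n1 n2 n3 n4.
move: n1 n2 n3 n4; rewrite S -/F1 -/F2 -/F3 -/F4.
have := ler_normD (F1 + F2) (F3 + F4); have := ler_normD F1 F2; have := ler_normD F3 F4.
lra.
Qed.

Lemma half_power_small (c d : R) : 0 < d -> exists n, c / 2 ^+ n < d.
Proof.
move=> d0; have [c0|c0] := leP c 0.
  exists 0%N; rewrite expr0 divr1; lra.
exists (Num.bound (c / d)); rewrite ltr_pdivrMr ?exprn_gt0 // mulrC.
rewrite -ltr_pdivrMr //.
have := archi_boundP (ltW (divr_gt0 c0 d0)); move/lt_trans; apply.
by rewrite -natrX ltr_nat ltn_expl.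
Qed.

(** Quartering keeps a rectangle with at least a quarter of the flux; the flux would then
    decrease at most like the area, while at the limit point differentiability makes
    it a small multiple of the area. *)
Theorem flux_eq0 g a a' b b' : a <= a' -> b <= b' ->
  differentiable_on_rect g a a' b b' -> flux g a a' b b' = 0.
Proof.
move=> aa' bb' dg.
pose s := a' - a; pose h := b' - b.
have s0 : 0 <= s by rewrite /s; lra.
have h0 : 0 <= h by rewrite /h; lra.
pose S n := s / 2 ^+ n; pose H n := h / 2 ^+ n.
have S0 n : 0 <= S n by rewrite divr_ge0 // exprn_ge0.
have H0 n : 0 <= H n by rewrite divr_ge0 // exprn_ge0.
have SS n : S n.+1 = S n / 2 by rewrite /S exprS; field; rewrite expf_neq0 // pnatr_eq0.
have HS n : H n.+1 = H n / 2 by rewrite /H exprS; field; rewrite expf_neq0 // pnatr_eq0.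
have step (k : nat * (R * R)) : exists p : R * R,
    differentiable_on_rect g k.2.1 (k.2.1 + S k.1) k.2.2 (k.2.2 + H k.1) ->
    [/\ k.2.1 <= p.1 <= k.2.1 + S k.1 / 2, k.2.2 <= p.2 <= k.2.2 + H k.1 / 2 &
     `|flux g k.2.1 (k.2.1 + S k.1) k.2.2 (k.2.2 + H k.1)| <=
      4 * `|flux g p.1 (p.1 + S k.1 / 2) p.2 (p.2 + H k.1 / 2)|].
  have [d|nd] := pselect (differentiable_on_rect g k.2.1 (k.2.1 + S k.1) k.2.2 (k.2.2 + H k.1)).
    by have [p Hp] := quarter_rect (S0 k.1) (H0 k.1) d; exists p.
  by exists (0, 0) => /nd.
have [f Hf] := choice step.
pose fix u n := if n is k.+1 then f (k, u k) else (a, b).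
have E1 : a + s = a' by rewrite /s; ring.
have E2 : b + h = b' by rewrite /h; ring.
have I n : [/\ a <= (u n).1, (u n).1 + S n <= a', b <= (u n).2, (u n).2 + H n <= b' &
    `|flux g a a' b b'| <= 4 ^+ n *
      `|flux g (u n).1 ((u n).1 + S n) (u n).2 ((u n).2 + H n)|].
  elim: n => [|n [h1 h2 h3 h4 h5]].
    by split; rewrite /S /H /= ?expr0 ?divr1 ?E1 ?E2 ?mul1r.
  have [] := Hf (n, u n) => /=; first exact: (sub_rect h1 h2 h3 h4).
  rewrite -SS -HS => k1 k2 k3; split.
  - lra.
  - by move: k1; rewrite SS; lra.
  - lra.
  - by move: k2; rewrite HS; lra.
  - by rewrite (le_trans h5) // exprSr -mulrA ler_wpM2l // exprn_ge0.
have I' n := let: And5 h1 h2 h3 h4 _ := I n in sub_rect h1 h2 h3 h4 dg.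
have mono n : (u n).1 <= (u n.+1).1 /\ (u n).2 <= (u n.+1).2.
  by have [/andP[? _] /andP[? _] _] := Hf (n, u n) (I' n).
have monoS n : (u n.+1).1 + S n.+1 <= (u n).1 + S n /\ (u n.+1).2 + H n.+1 <= (u n).2 + H n.
  have [/andP[_ k1] /andP[_ k2] _] := Hf (n, u n) (I' n).
  by move: k1 k2; rewrite SS HS /=; lra.
have lim (v w : nat -> R) : (forall n, v n <= v n.+1) -> (forall n, w n.+1 <= w n) ->
    (forall n, v n <= w n) -> exists x, forall n, v n <= x <= w n.
  move=> vm wm vw.
  have vm' m n : (m <= n)%N -> v m <= v n.
    by apply: (homo_leq (@lexx _ R) (@le_trans _ R)) => k.
  have wm' m n : (m <= n)%N -> w n <= w m.
    move=> mn; apply: (homo_leq (r := fun x y => y <= x) _ _ _ mn) => //.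
    by move=> y x z; move=> /[swap]; exact: le_trans.
  exists (sup (range v)) => n; apply/andP; split.
    apply: ub_le_sup; last by exists n.
    exists (w 0) => _ [m _ <-]; exact: (le_trans (vw m) (wm' 0%N m (leq0n _))).
  apply: ge_sup; first by exists (v 0), 0%N.
  move=> _ [m _ <-]; apply: (le_trans (vm' m _ (leq_maxl m n))).
  exact: (le_trans (vw _) (wm' _ _ (leq_maxr m n))).
have [x Hx] := lim (fun n => (u n).1) (fun n => (u n).1 + S n) (fun n => (mono n).1)
   (fun n => (monoS n).1) (fun n => ltac:(by rewrite lerDl)).
have [y Hy] := lim (fun n => (u n).2) (fun n => (u n).2 + H n) (fun n => (mono n).2)
   (fun n => (monoS n).2) (fun n => ltac:(by rewrite lerDl)).
have dxy : differentiable g (x +i* y).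
  by apply: (I' 0%N); [exact: Hx|exact: Hy].
have [D HD] := differentiable_estimate dxy.
apply/normr0_eq0/eqP; rewrite eq_le normr_ge0 andbT.
apply/ler_addgt0Pr => e e0; rewrite add0r.
pose K := 2 * (s + h) ^+ 2 + 1.
have K0 : 0 < K by rewrite /K; have := sqr_ge0 (s + h); lra.
have [d d0 Hd] := HD (e / K) (divr_gt0 e0 K0).
have [n Hn] : exists n, S n + H n < d.
  have [n hn] := half_power_small (s + h) d0; exists n.
  by rewrite /S /H -mulrDl.
have [h1 h2 h3 h4 h5] := I n.
apply: (le_trans h5).
have hx : (u n).1 <= x <= (u n).1 + S n := Hx n.
have hy : (u n).2 <= y <= (u n).2 + H n := Hy n.
have eK : 0 <= e / K by rewrite ltW // divr_gt0.
have := @flux_small g (u n).1 (S n) (u n).2 (H n) x y D (e / K) (S0 n) (H0 n) eK (I' n) hx hy.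
move=> /(_ _)/wrap[x' y' hx' hy'|].
  apply: Hd; apply: le_lt_trans (Hn); rewrite (le_trans (cmod_ReIm _)) //=.
  by apply: lerD; rewrite ler_distl; lra.
have p0 : (0 : R) < 4 ^+ n by rewrite exprn_gt0.
move/(ler_wpM2l (ltW p0))/le_trans; apply.
have -> : 4 ^+ n * (2 * (e / K) * (S n + H n) ^+ 2) = 2 * (e / K) * (s + h) ^+ 2.
  have -> : (4 : R) ^+ n = 2 ^+ n * 2 ^+ n by rewrite -exprMn -natrM.
  rewrite /S /H; have : (2 : R) ^+ n != 0 by rewrite expf_neq0 // pnatr_eq0.
  by move: (2 ^+ n) => p p1; field; rewrite p1 gt_eqF.
rewrite (_ : _ * _ = e * (2 * (s + h) ^+ 2) / K); last by ring.
by rewrite ler_pdivrMr // ler_wpM2l ?ltW // /K; lra.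
Qed.

End Goursat.

(** * The maximum principle *)

Section DifferentiabilityRules.
Context {R : realType} {V : normedModType R[i]}.
Implicit Types (f g : V -> R[i]) (z : V).

Lemma differentiable_mul f g z : differentiable f z -> differentiable g z ->
  differentiable (fun w => f w * g w) z.
Proof. by move=> df dg; exact: (differentiableM df dg). Qed.

Lemma differentiable_sub f g z : differentiable f z -> differentiable g z ->
  differentiable (fun w => f w - g w) z.
Proof. by move=> df dg; exact: (differentiableB df dg). Qed.

Lemma differentiable_add f g z : differentiable f z -> differentiable g z ->
  differentiable (fun w => f w + g w) z.
Proof. by move=> df dg; exact: (differentiableD df dg). Qed.

Lemma differentiable_const (a : R[i]) z : differentiable (fun _ : V => a) z.
Proof. exact: differentiable_cst. Qed.

Lemma differentiable_exp f k z : differentiable f z ->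
  differentiable (fun w => f w ^+ k) z.
Proof.
move=> df; elim: k => [|k IH]; first by under eq_fun do rewrite expr0; exact: differentiable_const.
by under eq_fun do rewrite exprS; exact: differentiable_mul.
Qed.

Lemma differentiable_inverse f z : f z != 0 -> differentiable f z ->
  differentiable (fun w => (f w)^-1) z.
Proof. by move=> fz df; exact: (differentiableV df fz). Qed.

Lemma differentiable_bigsum (I : Type) (s : seq I) (F : I -> V -> R[i]) z :
  (forall i, differentiable (F i) z) -> differentiable (fun w => \sum_(i <- s) F i w) z.
Proof.
move=> dF; elim: s => [|i s IH].
  by under eq_fun do rewrite big_nil; exact: differentiable_const.
by under eq_fun do rewrite big_cons; exact: differentiable_add.
Qed.

Lemma differentiable_bigprod (I : Type) (s : seq I) (F : I -> V -> R[i]) z :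
  (forall i, differentiable (F i) z) -> differentiable (fun w => \prod_(i <- s) F i w) z.
Proof.
move=> dF; elim: s => [|i s IH].
  by under eq_fun do rewrite big_nil; exact: differentiable_const.
by under eq_fun do rewrite big_cons; exact: differentiable_mul.
Qed.

End DifferentiabilityRules.

Section MaximumPrinciple.
Context {R : realType}.
Implicit Types (f g : R[i] -> R[i]) (c z : R[i]) (s t M : R).

Lemma differentiable_shift (a z : R[i]) : differentiable (fun w : R[i] => w - a) z.
Proof. by apply: differentiable_sub => //; exact: differentiable_const. Qed.

Definition square_flux g c s : R :=
  flux g (complex.Re c - s) (complex.Re c + s) (complex.Im c - s) (complex.Im c + s).

Definition in_square c s z :=
  complex.Re c - s <= complex.Re z <= complex.Re c + s /\
  complex.Im c - s <= complex.Im z <= complex.Im c + s.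

(** The annulus between two concentric squares is cut into four rectangles avoiding c,
    on each of which Goursat's theorem applies. *)
Lemma square_flux_shrink g c s t : 0 < t -> t <= s ->
  (forall z, in_square c s z -> z != c -> differentiable g z) ->
  square_flux g c s = square_flux g c t.
Proof.
case: c => x y; rewrite /square_flux /= => t0 ts dg.
have D u v : x - s <= u <= x + s -> y - s <= v <= y + s -> (u != x) || (v != y) ->
    differentiable g (u +i* v).
  by move=> hu hv uv; apply: dg => //; rewrite eq_complex /= negb_and.
have Dx u v : x - s <= u <= x + s -> y - s <= v <= y + s -> u < x \/ x < u ->
    differentiable g (u +i* v).
  by move=> hu hv [h|h]; apply: D => //; rewrite neq_lt h ?orbT.
have Dy u v : x - s <= u <= x + s -> y - s <= v <= y + s -> v < y \/ y < v ->
    differentiable g (u +i* v).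
  by move=> hu hv [h|h]; apply: D => //; rewrite !neq_lt h ?orbT.
rewrite (@flux_cut_vert _ _ _ (x - t)); [|lra|lra| |]; first last.
- by move=> u hu; apply: Dy; lra.
- by move=> u hu; apply: Dy; lra.
rewrite (@flux_cut_vert _ _ (x - t) (x + t)); [|lra|lra| |]; first last.
- by move=> u hu; apply: Dy; lra.
- by move=> u hu; apply: Dy; lra.
rewrite (@flux_cut_horiz _ _ (x - t) (x + t) (y - s) (y - t)); [|lra|lra| |]; first last.
- by move=> u hu; apply: Dx; lra.
- by move=> u hu; apply: Dx; lra.
rewrite (@flux_cut_horiz _ _ (x - t) (x + t) (y - t) (y + t)); [|lra|lra| |]; first last.
- by move=> u hu; apply: Dx; lra.
- by move=> u hu; apply: Dx; lra.
rewrite (@flux_eq0 _ _ (x - s)); [|lra|lra|by move=> u v hu hv; apply: Dx; lra].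
rewrite (@flux_eq0 _ _ (x - t) (x + t) (y - s)); [|lra|lra|by move=> u v hu hv; apply: Dy; lra].
rewrite (@flux_eq0 _ _ (x - t) (x + t) (y + t)); [|lra|lra|by move=> u v hu hv; apply: Dy; lra].
rewrite (@flux_eq0 _ _ (x + t)); [|lra|lra|by move=> u v hu hv; apply: Dx; lra].
by ring.
Qed.

Lemma square_flux_le g c s M : 0 < s ->
  (forall z, in_square c s z -> z != c -> differentiable g z) ->
  (forall v, - s <= v <= s -> complex.Re (g (c + (s +i* v))) <= M) ->
  (forall v, - s <= v <= s -> - M <= complex.Re (g (c + (- s +i* v)))) ->
  (forall v, - s <= v <= s -> - M <= complex.Im (g (c + (v +i* s)))) ->
  (forall v, - s <= v <= s -> complex.Im (g (c + (v +i* - s))) <= M) ->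
  square_flux g c s <= 8 * s * M.
Proof.
case: c => x y s0 dg H1 H2 H3 H4; rewrite /square_flux /=.
have D u v : x - s <= u <= x + s -> y - s <= v <= y + s ->
    (u < x \/ x < u) \/ (v < y \/ y < v) -> differentiable g (u +i* v).
  move=> hu hv uv; apply: dg => //; rewrite eq_complex /= negb_and !neq_lt.
  by case: uv => -[->|->]; rewrite ?orbT.
have cV u v : (x +i* y) + (u +i* (v - y)) = (x + u) +i* v.
  by apply/eqP; rewrite eq_complex /=; apply/andP; split; apply/eqP; ring.
have cH u v : (x +i* y) + ((u - x) +i* v) = u +i* (y + v).
  by apply/eqP; rewrite eq_complex /=; apply/andP; split; apply/eqP; ring.
have := @segint_le _ (fun v => complex.Re (g ((x + s) +i* v))) (y - s) (y + s) M.
have := @segint_ge _ (fun v => complex.Re (g ((x - s) +i* v))) (y - s) (y + s) (- M).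
have := @segint_ge _ (fun v => complex.Im (g (v +i* (y + s)))) (x - s) (x + s) (- M).
have := @segint_le _ (fun v => complex.Im (g (v +i* (y - s)))) (x - s) (x + s) M.
rewrite /flux => h4 h3 h2 h1.
have {}h1 := h1 _ _ _; have {}h2 := h2 _ _ _; have {}h3 := h3 _ _ _; have {}h4 := h4 _ _ _.
have {}h1 := h1 ltac:(lra)
  ltac:(apply: vert_continuous => v hv; apply: D; [lra|lra|left; right; lra])
  ltac:(by move=> v hv; have := H1 (v - y); rewrite cV; apply; lra).
have {}h2 := h2 ltac:(lra)
  ltac:(apply: vert_continuous => v hv; apply: D; [lra|lra|left; left; lra])
  ltac:(by move=> v hv; have := H2 (v - y); rewrite cV; apply; lra).
have {}h3 := h3 ltac:(lra)
  ltac:(apply: horiz_continuous => v hv; apply: D; [lra|lra|right; right; lra])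
  ltac:(by move=> v hv; have := H3 (v - x); rewrite cH; apply; lra).
have {}h4 := h4 ltac:(lra)
  ltac:(apply: horiz_continuous => v hv; apply: D; [lra|lra|right; left; lra])
  ltac:(by move=> v hv; have := H4 (v - x); rewrite cH; apply; lra).
lra.
Qed.

Lemma square_flux_ge g c s M : 0 < s ->
  (forall z, in_square c s z -> z != c -> differentiable g z) ->
  (forall v, - s <= v <= s -> - M <= complex.Re (g (c + (s +i* v)))) ->
  (forall v, - s <= v <= s -> complex.Re (g (c + (- s +i* v))) <= M) ->
  (forall v, - s <= v <= s -> complex.Im (g (c + (v +i* s))) <= M) ->
  (forall v, - s <= v <= s -> - M <= complex.Im (g (c + (v +i* - s)))) ->
  - (8 * s * M) <= square_flux g c s.
Proof.
case: c => x y s0 dg H1 H2 H3 H4; rewrite /square_flux /=.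
have D u v : x - s <= u <= x + s -> y - s <= v <= y + s ->
    (u < x \/ x < u) \/ (v < y \/ y < v) -> differentiable g (u +i* v).
  move=> hu hv uv; apply: dg => //; rewrite eq_complex /= negb_and !neq_lt.
  by case: uv => -[->|->]; rewrite ?orbT.
have cV u v : (x +i* y) + (u +i* (v - y)) = (x + u) +i* v.
  by apply/eqP; rewrite eq_complex /=; apply/andP; split; apply/eqP; ring.
have cH u v : (x +i* y) + ((u - x) +i* v) = u +i* (y + v).
  by apply/eqP; rewrite eq_complex /=; apply/andP; split; apply/eqP; ring.
have := @segint_ge _ (fun v => complex.Re (g ((x + s) +i* v))) (y - s) (y + s) (- M).
have := @segint_le _ (fun v => complex.Re (g ((x - s) +i* v))) (y - s) (y + s) M.
have := @segint_le _ (fun v => complex.Im (g (v +i* (y + s)))) (x - s) (x + s) M.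
have := @segint_ge _ (fun v => complex.Im (g (v +i* (y - s)))) (x - s) (x + s) (- M).
rewrite /flux => h4 h3 h2 h1.
have {}h1 := h1 _ _ _; have {}h2 := h2 _ _ _; have {}h3 := h3 _ _ _; have {}h4 := h4 _ _ _.
have {}h1 := h1 ltac:(lra)
  ltac:(apply: vert_continuous => v hv; apply: D; [lra|lra|left; right; lra])
  ltac:(by move=> v hv; have := H1 (v - y); rewrite cV; apply; lra).
have {}h2 := h2 ltac:(lra)
  ltac:(apply: vert_continuous => v hv; apply: D; [lra|lra|left; left; lra])
  ltac:(by move=> v hv; have := H2 (v - y); rewrite cV; apply; lra).
have {}h3 := h3 ltac:(lra)
  ltac:(apply: horiz_continuous => v hv; apply: D; [lra|lra|right; right; lra])
  ltac:(by move=> v hv; have := H3 (v - x); rewrite cH; apply; lra).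
have {}h4 := h4 ltac:(lra)
  ltac:(apply: horiz_continuous => v hv; apply: D; [lra|lra|right; left; lra])
  ltac:(by move=> v hv; have := H4 (v - x); rewrite cH; apply; lra).
lra.
Qed.

Lemma le_limit0 (x K d : R) : 0 < d ->
  (forall t, 0 < t -> t < d -> x <= K * t) -> x <= 0.
Proof.
move=> d0 H; apply/ler_addgt0Pr => e e0; rewrite add0r.
pose t := Num.min (d / 2) (e / (1 + `|K|)).
have k0 : 0 < 1 + `|K| by rewrite ltr_pwDl.
have t0 : 0 < t by rewrite lt_min !divr_gt0.
have td : t < d by rewrite gt_min ltr_pdivrMr // ltr_pMr // ltr1n.
apply: (le_trans (H t t0 td)); apply: (@le_trans _ _ ((1 + `|K|) * t)).
  by rewrite ler_pM2r // (le_trans (ler_norm K)) // lerDr.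
by rewrite mulrC -ler_pdivlMr // ge_min lexx orbT.
Qed.

(** Cauchy's formula as an inequality.  After a rotation f c = r >= 0, and the flux of
    (f - r) / (z - c) vanishes, since it does not depend on the size of the square
    and the quotient is bounded near c.  On each edge the flux density of 1 / (z - c) is at
    least 1 / (2 s), so r is at most 2 M. *)
Lemma square_center_bound f c s M : 0 < s ->
  (forall z, in_square c s z -> differentiable f z) ->
  (forall z, in_square c s z -> s <= cmod (z - c) -> cmod (f z) <= M) ->
  cmod (f c) <= 2 * M.
Proof.
move=> s0 df fM.
have cc : in_square c s c by split; lra.
have [fc0|fc0] := eqVneq (f c) 0.
  rewrite fc0 cmod0 mulr_ge0 // (le_trans (cmod_ge0 (f (c + s%:C)))) //.
  apply: fM; first by case: (c) => x y; split => /=; lra.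
  by rewrite addrAC subrr add0r cmodR gtr0_norm.
pose r := cmod (f c); have r0 : 0 < r by rewrite cmod_gt0.
have [u [u1 uf]] : exists u, cmod u = 1 /\ u * f c = r%:C.
  exists (r%:C * (f c)^-1); split; last by rewrite mulfVK.
  by rewrite cmodM cmodV cmodR gtr0_norm // divff // gt_eqF.
pose g z := (u * f z - r%:C) * (z - c)^-1.
have dg z : in_square c s z -> z != c -> differentiable g z.
  move=> zs zc; apply: differentiable_mul.
    apply: differentiable_sub; last exact: differentiable_const.
    by apply: differentiable_mul; [exact: differentiable_const|exact: df].
  by apply: differentiable_inverse; [rewrite subr_eq0|exact: differentiable_shift].
have [K K0 [d d0 Hd]] := differentiable_near (df c cc).
have gK z : cmod (z - c) < d -> z != c -> cmod (g z) <= K.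
  move=> zd zc; rewrite /g -uf -mulrBr !cmodM u1 mul1r cmodV ler_pdivrMr.
    exact: Hd.
  by rewrite cmod_gt0 subr_eq0.
have flux0 : 0 <= square_flux g c s.
  have E t : 0 < t -> t < Num.min s (d / 2) -> - (8 * K * t) <= square_flux g c s.
    move=> t0; rewrite lt_min => /andP[ts td].
    rewrite (square_flux_shrink t0 (ltW ts) dg).
    have dg' z : in_square c t z -> z != c -> differentiable g z.
      by move=> [h1 h2]; apply: dg; split; lra.
    have near v w : - t <= v <= t -> - t <= w <= t -> (`|v| = t) \/ (`|w| = t) ->
        cmod (g (c + (v +i* w))) <= K.
      move=> hv hw vw; apply: gK.
        rewrite addrAC subrr add0r (le_lt_trans (cmod_ReIm _)) //=.
        by apply: (@le_lt_trans _ _ (t + t)); [apply: lerD; rewrite ler_norml; lra|lra].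
      rewrite -subr_eq0 addrAC subrr add0r eq_complex /= negb_and.
      by case: vw => vw; rewrite -!normr_gt0 vw t0 ?orbT.
    have tt : `|t| = t by rewrite gtr0_norm.
    have nt : `|- t| = t by rewrite normrN.
    have bR v w h1 h2 h3 := le_trans (cmod_Re _) (near v w h1 h2 h3).
    have bI v w h1 h2 h3 := le_trans (cmod_Im _) (near v w h1 h2 h3).
    rewrite (_ : 8 * K * t = 8 * t * K); last by ring.
    apply: square_flux_ge => // v hv.
    + by have := bR t v; rewrite ler_norml => h; have /andP[] := h ltac:(lra) hv (or_introl tt).
    + by have := bR (- t) v; rewrite ler_norml => h; have /andP[] := h ltac:(lra) hv (or_introl nt).
    + by have := bI v t; rewrite ler_norml => h; have /andP[] := h hv ltac:(lra) (or_intror tt).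
    + by have := bI v (- t); rewrite ler_norml => h; have /andP[] := h hv ltac:(lra) (or_intror nt).
  rewrite -oppr_le0; apply: (@le_limit0 _ (8 * K) (Num.min s (d / 2))).
    by rewrite lt_min s0 divr_gt0.
  by move=> t t0 td; have := E t t0 td; lra.
(* the bound for the flux density of (f - r) / (z - c) on every edge *)
pose M' := (2 * M - r) / (2 * s).
have fM' v w : - s <= v <= s -> - s <= w <= s -> (`|v| = s) \/ (`|w| = s) ->
    cmod (f (c + (v +i* w))) <= M.
  move=> hv hw vw; apply: fM.
    by case: (c) => x y; split => /=; lra.
  rewrite addrAC subrr add0r; case: vw => <-; first exact: (cmod_Re (v +i* w)).
  exact: (cmod_Im (v +i* w)).
have ss : `|s| = s by rewrite gtr0_norm.
have ns : `|- s| = s by rewrite normrN.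
have cs v w : (`|v| = s) \/ (`|w| = s) -> s <= cmod (v +i* w).
  by case=> <-; [exact: (cmod_Re (v +i* w))|exact: (cmod_Im (v +i* w))].
have gE v w : g (c + (v +i* w)) = u * f (c + (v +i* w)) * (v +i* w)^-1 - r%:C * (v +i* w)^-1.
  by rewrite /g [c + _ - c]addrAC subrr add0r mulrBl.
have qM v w : - s <= v <= s -> - s <= w <= s -> (`|v| = s) \/ (`|w| = s) ->
    cmod (u * f (c + (v +i* w)) * (v +i* w)^-1) <= M / s.
  move=> hv hw vw; rewrite !cmodM u1 mul1r cmodV ler_pM ?cmod_ge0 ?invr_ge0 ?cmod_ge0 //.
    exact: fM'.
  by rewrite lef_pV2 ?posrE // ?cs // (lt_le_trans s0) // cs.
have qR v w h1 h2 h3 := le_trans (cmod_Re _) (qM v w h1 h2 h3).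
have qI v w h1 h2 h3 := le_trans (cmod_Im _) (qM v w h1 h2 h3).
have inv v : - s <= v <= s -> r / (2 * s) <= r * (s / (s ^+ 2 + v ^+ 2)).
  move=> hv; rewrite ler_pM2l //.
  have p : 0 < s ^+ 2 + v ^+ 2 by rewrite ltr_wpDr ?sqr_ge0 // exprn_gt0.
  have e : (2 * s)^-1 * (2 * s) = 1 by rewrite mulVf // mulf_neq0 // ?pnatr_eq0 // gt_eqF.
  rewrite ler_pdivlMr // mulrC ler_pdivrMr ?mulr_gt0 //.
  by nra.
have M'E : M' = M / s - r / (2 * s) by rewrite /M'; field; rewrite gt_eqF.
have : square_flux g c s <= 8 * s * M'.
  apply: square_flux_le => // v hv; rewrite gE raddfB /=.
  + have := qR s v; rewrite ler_norml => h; have /andP[_ {}h] := h ltac:(lra) hv (or_introl ss).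
    by have := inv v hv; rewrite mul0r subr0 M'E; move: h => /=; lra.
  + have := qR (- s) v; rewrite ler_norml => h; have /andP[{}h _] := h ltac:(lra) hv (or_introl ns).
    by have := inv v hv; rewrite mul0r subr0 M'E sqrrN mulNr mulrN; move: h => /=; lra.
  + have := qI v s; rewrite ler_norml => h; have /andP[{}h _] := h hv ltac:(lra) (or_intror ss).
    by have := inv v hv; rewrite mul0r addr0 M'E [v ^+ 2 + _]addrC mulrN; move: h => /=; lra.
  + have := qI v (- s); rewrite ler_norml => h; have /andP[_ {}h] := h hv ltac:(lra) (or_intror ns).
    by have := inv v hv; rewrite mul0r addr0 M'E [v ^+ 2 + _]addrC sqrrN mulNr opprK; move: h => /=; lra.
move/(le_trans flux0).
have -> : 8 * s * M' = 4 * (2 * M - r) by rewrite /M'; field; rewrite gt_eqF.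
by rewrite pmulr_rge0 // subr_ge0.
Qed.

Lemma pow_bound_le (x M K : R) : 0 <= x -> 0 <= M ->
  (forall k, x ^+ k <= K * M ^+ k) -> x <= M.
Proof.
move=> x0 M0 H; rewrite leNgt; apply/negP => Mx.
have [M00|Mn0] := eqVneq M 0.
  have := H 1%N; rewrite M00 !expr1 mulr0 => h; move: Mx; rewrite M00; lra.
have Mp : 0 < M by rewrite lt_def Mn0.
have q k : (x / M) ^+ k <= K by rewrite expr_div_n ler_pdivrMr ?exprn_gt0.
pose e := x / M - 1.
have e0 : 0 < e by rewrite /e subr_gt0 ltr_pdivlMr // mul1r.
have B k : 1 + k%:R * e <= (x / M) ^+ k.
  elim: k => [|k IH]; first by rewrite mul0r addr0 expr0.
  have xe : x / M = 1 + e by rewrite /e; ring.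
  rewrite exprS xe -natr1; rewrite xe in IH.
  apply: (@le_trans _ _ ((1 + e) * (1 + k%:R * e))); last by rewrite ler_pM2l //; lra.
  have : 0 <= k%:R * e * e :> R by rewrite !mulr_ge0 // ltW.
  lra.
have K0 : 0 <= K / e.
  by rewrite divr_ge0 ?(ltW e0) //; have := q 0%N; rewrite expr0; lra.
have := archi_boundP K0; set N := Num.bound _ => hN.
have := le_trans (B N) (q N); move: hN; rewrite ltr_pdivrMr //; lra.
Qed.

(** Maximum principle with removable singularities: multiply a high power of f
    by a fixed polynomial with double zeros at the singular points, and let
    the power absorb the constants. *)
Theorem maximum_principle f (S : seq R[i]) c s M : 0 < s -> c \notin S ->
  (forall z, in_square c s z -> z \notin S -> differentiable f z) ->
  (forall z, in_square c s z -> z \in S -> exists K, exists2 d : R, 0 < d &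
     forall w, cmod (w - z) < d -> w \notin S -> cmod (f w) <= K) ->
  (forall z, in_square c s z -> s <= cmod (z - c) -> cmod (f z) <= M) ->
  cmod (f c) <= M.
Proof.
move=> s0 cS df fS fM.
have M0 : 0 <= M.
  rewrite (le_trans (cmod_ge0 (f (c + s%:C)))) //.
  apply: fM; first by case: (c) => x y; split => /=; lra.
  by rewrite addrAC subrr add0r cmodR gtr0_norm.
pose om z := \prod_(a <- S) (z - a).
have dom z : differentiable om z.
  by apply: differentiable_bigprod => a; exact: differentiable_shift.
have om0 z : (om z == 0) = (z \in S).
  rewrite prodf_seq_eq0; apply/hasP/idP => [[a aS]|zS]; last by exists z; rewrite ?subrr /=.
  by rewrite subr_eq0 => /eqP ->.
pose W := \prod_(a <- S) (2 * s + cmod (c - a)).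
have omW z : in_square c s z -> cmod (om z) <= W.
  move=> [h1 h2]; rewrite /om /W.
  apply: (big_ind2 (fun x y => cmod x <= y)) => [|x1 x2 y1 y2 k1 k2|a _].
  - by rewrite cmod1.
  - by rewrite cmodM ler_pM ?cmod_ge0.
  - rewrite -(subrK c z) -addrA (le_trans (cmodD _ _)) // lerD2r.
    rewrite (le_trans (cmod_ReIm _)) // (_ : 2 * s = s + s); last by ring.
    by rewrite !raddfB /= lerD // ler_norml; lra.
have W0 : 0 <= W.
  by rewrite (le_trans (cmod_ge0 (om c))) // omW //; split; lra.
pose g k z := f z ^+ k * om z ^+ 2.
have H k : cmod (g k c) <= 2 * (M ^+ k * W ^+ 2).
  apply: (@square_center_bound _ _ s) => // [z zs|z zs zc]; last first.
    by rewrite /g cmodM !cmodX ler_pM ?exprn_ge0 ?cmod_ge0 // lerXn2r ?nnegrE ?cmod_ge0 ?fM ?omW.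
  have [zS|zS] := boolP (z \in S); last first.
    apply: differentiable_mul; last exact: differentiable_exp.
    by apply: differentiable_exp; exact: df.
  have [K [d d0 Hd]] := fS z zs zS.
  have [L L0 [d' d'0 Hd']] := differentiable_near (dom z).
  have omz : om z = 0 by apply/eqP; rewrite om0.
  pose C := `|K| ^+ k * L ^+ 2 + 1.
  have C0 : 0 < C by rewrite ltr_pwDr // mulr_ge0 ?exprn_ge0 // ltW.
  apply: (@differentiable_from_estimate _ _ _ 0) => e e0.
  exists (Num.min (Num.min d d') (e / C)).
    by rewrite !lt_min d0 d'0 divr_gt0.
  move=> w; rewrite !lt_min => /andP[/andP[wd wd'] we].
  have -> : g k z = 0 by rewrite /g omz expr0n mulr0.
  rewrite subr0 mul0r subr0 /g.
  have [wS|wS] := boolP (w \in S).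
    have -> : om w = 0 by apply/eqP; rewrite om0.
    by rewrite expr0n mulr0 cmod0 mulr_ge0 ?cmod_ge0 // ltW.
  rewrite cmodM !cmodX.
  have h1 : cmod (f w) ^+ k <= `|K| ^+ k.
    by rewrite lerXn2r ?nnegrE ?cmod_ge0 // (le_trans (Hd w wd wS)) // ler_norm.
  have h2 : cmod (om w) ^+ 2 <= L ^+ 2 * cmod (w - z) ^+ 2.
    have := Hd' w wd'; rewrite omz subr0 => h.
    by rewrite -exprMn lerXn2r ?nnegrE ?cmod_ge0 // mulr_ge0 ?cmod_ge0 // ltW.
  apply: (le_trans (ler_pM _ _ h1 h2)); rewrite ?exprn_ge0 ?cmod_ge0 //.
  rewrite [cmod (w - z) ^+ 2]expr2 !mulrA ler_wpM2r ?cmod_ge0 //.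
  apply: (@le_trans _ _ (C * cmod (w - z))).
    by apply: ler_wpM2r; [exact: cmod_ge0|rewrite /C expr2 mulrA lerDl ler01].
  by rewrite mulrC -ler_pdivlMr // ltW.
have oc : 0 < cmod (om c) ^+ 2 by rewrite exprn_gt0 // cmod_gt0 om0.
apply: (@pow_bound_le _ _ (2 * W ^+ 2 / cmod (om c) ^+ 2)) => //; first exact: cmod_ge0.
move=> k; rewrite mulrAC ler_pdivlMr //.
have := H k; rewrite /g cmodM !cmodX => h; rewrite (le_trans h) //.
by rewrite [M ^+ k * _]mulrC mulrA.
Qed.

End MaximumPrinciple.

(** * Newton interpolation of bounded holomorphic functions *)

Section NewtonInterpolation.
Context {R : realType}.
Implicit Types (h : R[i] -> R[i]) (t z : R[i]) (B : R).

(** Distinct real nodes, the same for every order of interpolation.  They are kept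
    distinct, instead of all being 0, so that each coefficient is a finite combination of
    values of the function and depends holomorphically on further variables. *)
Definition node (k : nat) : R[i] := ((16 * k.+1%:R)^-1 : R)%:C.

(** At node k' itself the quotient has the default value 0; this is harmless, as the
    formula below multiplies it by t - node k' and the bounds avoid the earlier nodes. *)
Fixpoint newton h k t : R[i] :=
  if k is k'.+1 then (newton h k' t - newton h k' (node k')) * (t - node k')^-1
  else h t.

Definition divided_difference h k : R[i] := newton h k (node k).

Definition nodes k := [seq node j | j <- iota 0 k].

Definition node_poly k t : R[i] := \prod_(j < k) (t - node j).

Lemma node_inj : injective node.
Proof.
move=> j k /complexI /invr_inj /mulfI; rewrite pnatr_eq0 => /(_ isT) /eqP.
by rewrite eqr_nat => /eqP [].
Qed.

Lemma mem_nodes j k : (node j \in nodes k) = (j < k)%N.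
Proof. by rewrite mem_map ?mem_iota //; exact: node_inj. Qed.

Lemma mem_nodesS t k : (t \in nodes k.+1) = (t \in nodes k) || (t == node k).
Proof. by rewrite /nodes -addn1 iotaD map_cat mem_cat /= inE. Qed.

Lemma cmod_node k : cmod (node k) <= 1 / 16.
Proof.
rewrite cmodR ger0_norm ?invr_ge0 ?mulr_ge0 // div1r lef_pV2 ?posrE ?mulr_gt0 //.
by rewrite ler_pMr // ler1n.
Qed.

Lemma cmod_node_lt1 k : cmod (node k) < 1.
Proof. by rewrite (le_lt_trans (cmod_node k)) //; lra. Qed.

Lemma cmod_sub_ge z t : cmod z - cmod t <= cmod (z - t).
Proof. by rewrite lerBlDr -{1}(subrK t z) cmodD. Qed.

Section OneVariable.
Variables (h : R[i] -> R[i]) (B : R).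
Hypothesis dh : forall t, cmod t < 1 -> differentiable h t.
Hypothesis hB : forall t, cmod t < 1 -> cmod (h t) <= B.

Lemma newton_differentiable k t : cmod t < 1 -> t \notin nodes k ->
  differentiable (newton h k) t.
Proof.
move=> t1; elim: k => [|k IH] tk; first exact: dh.
move: tk; rewrite mem_nodesS negb_or => /andP[tk tnk].
apply: differentiable_mul.
  by apply: differentiable_sub; [exact: IH|exact: differentiable_const].
by apply: differentiable_inverse; [rewrite subr_eq0|exact: differentiable_shift].
Qed.

(** The quotients are bounded near the nodes already used, which makes these nodes
    removable singularities for the maximum principle. *)
Lemma newton_near_node k t : cmod t < 1 -> t \in nodes k ->
  exists K, exists2 d : R, 0 < d & forall w, cmod (w - t) < d -> w \notin nodes k ->
    cmod (newton h k w) <= K.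
Proof.
move=> t1; elim: k => [|k IH] //.
rewrite mem_nodesS => /orP[tk|/eqP ->].
  have [K [d d0 H]] := IH tk.
  have tn : 0 < cmod (t - node k).
    rewrite cmod_gt0 subr_eq0; apply: contraTneq tk => ->.
    by rewrite mem_nodes ltnn.
  set e := cmod (t - node k) in tn.
  exists ((K + cmod (newton h k (node k))) * (e / 2)^-1).
  exists (Num.min d (e / 2)); first by rewrite lt_min d0 divr_gt0.
  move=> w; rewrite lt_min => /andP[wd we].
  rewrite mem_nodesS negb_or => /andP[wk wnk] /=.
  have K0 : cmod (newton h k w) <= K by exact: H.
  rewrite cmodM cmodV ler_pM ?cmod_ge0 ?invr_ge0 ?cmod_ge0 //.
    by rewrite (le_trans (cmodB _ _)) // lerD2r.
  have ew : e / 2 <= cmod (w - node k).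
    have := cmod_sub_ge (t - node k) (t - w).
    have -> : t - node k - (t - w) = w - node k by ring.
    by rewrite -/e (cmod_distC t); lra.
  by rewrite lef_pV2 ?posrE ?divr_gt0 // (lt_le_trans _ ew) // divr_gt0.
have nk : node k \notin nodes k by rewrite mem_nodes ltnn.
have [K K0 [d d0 H]] := differentiable_near (newton_differentiable (cmod_node_lt1 k) nk).
exists K, d => // w wd; rewrite mem_nodesS negb_or => /andP[wk wnk] /=.
by rewrite cmodM cmodV ler_pdivrMr ?H // cmod_gt0 subr_eq0.
Qed.

(** The maximum principle on a square of half side 1/2 transports the bound from
    7/16 <= |t| < 1, where the denominators are at least 3/8, to the nodes. *)
Lemma newton_bound k :
  (forall t, 7 / 16 <= cmod t -> cmod t < 1 -> cmod (newton h k t) <= 6 ^+ k * B) /\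
  (forall t, cmod t <= 1 / 16 -> t \notin nodes k -> cmod (newton h k t) <= 6 ^+ k * B).
Proof.
have B0 : 0 <= B by rewrite (le_trans (cmod_ge0 (h 0))) // hB // cmod0.
have core j : (forall t, 7 / 16 <= cmod t -> cmod t < 1 -> cmod (newton h j t) <= 6 ^+ j * B) ->
   (forall t, cmod t <= 1 / 16 -> t \notin nodes j -> cmod (newton h j t) <= 6 ^+ j * B).
  move=> H t t16 tj.
  have sq1 z : in_square t 2^-1 z -> cmod z < 1.
    move=> [h1 h2].
    have : cmod (z - t) <= 3 / 4.
      rewrite -ler_sqr ?nnegrE ?cmod_ge0 ?divr_ge0 //.
      rewrite -lecR rmorphXn /= -normE -add_Re2_Im2 lecR !raddfB /=; nra.
    by have := cmodD (z - t) t; rewrite subrK; lra.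
  apply: (@maximum_principle _ _ (nodes j) t 2^-1) => //.
  - by move=> z /sq1 z1; exact: newton_differentiable.
  - by move=> z /sq1 z1; exact: newton_near_node.
  - move=> z zs zt; apply: H; last exact: sq1.
    have := cmod_sub_ge z 0; have := cmodB z t; lra.
have reg : forall t, 7 / 16 <= cmod t -> cmod t < 1 -> cmod (newton h k t) <= 6 ^+ k * B.
  elim: k => [|k IH] t t7 t1; first by rewrite expr0 mul1r hB.
  (* 16 / 3 <= 6 is the growth factor of one quotient *)
  have tn : 3 / 8 <= cmod (t - node k).
    by have := cmod_sub_ge t (node k); have := cmod_node k; lra.
  rewrite /= cmodM cmodV ler_pdivrMr; last lra.
  rewrite (le_trans (cmodB _ _)) //.
  have h1 := IH t t7 t1.
  have h2 : cmod (newton h k (node k)) <= 6 ^+ k * B.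
    by apply: core => //; [exact: cmod_node|rewrite mem_nodes ltnn].
  have e0 : 0 <= 6 ^+ k * B by rewrite mulr_ge0 // exprn_ge0.
  rewrite exprS; nra.
by split => //; exact: core.
Qed.

Lemma divided_difference_bound k : cmod (divided_difference h k) <= 6 ^+ k * B.
Proof. by apply: (newton_bound k).2; [exact: cmod_node|rewrite mem_nodes ltnn]. Qed.

Lemma newton_expansion N t :
  h t = \sum_(k < N) divided_difference h k * node_poly k t + newton h N t * node_poly N t.
Proof.
elim: N => [|N IH]; first by rewrite big_ord0 add0r /node_poly big_ord0 mulr1.
rewrite [in LHS]IH big_ord_recr /= -addrA; congr (_ + _).
rewrite [node_poly N.+1 t]/node_poly big_ord_recr /= -/(node_poly N t) /divided_difference.
have [->|tN] := eqVneq t (node N); first by rewrite !subrr !mulr0 addr0.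
by rewrite [X in _ + _ * X]mulrC mulrA mulfVK ?subr_eq0 // mulrBl addrC subrK.
Qed.

Lemma node_poly_bound k t : cmod t <= 1 / 16 -> cmod (node_poly k t) <= (1 / 8) ^+ k.
Proof.
move=> t16; elim: k => [|k IH]; first by rewrite /node_poly big_ord0 cmod1 expr0.
rewrite /node_poly big_ord_recr /= cmodM exprSr ler_pM ?cmod_ge0 //.
by rewrite (le_trans (cmodB _ _)) //; have := cmod_node k; lra.
Qed.

Lemma node_poly_root N t : t \in nodes N -> node_poly N t = 0.
Proof.
move=> /mapP[j]; rewrite mem_iota add0n => /andP[_ jN] ->.
by rewrite /node_poly (bigD1 (Ordinal jN)) //= subrr mul0r.
Qed.

Lemma newton_remainder_bound N t : cmod t <= 1 / 16 ->
  cmod (newton h N t * node_poly N t) <= (3 / 4) ^+ N * B.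
Proof.
move=> t16; have B0 : 0 <= B by rewrite (le_trans (cmod_ge0 (h 0))) // hB // cmod0.
have [tN|tN] := boolP (t \in nodes N).
  by rewrite node_poly_root // mulr0 cmod0 mulr_ge0 // exprn_ge0 //; lra.
rewrite cmodM; apply: (le_trans (ler_pM _ _ ((newton_bound N).2 t t16 tN) (node_poly_bound N t16))).
- exact: cmod_ge0.
- exact: cmod_ge0.
have -> : 3 / 4 = 6 * (1 / 8) :> R by field.
by rewrite [(6 * _) ^+ _]exprMn; lra.
Qed.

(** The first step of the scheme is a Schwarz lemma at the first node. *)
Lemma schwarz_bound t : cmod t <= 1 / 16 ->
  cmod (h t - h (node 0)) <= 6 * B * cmod (t - node 0).
Proof.
move=> t16; have [->|tn] := eqVneq t (node 0); first by rewrite !subrr cmod0 mulr0.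
have := (newton_bound 1).2 t t16; rewrite /nodes /= inE => /(_ tn).
by rewrite expr1 cmodM cmodV ler_pdivrMr // cmod_gt0 subr_eq0.
Qed.

End OneVariable.

Lemma newtonB h1 h2 k t : newton (fun a => h1 a - h2 a) k t = newton h1 k t - newton h2 k t.
Proof. by elim: k t => [//|k IH] t /=; rewrite !IH; ring. Qed.

Lemma newton_parameter (h : R[i] -> R[i] -> R[i]) a0 k z : cmod z < 1 ->
  (forall t, cmod t < 1 -> differentiable (fun a => h a t) a0) ->
  differentiable (fun a => newton (h a) k z) a0.
Proof.
move=> z1 dh; elim: k z z1 => [|k IH] z z1 /=; first exact: dh.
apply: differentiable_mul; last exact: differentiable_const.
by apply: differentiable_sub; apply: IH => //; exact: cmod_node_lt1.
Qed.

End NewtonInterpolation.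

Section SeveralVariables.
Context {R : realType} {I : eqType}.
Implicit Types (H G : (I -> R[i]) -> R[i]) (t u : I -> R[i]) (i j : I) (a : R[i]) (B : R).

Definition upd t i a : I -> R[i] := fun j => if j == i then a else t j.

Definition polydisc t := forall i, cmod (t i) < 1.

(** Holomorphy is used one variable at a time only. *)
Definition separately_holomorphic H := forall t i, polydisc t ->
  differentiable (fun a => H (upd t i a)) (t i).

Definition bounded_on_polydisc H B := forall t, polydisc t -> cmod (H t) <= B.

Definition partial_difference i k H t := divided_difference (fun a => H (upd t i a)) k.

Fixpoint newton_coef (s : seq I) (al : seq nat) H : (I -> R[i]) -> R[i] :=
  match s, al with
  | i :: s', k :: al' => partial_difference i k (newton_coef s' al' H)
  | _, _ => H
  end.

Lemma polydisc_upd t i a : polydisc t -> cmod a < 1 -> polydisc (upd t i a).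
Proof. by move=> pt a1 j; rewrite /upd; case: eqP. Qed.

Lemma upd_upd t i a b : upd (upd t i a) i b = upd t i b.
Proof. by apply/funext => j; rewrite /upd; case: eqP. Qed.

Lemma upd_comm t i j a b : i != j -> upd (upd t i a) j b = upd (upd t j b) i a.
Proof.
move=> ij; apply/funext => k; rewrite /upd.
by have [->|//] := eqVneq k j; rewrite eq_sym (negbTE ij).
Qed.

Lemma upd_id t i : upd t i (t i) = t.
Proof. by apply/funext => j; rewrite /upd; case: eqP => [->|]. Qed.

Lemma separately_holomorphic_slice H t i a : separately_holomorphic H ->
  polydisc t -> cmod a < 1 -> differentiable (fun b => H (upd t i b)) a.
Proof.
move=> hH pt a1; have := hH (upd t i a) i (polydisc_upd i pt a1).
by rewrite /upd eqxx -/(upd t i a); under eq_fun do rewrite -/(upd _ i _) upd_upd.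
Qed.

(** In the variable i the difference is constant; in another variable it is a combination
    of slices of H. *)
Lemma partial_difference_holomorphic i k H :
  separately_holomorphic H -> separately_holomorphic (partial_difference i k H).
Proof.
move=> hH t j pt; apply: (@newton_parameter _ (fun b a => H (upd (upd t j b) i a))).
  exact: cmod_node_lt1.
move=> z z1; have [->|ij] := eqVneq j i.
  by under eq_fun do rewrite upd_upd; exact: differentiable_const.
under eq_fun do rewrite upd_comm //.
by apply: separately_holomorphic_slice => //; exact: polydisc_upd.
Qed.

Lemma partial_difference_bound i k H B : separately_holomorphic H ->
  bounded_on_polydisc H B -> bounded_on_polydisc (partial_difference i k H) (6 ^+ k * B).
Proof.
move=> hH HB t pt; apply: divided_difference_bound => a a1.
  exact: separately_holomorphic_slice.
by apply: HB; exact: polydisc_upd.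
Qed.

Lemma newton_coef_holomorphic s al H : separately_holomorphic H ->
  separately_holomorphic (newton_coef s al H).
Proof.
move=> hH; elim: s al => [|i s IH] [|k al] //=.
exact: partial_difference_holomorphic.
Qed.

Lemma newton_coef_bound s al H B : size al = size s -> separately_holomorphic H ->
  bounded_on_polydisc H B ->
  bounded_on_polydisc (newton_coef s al H) (6 ^+ sumn al * B).
Proof.
move=> + hH HB; elim: s al => [|i s IH] [|k al] //= => [_|[sz]]; first by rewrite expr0 mul1r.
rewrite exprD -mulrA; apply: partial_difference_bound; last exact: IH.
exact: newton_coef_holomorphic.
Qed.

Lemma newton_coefB s al H G t :
  newton_coef s al (fun u => H u - G u) t = newton_coef s al H t - newton_coef s al G t.
Proof.
elim: s al t => [|i s IH] [|k al] t //=.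
rewrite /partial_difference /divided_difference -newtonB; congr newton.
by apply/funext => a.
Qed.

Lemma newton_coef_indep s al H t u : size al = size s ->
  (forall j, j \notin s -> t j = u j) -> newton_coef s al H t = newton_coef s al H u.
Proof.
elim: s al t u => [|i s IH] [|k al] t u //=.
  by move=> _ tu; congr H; apply/funext => j; exact: tu.
move=> [sz] tu; rewrite /partial_difference; congr divided_difference.
apply/funext => a; apply: IH => // j js; rewrite /upd; case: eqVneq => // ji.
by apply: tu; rewrite inE negb_or ji.
Qed.

Lemma geometric_sum_le (x : R) N : 0 <= x -> x < 1 -> \sum_(k < N) x ^+ k <= (1 - x)^-1.
Proof.
move=> x0 x1; have p : 0 < 1 - x by rewrite subr_gt0.
rewrite -(ler_pM2l p) mulfV ?gt_eqF // (_ : _ * _ = 1 - x ^+ N) ?gerBl ?exprn_ge0 //.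
by rewrite -[1 - x ^+ N]opprB subrX1 -mulNr opprB.
Qed.

(** Expand one variable after the other.  The term 6 ^+ sumn al * b in the hypothesis
    carries the remainders of the variables already expanded: coefficients of large order
    have a worse remainder, which the factors (1 / 8) ^+ k compensate. *)
Lemma newton_coef_norming s H B N t (tau b : R) : separately_holomorphic H ->
  bounded_on_polydisc H B -> polydisc t -> (forall i, i \in s -> cmod (t i) <= 1 / 16) ->
  0 <= tau -> 0 <= b ->
  (forall al, size al = size s -> all (fun k => (k < N)%N) al ->
     cmod (newton_coef s al H t) <= tau + 6 ^+ sumn al * b) ->
  cmod (H t) <= 2 ^+ size s * tau + 4 ^+ size s * b
    + (4 ^+ size s * (size s)%:R) * ((3 / 4) ^+ N * B).
Proof.
move=> hH HB pt; elim: s tau b => [|i s IH] tau b ts tau0 b0 small.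
  have := small [::] erefl isT; rewrite /= !expr0 !mul1r mul0r addr0 => h; exact: h.
have B0 : 0 <= B by rewrite (le_trans (cmod_ge0 (H t))) // HB.
have q0 : 0 <= (3 / 4) ^+ N * B by rewrite mulr_ge0 // exprn_ge0 //; lra.
have := IH (2 * tau) (4 * b + (3 / 4) ^+ N * B).
move=> /(_ _ _ _ _)/wrap[|||al sz alN|].
- by move=> j js; apply: ts; rewrite inE js orbT.
- by rewrite mulr_ge0.
- by rewrite addr_ge0 // mulr_ge0.
- have ti : cmod (t i) <= 1 / 16 by apply: ts; rewrite inE eqxx.
  pose g a := newton_coef s al H (upd t i a).
  have dg a : cmod a < 1 -> differentiable g a.
    by move=> a1; apply: separately_holomorphic_slice => //; exact: newton_coef_holomorphic.
  have gB a : cmod a < 1 -> cmod (g a) <= 6 ^+ sumn al * B.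
    by move=> a1; apply: newton_coef_bound => //; exact: polydisc_upd.
  have -> : newton_coef s al H t = g (t i) by rewrite /g upd_id.
  rewrite (newton_expansion g N) (le_trans (cmodD _ _)) //.
  have r := newton_remainder_bound dg gB N ti.
  apply: (@le_trans _ _ ((\sum_(k < N) (1 / 8) ^+ k) * tau +
     6 ^+ sumn al * b * (\sum_(k < N) (3 / 4) ^+ k) + (3 / 4) ^+ N * (6 ^+ sumn al * B))).
    apply: lerD => //; rewrite mulr_suml mulr_sumr -big_split /=.
    apply: (le_trans (cmod_sum _ _ _)); apply: ler_sum => k _.
    have := small (nat_of_ord k :: al); rewrite /= sz ltn_ord => /(_ erefl alN) h.
    rewrite cmodM; apply: (le_trans (ler_pM _ _ h (node_poly_bound k ti))); rewrite ?cmod_ge0 //.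
    rewrite mulrDl [tau * _]mulrC lerD2l.
    have -> : 3 / 4 = 6 * (1 / 8) :> R by field.
    by rewrite [(6 * _) ^+ _]exprMn exprD le_eqVlt; apply/orP; left; apply/eqP; ring.
  have g1 : \sum_(k < N) (1 / 8) ^+ k <= 2 :> R.
    apply: (le_trans (geometric_sum_le N _ _)); [lra|lra|].
    by rewrite (_ : (1 - 1 / 8)^-1 = 8 / 7 :> R); [lra|field].
  have g2 : \sum_(k < N) (3 / 4) ^+ k <= 4 :> R.
    apply: (le_trans (geometric_sum_le N _ _)); [lra|lra|].
    by rewrite (_ : (1 - 3 / 4)^-1 = 4 :> R); [lra|field].
  have p0 : 0 <= 6 ^+ sumn al * b by rewrite mulr_ge0 // exprn_ge0.
  have := ler_wpM2r tau0 g1; have := ler_wpM2l p0 g2.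
  move: (6 ^+ sumn al) ((3 / 4) ^+ N) (\sum_(k < N) (1 / 8) ^+ k)
    (\sum_(k < N) (3 / 4) ^+ k) => p q S1 S2 h1 h2.
  by lra.
move=> /le_trans; apply.
rewrite /= !exprS -[(size s).+1%:R]natr1.
have : 0 <= 4 ^+ size s * (size s)%:R * ((3 / 4) ^+ N * B).
  by rewrite !mulr_ge0 // exprn_ge0.
have : 0 <= 4 ^+ size s * ((3 / 4) ^+ N * B) by rewrite mulr_ge0 // exprn_ge0.
move: (4 ^+ size s) (2 ^+ size s) ((3 / 4) ^+ N) (size s)%:R => p q r u h1 h2.
by lra.
Qed.

End SeveralVariables.

Section NewtonFunctionals.
Context {R : realType} {m : nat}.
Implicit Types (H G : ('I_m -> R[i]) -> R[i]).

(** The base point 0 is immaterial once all variables are expanded. *)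
Definition newton_functional (N : nat) (al : {ffun 'I_m -> 'I_N}) H : R[i] :=
  newton_coef (enum 'I_m) [seq nat_of_ord (al i) | i <- enum 'I_m] H (fun=> 0).

Lemma newton_functional_bound N (al : {ffun 'I_m -> 'I_N}) H :
  separately_holomorphic H -> bounded_on_polydisc H 1 ->
  cmod (newton_functional al H) <= 6 ^+ (m * N).
Proof.
move=> hH HB; have := @newton_coef_bound _ _ (enum 'I_m)
  [seq nat_of_ord (al i) | i <- enum 'I_m] H 1 (size_map _ _) hH HB (fun=> 0).
move=> /(_ _)/wrap[i|]; first by rewrite cmod0.
move/le_trans; apply; rewrite mulr1 ler_weXn2l //; first lra.
rewrite -[X in (_ <= X * _)%N](size_enum_ord m) -sum1_size big_distrl /= sumnE big_map.
by apply: leq_sum => i _; rewrite mul1n ltnW.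
Qed.

(** Hence N ^ m numbers of size 6 ^ (m N) determine a bounded holomorphic function on the
    polydisc of radius 1 / 16 up to (3 / 4) ^ N. *)
Theorem newton_functional_norming N H G tau t :
  separately_holomorphic H -> bounded_on_polydisc H 1 ->
  separately_holomorphic G -> bounded_on_polydisc G 1 ->
  0 <= tau ->
  (forall al : {ffun 'I_m -> 'I_N},
     cmod (newton_functional al H - newton_functional al G) <= tau) ->
  (forall i, cmod (t i) <= 1 / 16) ->
  cmod (H t - G t) <= 2 ^+ m * tau + 2 * (4 ^+ m * m%:R) * (3 / 4) ^+ N.
Proof.
move=> hH HB hG GB tau0 small t16.
have pt : polydisc t by move=> i; rewrite (le_lt_trans (t16 i)) //; lra.
have hD : separately_holomorphic (fun u => H u - G u).
  by move=> u i pu; apply: differentiable_sub; [exact: hH|exact: hG].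
have DB : bounded_on_polydisc (fun u => H u - G u) 2.
  move=> u pu; rewrite (le_trans (cmodB _ _)) //.
  by have := HB u pu; have := GB u pu; lra.
have := @newton_coef_norming _ _ (enum 'I_m) _ 2 N t tau 0 hD DB pt (fun i _ => t16 i) tau0 (lexx _).
move=> /(_ _)/wrap[al sz alN|].
  rewrite mulr0 addr0 newton_coefB.
  have alE : exists be : {ffun 'I_m -> 'I_N}, al = [seq nat_of_ord (be i) | i <- enum 'I_m].
    case: N alN {small} => [|N] alN.
      case: al sz alN => [|//]; rewrite size_enum_ord => /esym m0 _; subst m.
      by exists [ffun i : 'I_0 => match i with Ordinal k p => False_rect _ (notF p) end]; rewrite enum_ord0.
    exists [ffun i : 'I_m => inord (nth 0%N al i)].
    apply: (@eq_from_nth _ 0%N); first by rewrite size_map.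
    move=> k; rewrite sz size_enum_ord => km.
    rewrite (nth_map (Ordinal km)) ?size_enum_ord // ffunE nth_enum_ord // inordK //.
    by apply: (allP alN); rewrite mem_nth // sz size_enum_ord.
  have [be ->] := alE.
  have := small be; rewrite /newton_functional.
  rewrite (@newton_coef_indep _ _ _ _ H _ t) ?size_map //; last by move=> j; rewrite mem_enum.
  by rewrite (@newton_coef_indep _ _ _ _ G _ t) ?size_map // => j; rewrite mem_enum.
rewrite size_enum_ord mulr0 addr0 => /le_trans; apply.
rewrite lerD2l; lra.
Qed.

End NewtonFunctionals.

(** * Taylor's formula in one real variable *)

Section TaylorOneVariable.
Context {R : realType}.
Implicit Types (phi dphi : R -> R) (B r t : R) (g : nat -> R -> R).

Lemma is_derive_continuous phi t d : is_derive t 1 phi d -> {for t, continuous phi}.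
Proof.
by move=> H; apply: differentiable_continuous; apply/derivable1_diffP; exact: ex_derive.
Qed.

Lemma is_derive_monomial n t :
  is_derive t 1 (fun u : R => u ^+ n.+1 / n.+1`!%:R) (t ^+ n / n`!%:R).
Proof.
have -> : (fun u : R => u ^+ n.+1 / n.+1`!%:R) = n.+1`!%:R^-1 \*: (fun u : R => u ^+ n.+1).
  by apply/funext => u /=; rewrite mulrC.
have D : is_derive t 1 (fun u : R => u ^+ n.+1) (n.+1%:R * t ^+ n).
  by apply: DeriveDef; [exact: exprn_derivable|rewrite exp_derive /= [_ *: 1]mulr1].
have -> : t ^+ n / n`!%:R = n.+1`!%:R^-1 *: (n.+1%:R * t ^+ n).
  rewrite -[_ *: _]/(_ * _) factS natrM invfM mulrACA mulVf ?pnatr_eq0 //.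
  by rewrite mul1r mulrC.
exact: is_deriveZ.
Qed.

Lemma derive_bound_pos phi dphi N B t : 0 <= t ->
  (forall u, 0 <= u <= t -> is_derive u 1 phi (dphi u)) ->
  (forall u, 0 <= u <= t -> dphi u <= B * (u ^+ N / N`!%:R)) ->
  phi t - phi 0 <= B * (t ^+ N.+1 / N.+1`!%:R).
Proof.
move=> t0 dp dB.
pose psi u := B * (u ^+ N.+1 / N.+1`!%:R) - phi u.
have dpsi u : 0 <= u <= t -> is_derive u 1 psi (B * (u ^+ N / N`!%:R) - dphi u).
  move=> hu; apply: (@is_deriveB _ _ _ (B \*: (fun u : R => u ^+ N.+1 / N.+1`!%:R)) phi).
  - by apply: is_deriveZ; exact: is_derive_monomial.
  - exact: dp.
have d1 u : u \in `]0, t[ -> is_derive u 1 psi (B * (u ^+ N / N`!%:R) - dphi u).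
  by rewrite in_itv /= => /andP[u0 ut]; apply: dpsi; rewrite !ltW.
have c1 : {within `[0, t], continuous psi}.
  apply: continuous_in_subspaceT => u; rewrite inE /= in_itv /= => hu.
  exact: (is_derive_continuous (dpsi u hu)).
have [c ct E] := MVT_segment t0 d1 c1.
move: ct; rewrite in_itv /= => ct; have := dB c ct.
have p : 0 <= psi t - psi 0 -> phi t - phi 0 <= B * (t ^+ N.+1 / N.+1`!%:R).
  by rewrite /psi expr0n /= mul0r mulr0; lra.
by move=> h; apply: p; rewrite E subr0 mulr_ge0 // subr_ge0.
Qed.

Lemma derive_bound phi dphi N B r t : `|t| <= r ->
  (forall u : R, `|u| <= r -> is_derive u 1 phi (dphi u)) ->
  (forall u : R, `|u| <= r -> `|dphi u| <= B * (`|u| ^+ N / N`!%:R)) ->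
  `|phi t - phi 0| <= B * (`|t| ^+ N.+1 / N.+1`!%:R).
Proof.
wlog t0 : phi dphi t / 0 <= t => [W|].
  move=> tr dp dB; have [t0|t0] := leP 0 t; first exact: W.
  have := W (fun u => phi (- u)) (fun u => - dphi (- u)) (- t); rewrite normrN opprK oppr0.
  apply=> // [|u ur|u ur]; first by rewrite oppr_ge0 ltW.
    have dpu : is_derive (- u) 1 phi (dphi (- u)) by apply: dp; rewrite normrN.
    rewrite -[- dphi _]mulrN1; apply: (@is_derive1_comp _ phi -%R) => //.
  by rewrite normrN -(normrN u); apply: dB; rewrite normrN.
move=> tr dp dB.
have hr u : 0 <= u <= t -> `|u| <= r.
  by move=> /andP[u0 ut]; rewrite ger0_norm // (le_trans ut) // (le_trans (ler_norm t)).
rewrite [`|t|]ger0_norm // ler_norml; apply/andP; split; last first.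
  apply: (@derive_bound_pos _ dphi) => // [u /hr /dp //|u hu].
  have /andP[u0 _] := hu; have := dB u (hr u hu); rewrite (ger0_norm u0).
  exact: le_trans (ler_norm _).
rewrite lerNl opprB.
have := @derive_bound_pos (fun u => - phi u) (fun u => - dphi u) N B t t0.
rewrite opprK addrC; apply=> // [u /hr /dp ?|u hu]; first exact: is_deriveN.
have /andP[u0 _] := hu; have := dB u (hr u hu); rewrite (ger0_norm u0).
by apply: le_trans; rewrite -normrN ler_norm.
Qed.

Lemma is_derive_sum_ord n (h : 'I_n -> R -> R) (dh : 'I_n -> R) t :
  (forall i, is_derive t 1 (h i) (dh i)) ->
  is_derive t 1 (fun u => \sum_(i < n) h i u) (\sum_(i < n) dh i).
Proof.
move=> H; have -> : (fun u => \sum_(i < n) h i u) = \sum_(i < n) h i.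
  by apply/funext => u; rewrite fct_sumE.
exact: is_derive_sum.
Qed.

(** The g j stand for the successive derivatives of g 0. *)
Lemma taylor_one_variable g N B r t : `|t| <= r ->
  (forall j (u : R), (j < N)%N -> `|u| <= r -> is_derive u 1 (g j) (g j.+1 u)) ->
  (forall u : R, `|u| <= r -> `|g N u| <= B) ->
  `|g 0%N t - \sum_(j < N) g j 0 * (t ^+ j / j`!%:R)| <= B * (`|t| ^+ N / N`!%:R).
Proof.
elim: N g t => [|N IH] g t tr dg gB.
  by rewrite big_ord0 subr0 expr0 fact0 divr1 mulr1 gB.
pose phi u := g 0%N u - \sum_(j < N.+1) g j 0 * (u ^+ j / j`!%:R).
have phi0 : phi 0 = 0.
  rewrite /phi big_ord_recl expr0 fact0 divr1 mulr1 big1 ?addr0 ?subrr // => j _.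
  by rewrite expr0n mul0r mulr0.
rewrite -[X in `|X|]/(phi t) -[phi t]subr0 -{1}phi0.
apply: (@derive_bound _ (fun u => g 1%N u - \sum_(j < N) g j.+1 0 * (u ^+ j / j`!%:R)) _ _ r) => //.
  move=> u ur; rewrite /phi.
  have -> : (fun u => g 0%N u - \sum_(j < N.+1) g j 0 * (u ^+ j / j`!%:R)) =
     (fun u => (g 0%N u - g 0%N 0) - \sum_(j < N) g j.+1 0 * (u ^+ j.+1 / j.+1`!%:R)).
    by apply/funext => w; rewrite big_ord_recl expr0 fact0 divr1 mulr1 opprD addrA.
  apply: (@is_deriveB _ _ _ (fun u => g 0%N u - g 0%N 0)).
    rewrite -[g 1%N u]subr0; apply: is_deriveB; first exact: dg.
  apply: (@is_derive_sum_ord _ (fun j u => g j.+1 0 * (u ^+ j.+1 / j.+1`!%:R))) => j.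
  by apply: (@is_deriveZ _ _ _ (fun u : R => u ^+ j.+1 / j.+1`!%:R)); exact: is_derive_monomial.
by move=> u ur; apply: (IH (fun j => g j.+1)) => // j w jN wr; exact: dg.
Qed.

End TaylorOneVariable.

Section LineRestriction.
Context {R : realType} {V : normedModType R}.

Lemma is_derive_line (f : V -> R) (x e : V) (t : R) : derivable f (t *: e + x) e ->
  is_derive t 1 (fun u : R => f (u *: e + x)) ('D_e f (t *: e + x)).
Proof.
move=> df.
have E : (fun h : R => h^-1 *: (f ((h *: 1 + t) *: e + x) - f (t *: e + x))) =
    (fun h : R => h^-1 *: (f (h *: e + (t *: e + x)) - f (t *: e + x))).
  by apply/funext => h; rewrite [h *: 1]mulr1 scalerDl addrA.
apply: DeriveDef; first by rewrite /derivable /= E.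
by rewrite /derive /= E.
Qed.

End LineRestriction.

(** * Mean value estimates in several real variables *)

Section PartialDerivatives.
Context {R : realType} {d : nat}.
Implicit Types (f : 'rV[R]_d -> R) (U : set 'rV[R]_d) (x : 'rV[R]_d) (i : 'I_d).

Lemma partials_cat w1 w2 f : partials (w1 ++ w2) f = partials w1 (partials w2 f).
Proof. by rewrite /partials foldr_cat. Qed.

Lemma partials_nseq k i f : partials (nseq k i) f = iter k (partial i) f.
Proof. by elim: k => //= k ->. Qed.

Lemma smooth_on_iter U f k i : smooth_on U f -> smooth_on U (iter k (partial i) f).
Proof. by move=> sf w x Ux; rewrite -partials_nseq -partials_cat; exact: sf. Qed.

Lemma partial_is_derive U f i x (t : R) : smooth_on U f -> U (t *: 'e_i + x) ->
  is_derive t 1 (fun u : R => f (u *: 'e_i + x)) (partial i f (t *: 'e_i + x)).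
Proof. by move=> sf Ux; apply: is_derive_line; have [_] := sf [::] _ Ux; exact. Qed.

(** The corner of the box spanned by x0 and v in the directions of s. *)
Definition corner x0 (s : seq 'I_d) (v : 'I_d -> R) : 'rV[R]_d :=
  \row_j (x0 0 j + (if j \in s then v j else 0)).

Definition box x0 (r : R) : set 'rV[R]_d := [set x | forall j, `|x 0 j - x0 0 j| <= r].

Lemma corner_cons x0 i s v (t : R) : i \notin s ->
  t *: 'e_i + corner x0 s v = corner x0 (i :: s) (fun j => if j == i then t else v j).
Proof.
move=> ins; apply/rowP => j; rewrite !mxE inE /=.
have [->|ji] := eqVneq j i; last by rewrite /= mulr0 add0r.
by rewrite (negbTE ins) mulr1 addr0 addrC.
Qed.

Lemma corner_ext x0 s v v' : (forall j, j \in s -> v j = v' j) ->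
  corner x0 s v = corner x0 s v'.
Proof. by move=> H; apply/rowP => j; rewrite !mxE; case: ifP => // /H ->. Qed.

Lemma corner_box x0 s v r : 0 <= r -> (forall j, j \in s -> `|v j| <= r) -> box x0 r (corner x0 s v).
Proof.
by move=> r0 vr j; rewrite mxE addrAC subrr add0r; case: ifP => [/vr //|]; rewrite normr0.
Qed.

Lemma corner_box_cons x0 i s v r (t : R) : i \notin s -> `|t| <= r -> (forall j, `|v j| <= r) ->
  box x0 r (t *: 'e_i + corner x0 s v).
Proof.
move=> ins tr vr; rewrite corner_cons //; apply: corner_box.
  exact: le_trans tr.
by move=> j _; case: eqP.
Qed.

End PartialDerivatives.

Section StrictDifferentiability.
Context {R : realType} {d : nat}.
Variables (U : set 'rV[R]_d) (f : 'rV[R]_d -> R) (q : 'rV[R]_d) (kappa delta : R).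
Hypotheses (sf : smooth_on U f) (qU : box q delta `<=` U).
Hypothesis near : forall i x, box q delta x -> `|partial i f x - partial i f q| <= kappa.

(** The coordinates of y are replaced by those of x one after the other; the mean value
    theorem along each step compares the increment with the partial derivative at q. *)
Lemma strict_difference (x y : 'rV[R]_d) (rho : R) : box q delta x -> box q delta y ->
  (forall i, `|x 0 i - y 0 i| <= rho) ->
  `|f x - f y - \sum_i partial i f q * (x 0 i - y 0 i)| <= d%:R * (kappa * rho).
Proof.
move=> bx by_ xy.
have [->|d0] := eqVneq x y.
  rewrite subrr big1 ?subr0 ?normr0 => [|i _]; last by rewrite subrr mulr0.
  case: (posnP d) => [d0|d0]; first by rewrite [X in X%:R]d0 mul0r.
  rewrite mulr_ge0 // mulr_ge0 //.
    exact: le_trans (near (Ordinal d0) bx).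
  exact: le_trans (xy (Ordinal d0)).
pose v i := x 0 i - y 0 i.
have mixb s : box q delta (corner y s v).
  move=> j; rewrite mxE; case: ifP => _; last by rewrite addr0; exact: by_.
  by rewrite /v addrCA subrr addr0; exact: bx.
suff main s : uniq s -> `|f (corner y s v) - f y - \sum_(i <- s) partial i f q * v i| <=
    (size s)%:R * (kappa * rho).
  have := main (enum 'I_d) (enum_uniq _); rewrite size_enum_ord big_enum.
  have -> // : corner y (enum 'I_d) v = x.
  by apply/rowP => j; rewrite mxE mem_enum /= /v addrCA subrr addr0.
elim: s => [|i s IH] /=.
  move=> _; have -> : corner y [::] v = y by apply/rowP => j; rewrite mxE /= addr0.
  by rewrite big_nil subrr subr0 normr0 mul0r.
move=> /andP[ins us].
pose c := partial i f q.
have E : corner y (i :: s) v = v i *: 'e_i + corner y s v.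
  by rewrite corner_cons //; apply: corner_ext => j _; case: eqP => [->|].
pose z (t : R) := t *: 'e_i + corner y s v.
have zb (t : R) : `|t| <= `|v i| -> t * v i >= 0 -> box q delta (z t).
  move=> tv tv0 j; rewrite /z corner_cons // mxE inE.
  have [->|ji] /= := eqVneq j i; last by have := mixb s j; rewrite mxE.
  have := by_ i; have : `|y 0 i + v i - q 0 i| <= delta.
    by rewrite /v addrCA subrr addr0; exact: bx.
  rewrite !ler_norml => /andP[h1 h2] /andP[h3 h4].
  have [v0|v0] := leP 0 (v i).
    have tvi : t <= v i by move: tv; rewrite (ger0_norm v0) ler_norml => /andP[].
    have [t0|t0] := leP 0 t; first lra.
    have : v i = 0 by apply/eqP; rewrite eq_le v0 andbT -(nmulr_rge0 _ t0).
    by move=> vi0; move: tv; rewrite vi0 normr0 normr_le0 => /eqP ->; lra.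
  have tvi : v i <= t by move: tv; rewrite (ltr0_norm v0) ler_norml opprK => /andP[].
  have t0 : t <= 0 by rewrite -(nmulr_lge0 _ v0).
  lra.
have step : `|f (z (v i)) - f (z 0) - c * v i| <= kappa * rho.
  pose phi (t : R) := f (z (t * v i)) - f (z 0) - c * (t * v i).
  have H (t : R) : 0 <= t <= 1 -> `|t * v i| <= `|v i| /\ t * v i * v i >= 0.
    move=> /andP[t0 t1]; split; first by rewrite normrM (ger0_norm t0) ler_piMl.
    by rewrite -mulrA mulr_ge0 // -expr2 sqr_ge0.
  have dphi (t : R) : 0 <= t <= 1 -> is_derive t 1 phi ((partial i f (z (t * v i)) - c) * v i).
    move=> /H [h1 h2].
    have D : is_derive (t * v i) 1 (fun u : R => f (z u)) (partial i f (z (t * v i))).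
      by apply: (partial_is_derive sf); apply: qU; exact: zb.
    have D1 : is_derive t 1 (fun u : R => u * v i) (v i).
      have := @is_deriveZ _ _ _ id (v i) t 1 1 (is_derive_id _ _).
      rewrite [_ *: 1]mulr1 (_ : _ \*: _ = (fun u => u * v i)) //.
      by apply/funext => u /=; rewrite mulrC.
    have D2 := @is_derive1_comp _ (fun u : R => f (z u)) (fun u : R => u * v i) t _ _ D D1.
    have D3 := @is_deriveZ _ _ _ (fun u : R => u * v i) c t 1 _ D1.
    have := is_deriveB (is_deriveB D2 (is_derive_cst (f (z 0)) t 1)) D3.
    by rewrite subr0 -[c *: v i]/(c * v i) -mulrBl.
  have kk : 0 <= kappa := le_trans (normr_ge0 _) (near i bx).
  have B (t : R) : 0 <= t <= 1 -> `|(partial i f (z (t * v i)) - c) * v i| <= kappa * rho.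
    move=> /H [h1 h2]; rewrite normrM ler_pM //; last exact: xy.
    by apply: near; exact: zb.
  have p1 := @derive_bound_pos _ phi (fun t => (partial i f (z (t * v i)) - c) * v i) 0
    (kappa * rho) 1 ler01 dphi.
  have p2 := @derive_bound_pos _ (fun t => - phi t) (fun t => - ((partial i f (z (t * v i)) - c) * v i)) 0
    (kappa * rho) 1 ler01 (fun t ht => is_deriveN (dphi t ht)).
  have phi0 : phi 0 = 0 by rewrite /phi mul0r mulr0 subr0 subrr.
  have phi1 : phi 1 = f (z (v i)) - f (z 0) - c * v i by rewrite /phi mul1r.
  have f1 : (1 : R) ^+ 1 / 1`!%:R = 1 by rewrite expr1 divr1.
  move: p1 p2; rewrite phi0 phi1 f1 mulr1 !oppr0 !addr0 => p1 p2.
  rewrite ler_norml lerNl; apply/andP; split.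
    apply: p2 => u hu; have := B u hu; rewrite ler_norml lerNl.
    by move=> /andP[].
  apply: p1 => u hu; have := B u hu; rewrite ler_norml.
  by move=> /andP[].
have z0 : z 0 = corner y s v by rewrite /z scale0r add0r.
rewrite E -/(z _) big_cons -/c -natr1 mulrDl mul1r.
have -> : f (z (v i)) - f y - (c * v i + \sum_(j <- s) partial j f q * v j) =
  (f (corner y s v) - f y - \sum_(j <- s) partial j f q * v j) +
  (f (z (v i)) - f (z 0) - c * v i) by rewrite z0; ring.
by rewrite (le_trans (ler_normD _ _)) // lerD // IH.
Qed.

End StrictDifferentiability.

(** * Taylor polynomials of Gevrey functions *)

Section FactorialWeights.
Context {R : realType}.

Lemma fact_le_exp N a : (a < N)%N -> (a.+1`! <= N ^ a)%N.
Proof.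
elim: a => [//|a IH] aN; rewrite factS expnS leq_mul //.
by apply: IH; rewrite ltnW.
Qed.

(** In a Taylor polynomial of order N, dividing by the factorial leaves (a!)^(s-1), which
    is at most N^(s-1) for each derivative but the first.  At the scale N^(1-s) a Gevrey
    function thus behaves like an analytic one. *)
Lemma gevrey_weight (s : R) N a : 1 <= s -> (a < N)%N ->
  a.+1`!%:R `^ s <= a.+1`!%:R * (N%:R `^ (s - 1)) ^+ a :> R.
Proof.
move=> s1 aN; have f0 : 0 < a.+1`!%:R :> R by rewrite ltr0n fact_gt0.
rewrite -[leLHS]mulr_powRB1 ?ler0n ?(lt_le_trans ltr01) // ler_pM2l //.
rewrite -powR_mulrn ?powR_ge0 // -powRrM mulrC powRrM powR_mulrn //.
rewrite ge0_ler_powR ?nnegrE ?subr_ge0 ?exprn_ge0 //.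
by rewrite -natrX ler_nat fact_le_exp.
Qed.

Lemma powR_ge1 (s : R) N : 1 <= s -> (0 < N)%N -> 1 <= N%:R `^ (s - 1) :> R.
Proof.
move=> s1 N0; rewrite -[X in X <= _](powRr0 N%:R); apply: ler_powR; first by rewrite ler1n.
by rewrite subr_ge0.
Qed.

End FactorialWeights.

Section BoxTaylor.
Context {R : realType} {d : nat}.
Implicit Types (f : 'rV[R]_d -> R) (s : seq 'I_d) (i : 'I_d) (A : R).

(** The Taylor polynomial at x0 of degree less than N in each of the variables
    of s, evaluated at increments in L, real or complex.  Expanding one variable at a time
    produces the derivatives in the order of mpartial, so that no symmetry of mixed
    derivatives is involved. *)
Fixpoint taylor (N : nat) (x0 : 'rV[R]_d) (L : comNzRingType) (iota : R -> L)
    s f (v : 'I_d -> L) : L :=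
  if s is i :: s' then
    \sum_(a < N) v i ^+ a * iota (a`!%:R^-1) * taylor N x0 iota s' (iter a (partial i) f) v
  else iota (f x0).

(** The Gevrey estimates for the derivatives in the variables of s, shaped like the
    recursion of taylor. *)
Fixpoint gevrey_bound (K : set 'rV[R]_d) (C sigma : R) s f A : Prop :=
  if s is i :: s' then
    forall a, gevrey_bound K C sigma s' (iter a (partial i) f)
      (A * C ^+ a * a`!%:R `^ sigma)
  else forall x, K x -> `|f x| <= A.

Lemma gevrey_bound_sup K C sigma s f A : gevrey_bound K C sigma s f A ->
  forall x, K x -> `|f x| <= A.
Proof.
elim: s f A => [|i s IH] f A //= H.
by have := IH _ _ (H 0%N); rewrite expr0 fact0 powR1 !mulr1.
Qed.

Lemma gevrey_boundP K C sigma s f A : uniq s ->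
  (forall (a : 'I_d -> nat) x, K x ->
     `|partials (flatten [seq nseq (a i) i | i <- rev s]) f x| <=
       A * C ^+ (\sum_(i <- s) a i)%N * \prod_(i <- s) (a i)`!%:R `^ sigma) ->
  gevrey_bound K C sigma s f A.
Proof.
elim: s f A => [|i s IH] f A /=.
  by move=> _ H x Kx; have := H (fun=> 0%N) x Kx; rewrite !big_nil expr0 !mulr1.
move=> /andP[ins us] H a; apply: IH => // b x Kx.
have := H (fun j => if j == i then a else b j) x Kx.
rewrite rev_cons map_rcons flatten_rcons partials_cat eqxx partials_nseq.
have E j : j \in s -> (if j == i then a else b j) = b j.
  by move=> js; case: eqVneq => // ji; rewrite -ji js in ins.
have -> : [seq nseq (if j == i then a else b j) j | j <- rev s] = [seq nseq (b j) j | j <- rev s].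
  by apply/eq_in_map => j; rewrite mem_rev => /E ->.
rewrite !big_cons eqxx (eq_big_seq b) //.
rewrite [X in _ * (_ * X)](eq_big_seq (fun j => (b j)`!%:R `^ sigma)); last by move=> j /E ->.
by rewrite exprD; congr (_ <= _); ring.
Qed.

Variables (U K : set 'rV[R]_d) (x0 : 'rV[R]_d) (r C nu sigma : R) (N : nat).
Hypotheses (C0 : 0 < C) (r0 : 0 <= r) (nu1 : 1 <= nu) (small : C * r * nu <= 1 / 2).
Hypothesis weight : forall a, (a < N)%N -> a.+1`!%:R `^ sigma <= a.+1`!%:R * nu ^+ a.
Hypotheses (bK : box x0 r `<=` K) (KU : K `<=` U).

Local Notation mu := (C * r * nu).
Local Notation bound := (gevrey_bound K C sigma).

Let mu0 : 0 <= mu. Proof. by rewrite !mulr_ge0 // ?ltW // (lt_le_trans ltr01). Qed.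
Let nu0 : 0 < nu. Proof. exact: lt_le_trans nu1. Qed.

Let fact_inv0 a : 0 <= (a`!%:R : R)^-1. Proof. by rewrite invr_ge0. Qed.

Let Crmu : C * r <= mu.
Proof. by rewrite ler_peMr // mulr_ge0 // ltW. Qed.

Lemma taylor_term_le a w : 0 <= w -> w <= r -> (a < N)%N ->
  w ^+ a.+1 * (a.+1`!%:R)^-1 * (C ^+ a.+1 * a.+1`!%:R `^ sigma) <= C * r * mu ^+ a.
Proof.
move=> w0 wr aN; have f0 : 0 < a.+1`!%:R :> R by rewrite ltr0n fact_gt0.
apply: (@le_trans _ _ (r ^+ a.+1 * (a.+1`!%:R)^-1 * (C ^+ a.+1 * (a.+1`!%:R * nu ^+ a)))).
  rewrite ler_pM ?mulr_ge0 ?exprn_ge0 ?powR_ge0 ?(ltW C0) //.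
    by rewrite ler_wpM2r // lerXn2r.
  by rewrite ler_wpM2l ?exprn_ge0 ?(ltW C0) // weight.
rewrite !exprMn !exprS le_eqVlt; apply/orP; left; apply/eqP.
by field; rewrite gt_eqF.
Qed.

Lemma taylor_term_le' a w : 0 <= w -> w <= r -> (a <= N)%N ->
  w ^+ a * (a`!%:R)^-1 * (C ^+ a * a`!%:R `^ sigma) <= mu ^+ a.
Proof.
case: a => [|a] w0 wr aN; first by rewrite !expr0 fact0 invr1 powR1 !mulr1.
apply: (le_trans (taylor_term_le w0 wr aN)).
by rewrite exprS ler_wpM2r // exprn_ge0.
Qed.

Let rearr3 (p q' A x w m : R) : p * (q' * (A * x * w) * m) = q' * A * m * (p * (x * w)).
Proof. by ring. Qed.

Let rearr2 (p q' A x w : R) : p * (q' * (A * x * w)) = q' * A * (p * (x * w)).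
Proof. by ring. Qed.

Let geom n : \sum_(a < n) mu ^+ a <= 2.
Proof.
have h : 1 - mu >= 2^-1 by move: small; lra.
apply: (le_trans (geometric_sum_le n mu0 _)); first by move: small; lra.
rewrite -[2]invrK lef_pV2 ?posrE ?invr_gt0 //.
by rewrite (lt_le_trans _ h) // invr_gt0.
Qed.

Lemma bound_ge0 s f A : bound s f A -> 0 <= A.
Proof.
move=> /gevrey_bound_sup H; apply: le_trans (H x0 _); rewrite ?normr_ge0 //.
by apply: bK => j; rewrite subrr normr0.
Qed.

(** One variable at a time, each expansion costs its
    Lagrange remainder, at most A * mu ^+ N. *)
Lemma taylor_error s f A (v : 'I_d -> R) : uniq s -> smooth_on U f -> bound s f A ->
  (forall i, `|v i| <= r) ->
  `|f (corner x0 s v) - taylor N x0 idfun s f v| <= 4 ^+ size s * A * mu ^+ N.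
Proof.
move=> + + + vr; elim: s f A => [|i s IH] f A /=.
  move=> _ sf bf; have -> : corner x0 [::] v = x0 by apply/rowP => j; rewrite mxE addr0.
  by rewrite subrr normr0 !mulr_ge0 ?exprn_ge0 // (@bound_ge0 [::] f A bf).
move=> /andP[ins us] sf bf.
have A0 := @bound_ge0 (i :: s) f A bf.
have muN : 0 <= A * mu ^+ N by rewrite mulr_ge0 // exprn_ge0.
pose z (t : R) := t *: 'e_i + corner x0 s v.
have zK t : `|t| <= r -> K (z t).
  by move=> tr; apply: bK; exact: corner_box_cons.
have E : corner x0 (i :: s) v = z (v i).
  by rewrite /z corner_cons //; apply: corner_ext => j _; case: eqP => [->|].
have z0 : z 0 = corner x0 s v by rewrite /z scale0r add0r.
have T := @taylor_one_variable _ (fun j t => iter j (partial i) f (z t)) N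
  (A * C ^+ N * N`!%:R `^ sigma) r (v i) (vr i) _ _.
have {}T := T _ _.
have {}T := T (fun j t _ tr => partial_is_derive (smooth_on_iter j i sf) (KU (zK t tr)))
  (fun t tr => gevrey_bound_sup (bf N) (zK t tr)).
rewrite E -[f]/(iter 0 (partial i) f).
set S1 := \sum_(j < N) _ in T.
rewrite -(subrK S1 (iter 0 (partial i) f (z (v i)))) -addrA (le_trans (ler_normD _ _)) //.
have -> : 4 ^+ (size s).+1 * A * mu ^+ N = 4 ^+ size s * (A * mu ^+ N) +
   (4 ^+ size s * (A * mu ^+ N)) * 3 by rewrite exprS; ring.
have s1 : 1 <= 4 ^+ size s :> R by rewrite exprn_ege1 //; lra.
apply: lerD.
  apply: (le_trans T).
  rewrite (_ : _ * _ = A * (`|v i| ^+ N * (N`!%:R)^-1 * (C ^+ N * N`!%:R `^ sigma))); last by ring.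
  apply: (@le_trans _ _ (A * mu ^+ N)); last by rewrite ler_peMl.
  by rewrite ler_wpM2l // taylor_term_le'.
rewrite /S1 -sumrB (le_trans (ler_norm_sum _ _ _)) //.
apply: (@le_trans _ _ (\sum_(a < N) (4 ^+ size s * A * mu ^+ N) * mu ^+ a)); last first.
  rewrite -mulr_sumr -[4 ^+ _ * A * _]mulrA; apply: ler_wpM2l.
    by rewrite mulr_ge0 // exprn_ge0.
  by have := geom N; lra.
apply: ler_sum => a _.
rewrite z0 (_ : _ - _ = (v i ^+ a / a`!%:R) *
   (iter a (partial i) f (corner x0 s v) - taylor N x0 idfun s (iter a (partial i) f) v)); last by rewrite /=; ring.
rewrite normrM normrM normrX (ger0_norm (fact_inv0 a)).
have h := IH _ _ us (smooth_on_iter a i sf) (bf a).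
have p : 0 <= `|v i| ^+ a / a`!%:R by rewrite mulr_ge0 ?exprn_ge0.
apply: (le_trans (ler_wpM2l p h)).
rewrite rearr3.
rewrite ler_wpM2l //; first by rewrite -mulrA mulr_ge0 // exprn_ge0.
by rewrite taylor_term_le' // ltnW.
Qed.

Local Notation tayC := (taylor N x0 (real_complex R)).

Lemma taylor_bound s f A (v : 'I_d -> R[i]) : bound s f A ->
  (forall i, cmod (v i) <= r) -> cmod (tayC s f v) <= 2 ^+ size s * A.
Proof.
move=> + vr; elim: s f A => [|i s IH] f A /= bf.
  by rewrite cmodR expr0 mul1r; apply: bf; apply: bK => j; rewrite subrr normr0.
have A0 := @bound_ge0 (i :: s) f A bf.
apply: (le_trans (cmod_sum _ _ _)).
apply: (@le_trans _ _ (\sum_(a < N) (2 ^+ size s * A) * mu ^+ a)); last first.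
  rewrite -mulr_sumr (_ : 2 ^+ (size s).+1 * A = 2 ^+ size s * A * 2); last first.
    by rewrite exprS; ring.
  by apply: ler_wpM2l (geom N); rewrite mulr_ge0 ?exprn_ge0.
apply: ler_sum => a _; rewrite !cmodM cmodX cmodR (ger0_norm (fact_inv0 a)).
have p : 0 <= cmod (v i) ^+ a / a`!%:R by rewrite mulr_ge0 ?exprn_ge0 ?cmod_ge0.
apply: (le_trans (ler_wpM2l p (IH _ _ (bf a)))).
rewrite rearr2.
by rewrite ler_wpM2l ?mulr_ge0 ?exprn_ge0 // taylor_term_le' ?cmod_ge0 // ltnW.
Qed.

(* The terms of order at least k.+1 in the variable i *)
Lemma taylor_tail i s f A (v : 'I_d -> R[i]) k n : bound (i :: s) f A ->
  (forall j, cmod (v j) <= r) -> (k + n < N)%N ->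
  cmod (\sum_(a < n) v i ^+ (k + a).+1 * ((k + a).+1`!%:R^-1)%:C *
     tayC s (iter (k + a).+1 (partial i) f) v) <= 2 ^+ (size s).+1 * A * (C * r) * mu ^+ k.
Proof.
move=> bf vr knN; have A0 := @bound_ge0 (i :: s) f A bf.
have Cr0 : 0 <= C * r by rewrite mulr_ge0 // ltW.
apply: (le_trans (cmod_sum _ _ _)).
apply: (@le_trans _ _ (\sum_(a < n) (2 ^+ size s * A * (C * r) * mu ^+ k) * mu ^+ a)); last first.
  rewrite -mulr_sumr exprS (_ : 2 * _ * _ * _ * _ = (2 ^+ size s * A * (C * r) * mu ^+ k) * 2); last by ring.
  by apply: ler_wpM2l (geom n); rewrite mulr_ge0 ?exprn_ge0 // mulr_ge0 // mulr_ge0 ?exprn_ge0.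
apply: ler_sum => a _; rewrite !cmodM cmodX cmodR (ger0_norm (fact_inv0 _)).
have p : 0 <= cmod (v i) ^+ (k + a).+1 / (k + a).+1`!%:R by rewrite mulr_ge0 ?exprn_ge0 ?cmod_ge0.
apply: (le_trans (ler_wpM2l p (taylor_bound (bf _) vr))).
rewrite rearr2.
rewrite -[leRHS]mulrA -exprD -[leRHS]mulrA ler_wpM2l ?mulr_ge0 ?exprn_ge0 //.
apply: taylor_term_le; rewrite ?cmod_ge0 //.
by rewrite (leq_ltn_trans _ knN) // leq_add2l ltnW.
Qed.

Let sum_split1 (F : nat -> R[i]) : (0 < N)%N ->
  \sum_(a < N) F a = F 0%N + \sum_(a < N.-1) F a.+1.
Proof. by case: (N) => // n _; rewrite big_ord_recl. Qed.

Let sum_split2 (F : nat -> R[i]) : (1 < N)%N ->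
  \sum_(a < N) F a = F 0%N + (F 1%N + \sum_(a < N.-2) F a.+2).
Proof. by case: (N) => [|[|n]] // _; rewrite !big_ord_recl. Qed.

Lemma taylor_first_order s f A (v : 'I_d -> R[i]) : bound s f A ->
  (forall i, cmod (v i) <= r) -> (0 < N)%N ->
  cmod (tayC s f v - (f x0)%:C) <= (size s)%:R * 2 ^+ size s * A * (C * r).
Proof.
move=> + vr N0; elim: s f A => [|i s IH] f A /= bf.
  by rewrite subrr cmod0 !mul0r.
have A0 := @bound_ge0 (i :: s) f A bf.
have Cr0 : 0 <= C * r by rewrite mulr_ge0 // ltW.
have IH0 := IH f A ltac:(by have := bf 0%N; rewrite expr0 fact0 powR1 !mulr1).
pose F a := v i ^+ a * (a`!%:R^-1)%:C * tayC s (iter a (partial i) f) v.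
have hT : cmod (\sum_(a < N.-1) F a.+1) <= 2 ^+ (size s).+1 * A * (C * r) * mu ^+ 0.
  by apply: (@taylor_tail i s f A v 0 N.-1 bf vr); rewrite add0n prednK.
rewrite (sum_split1 F N0) {1}/F expr0 mul1r fact0 invr1 rmorph1 mul1r.
rewrite addrAC (le_trans (cmodD _ _)) //.
apply: (le_trans (lerD IH0 hT)).
rewrite expr0 mulr1 exprS -natr1.
have p : 0 <= 2 ^+ size s * (A * (C * r)) by rewrite !mulr_ge0 ?exprn_ge0 // ltW.
have q : 0 <= (size s)%:R * (2 ^+ size s * (A * (C * r))) by rewrite mulr_ge0.
lra.
Qed.

(** The nonlinear part is quadratically small also at complex increments, where there is
    no function to compare with, only the coefficients. *)
Lemma taylor_second_order s f A (v : 'I_d -> R[i]) : bound s f A ->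
  (forall i, cmod (v i) <= r) -> (1 < N)%N ->
  cmod (tayC s f v - (f x0)%:C - \sum_(i <- s) (partial i f x0)%:C * v i) <=
   (size s)%:R * ((size s).+1%:R * 2 ^+ (size s).+1) * A * (C * r) * mu.
Proof.
move=> + vr N1; elim: s f A => [|i s IH] f A /= bf.
  by rewrite subrr big_nil subrr cmod0 !mul0r.
have A0 := @bound_ge0 (i :: s) f A bf.
have Cr0 : 0 <= C * r by rewrite mulr_ge0 // ltW.
have IH0 := IH f A ltac:(by have := bf 0%N; rewrite expr0 fact0 powR1 !mulr1).
pose F a := v i ^+ a * (a`!%:R^-1)%:C * tayC s (iter a (partial i) f) v.
have hT : cmod (\sum_(a < N.-2) F a.+2) <= 2 ^+ (size s).+1 * A * (C * r) * mu ^+ 1.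
  by apply: (@taylor_tail i s f A v 1 N.-2 bf vr); case: (N) N1 => [|[|n]].
rewrite (sum_split2 F N1) {1 2}/F /= expr0 mul1r fact0 invr1 rmorph1 mul1r.
rewrite expr1 mulr1 big_cons.
set T := \sum_(a < _) _ in hT *.
have b1 : cmod (tayC s (partial i f) v - (partial i f x0)%:C) <=
   (size s)%:R * 2 ^+ size s * (A * C) * (C * r).
  apply: taylor_first_order => //; last exact: ltnW.
  by have := bf 1%N; rewrite expr1 powR1 mulr1.
have -> : tayC s f v + (v i * tayC s (partial i f) v + T) - (f x0)%:C -
     ((partial i f x0)%:C * v i + \sum_(j <- s) (partial j f x0)%:C * v j) =
   (tayC s f v - (f x0)%:C - \sum_(j <- s) (partial j f x0)%:C * v j) +
   (v i * (tayC s (partial i f) v - (partial i f x0)%:C) + T) by ring.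
rewrite (le_trans (cmodD _ _)) //.
have b2 : cmod (v i * (tayC s (partial i f) v - (partial i f x0)%:C)) <=
    (size s)%:R * 2 ^+ size s * A * (C * r) * mu.
  rewrite cmodM; apply: (le_trans (ler_pM _ _ (vr i) b1)); rewrite ?cmod_ge0 //.
  apply: (@le_trans _ _ ((size s)%:R * 2 ^+ size s * A * (C * r) * (C * r))); first by lra.
  by rewrite ler_wpM2l // !mulr_ge0 ?exprn_ge0 // ltW.
have b3 := le_trans (cmodD _ _) (lerD b2 hT).
apply: (le_trans (lerD IH0 b3)).
have e1 : (size s).+1%:R = (size s)%:R + 1 :> R by rewrite natr1.
have e2 : (size s).+2%:R = (size s)%:R + 2 :> R by rewrite -(natrD _ _ 2) addn2.
rewrite expr1 !exprS e1 e2.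
have p : 0 <= 2 ^+ size s * (A * (C * r) * mu) by rewrite !mulr_ge0 ?exprn_ge0 // ltW.
have k0 : 0 <= (size s)%:R :> R by [].
have q := mulr_ge0 k0 p; have q2 := mulr_ge0 k0 q.
lra.
Qed.

End BoxTaylor.

(** * Gevrey estimates and differentials on small boxes *)

Section TaylorMorphisms.
Context {R : realType} {d : nat}.
Implicit Types (f : 'rV[R]_d -> R) (s : seq 'I_d).

Lemma taylor_real N x0 s f (v : 'I_d -> R) :
  taylor N x0 (real_complex R) s f (fun i => (v i)%:C) = (taylor N x0 idfun s f v)%:C.
Proof.
elim: s f => [//|i s IH] f /=; rewrite rmorph_sum; apply: eq_bigr => a _.
by rewrite IH !rmorphM rmorphXn.
Qed.

Lemma taylor_differentiable (V : normedModType R[i]) N x0 s f (w : V -> 'I_d -> R[i]) (z : V) :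
  (forall i, differentiable (fun y => w y i) z) ->
  differentiable (fun y => taylor N x0 (real_complex R) s f (w y)) z.
Proof.
move=> dw; elim: s f => [|i s IH] f /=; first exact: differentiable_const.
apply: differentiable_bigsum => a; apply: differentiable_mul; last exact: IH.
apply: differentiable_mul; last exact: differentiable_const.
exact: differentiable_exp.
Qed.

Lemma gevrey_bound_mono K C C' sigma s f A A' : 0 <= C -> C <= C' -> 0 <= A -> A <= A' ->
  gevrey_bound K C sigma s f A -> gevrey_bound K C' sigma s f A'.
Proof.
move=> C0 CC; elim: s f A A' => [|i s IH] f A A' A0 AA /= H.
  by move=> x /H h; exact: le_trans AA.
move=> a; apply: IH (H a); first by rewrite !mulr_ge0 ?exprn_ge0 ?powR_ge0.
by rewrite ler_wpM2r ?powR_ge0 // ler_pM ?exprn_ge0 // lerXn2r // nnegrE // (le_trans C0).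
Qed.

(** The order of the variables is reversed since taylor expands the innermost, that is
    the last, variable of mpartial first. *)
Lemma gevrey_boundE sigma U K f : gevrey sigma U f -> compact K -> K `<=` U ->
  exists2 C : R, 0 < C & gevrey_bound K C sigma (rev (enum 'I_d)) f C.
Proof.
move=> [_ H] cK KU; have [C C0 {}H] := H K cK KU; exists C => //.
apply: gevrey_boundP; first by rewrite rev_uniq enum_uniq.
move=> a x Kx; have := H a x Kx; rewrite revK /mpartial => /le_trans; apply.
have E (T : Type) (idx : T) (op : Monoid.com_law idx) (F : 'I_d -> T) :
    \big[op/idx]_(i <- rev (enum 'I_d)) F i = \big[op/idx]_i F i.
  by rewrite (perm_big (enum 'I_d)) ?perm_rev //= big_enum.
rewrite !E exprS le_eqVlt; apply/orP; left; apply/eqP; congr (_ * _).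
elim/big_rec2 : _ => [|i y1 y2 _ E1]; first by rewrite powR1.
by rewrite natrM powRM // E1.
Qed.

Lemma box_compact (q : 'rV[R]_d) r : compact (box q r).
Proof.
have -> : box q r = [set x : 'rV[R]_d | forall j, [set` `[q 0 j - r, q 0 j + r]] (x 0 j)].
  by apply/seteqP; split => x H j; have := H j; rewrite /= in_itv /= ler_distl.
apply: (@rV_compact R d (fun j => [set` `[q 0 j - r, q 0 j + r]])) => j.
exact: segment_compact.
Qed.

Lemma near_box (q : 'rV[R]_d) (B : set 'rV[R]_d) : nbhs q B ->
  exists2 e : R, 0 < e & box q e `<=` B.
Proof.
move=> /nbhs_ballP [e /= e0 eB]; exists (e / 2); first by rewrite divr_gt0.
move=> x bx; apply: eB; split => // i j; rewrite ord1 /ball /= distrC (le_lt_trans (bx j)) //.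
by rewrite ltr_pdivrMr // ltr_pMr // ltr1n.
Qed.

Lemma box_near (q : 'rV[R]_d) (e : R) : 0 < e -> nbhs q (box q e).
Proof.
move=> e0; apply/nbhs_ballP; exists e => // x [_ bx] j.
by have := bx 0 j; rewrite /ball /= distrC => /ltW.
Qed.

Lemma box_sub (q : 'rV[R]_d) (e e' : R) : e <= e' -> box q e `<=` box q e'.
Proof. by move=> ee x bx j; exact: le_trans ee. Qed.

Lemma partial_near U f (q : 'rV[R]_d) (kappa : R) : open U -> U q -> smooth_on U f ->
  0 < kappa -> exists2 e : R, 0 < e & box q e `<=` U /\
    forall i x, box q e x -> `|partial i f x - partial i f q| <= kappa.
Proof.
move=> oU Uq sf k0.
have N : \forall x \near q, forall i : 'I_d, `|partial i f x - partial i f q| <= kappa.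
  apply: (@filter_forall 'rV[R]_d 'I_d (fun i x => `|partial i f x - partial i f q| <= kappa) (nbhs q) _ _) => i.
  have [ci _] := sf [:: i] q Uq.
  have := ci; move/cvgrPdist_le => /(_ _ k0); apply: filterS => x /=.
  by rewrite distrC.
have [e e0 He] := near_box (filterI (open_nbhs_nbhs (conj oU Uq)) N).
by exists e => //; split => [x /He []//|i x /He []//].
Qed.

(** Continuity of the partial derivatives gives the linear approximation, by
    strict_difference. *)
Lemma diff_partial U f (q : 'rV[R]_d) j : open U -> U q -> smooth_on U f ->
  'd f q 'e_j = partial j f q.
Proof.
move=> oU Uq sf.
pose c : 'cV[R]_d := \col_i partial i f q.
pose df (v : 'rV[R]_d) : R := \sum_i v 0 i * partial i f q.
have lf : linear df.
  move=> a u v; rewrite /df scaler_sumr -big_split /=; apply: eq_bigr => i _.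
  by rewrite !mxE mulrDl -[_ *: _]/(_ * _) mulrA.
pose dfL : {linear 'rV[R]_d -> R} := HB.pack df (GRing.isLinear.Build _ _ _ _ df lf).
have cf : continuous dfL.
  rewrite /= /df; elim: (index_enum _) => [|i s IH] v.
    by under eq_fun do rewrite big_nil; exact: cst_continuous.
  under eq_fun do rewrite big_cons.
  apply: (@continuousD _ _ _ (fun v : 'rV[R]_d => v 0 i * partial i f q)); last exact: IH.
  by apply: continuousM; [exact: coord_continuous|exact: cst_continuous].
have E : 'd f q = dfL :> (_ -> _).
  apply: diff_unique => //; apply/eqaddoP => e e0.
  pose d1 : R := d%:R + 1.
  have d10 : 0 < d1 by rewrite /d1 ltr_wpDl.
  have [eps eps0 [bU near]] := partial_near oU Uq sf (divr_gt0 e0 d10).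
  have := box_near (0 : 'rV[R]_d) eps0; apply: filterS => h bh /=.
  have bq : box q eps q by move=> i; rewrite subrr normr0 ltW.
  have bhq : box q eps (h + q) by move=> i; rewrite mxE addrK; have := bh i; rewrite mxE subr0.
  have hh i : `|(h + q) 0 i - q 0 i| <= `|h|.
    rewrite mxE addrK [leRHS]mx_normE.
    have -> : `|h 0 i| = `|h ((0 : 'I_1), i).1 ((0 : 'I_1), i).2| by [].
    by rewrite -[leLHS]nngE num_le; exact: le_bigmax.
  have h1 := strict_difference sf bU near bhq bq hh.
  rewrite (_ : \sum_i _ = df h) in h1; last first.
    by apply: eq_bigr => i _; rewrite mxE addrK mulrC.
  rewrite -[X in `|X|]/(f (h + q) - (f q + df h)).
  rewrite (_ : f (h + q) - (f q + df h) = f (h + q) - f q - df h); last by ring.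
  apply: (le_trans h1); rewrite mulrA ler_wpM2r // mulrA ler_pdivrMr //.
  by rewrite mulrC ler_pM2l // /d1 lerDl.
rewrite E /= /df (bigD1 j) //= mxE !eqxx mul1r big1 ?addr0 // => i ij.
by rewrite mxE eqxx (negbTE ij) mul0r.
Qed.

End TaylorMorphisms.

(** * Polynomial charts with complex parameters *)

Section TransverseSplitting.
Context {R : realType}.

(** Every vector v is (v T) P + (v J^T) Q: the rows of P span the kernel of J, v T are
    the coordinates along it and v J^T are the values of J. *)
Lemma transverse_splitting (d m : nat) (J : 'M[R]_(d - m, d)) : (m <= d)%N -> row_free J ->
  exists (P : 'M[R]_(m, d)) (T : 'M[R]_(d, m)) (Q : 'M[R]_(d - m, d)),
    T *m P + J^T *m Q = 1%:M.
Proof.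
move=> md fJ; have /row_freeP [B JB] := fJ.
pose Q := B^T; pose E := 1%:M - J^T *m Q.
have EJ : E *m J^T = 0.
  rewrite mulmxBl mul1mx -mulmxA (_ : Q *m J^T = 1%:M) ?mulmx1 ?subrr //.
  by rewrite -trmx_mul JB trmx1.
have rk : \rank (kermx J^T) = m.
  by rewrite mxrank_ker mxrank_tr (eqP fJ) subKn.
have [P [T TP]] : exists (P : 'M[R]_(\rank (kermx J^T), d)) T, T *m P = E.
  exists (row_base (kermx J^T)), (E *m pinvmx (row_base (kermx J^T))).
  by rewrite mulmxKpV // eq_row_base; apply/sub_kermxP.
move: P T TP; rewrite rk => P T TP.
by exists P, T, Q; rewrite TP /E subrK.
Qed.

End TransverseSplitting.

(** What is used of a function holomorphic and bounded by 1 near q; the first clause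
    replaces joint differentiability by the chain rule along curves. *)
Definition curve_holomorphic {R : realType} {d : nat} (q : 'rV[R]_d) (eta : R)
    (Phi : ('I_d -> R[i]) -> R[i]) :=
  (forall (w : R[i] -> 'I_d -> R[i]) z, (forall i, differentiable (fun y => w y i) z) ->
     (forall i, cmod (w z i - (q 0 i)%:C) < eta) -> differentiable (fun y => Phi (w y)) z) /\
  (forall v, (forall i, cmod (v i - (q 0 i)%:C) < eta) -> cmod (Phi v) <= 1).

(** Schwarz's lemma on the complex line through v and v'. *)
Lemma curve_holomorphic_lipschitz (R : realType) (d : nat) (q : 'rV[R]_d) (eta e : R) Phi
    (v v' : 'I_d -> R[i]) : 0 < eta -> 0 < e -> curve_holomorphic q eta Phi ->
  (forall i, cmod (v i - (q 0 i)%:C) <= eta / 4) -> (forall i, cmod (v' i - v i) <= e * (eta / 4)) ->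
  (forall i, cmod (v' i - (q 0 i)%:C) <= eta / 2) ->
  cmod (Phi v' - Phi v) <= 32 * e.
Proof.
move=> eta0 e0 [dPhi bPhi] vq vv v'q.
have [e16|e16] := leP e (1 / 16); last first.
  rewrite (le_trans (cmodB _ _)) // (@le_trans _ _ (1 + 1)) //; last lra.
  by rewrite lerD // bPhi // => i; [have := v'q i|have := vq i]; lra.
have eC : e%:C != 0 by rewrite -cmod_eq0 cmodR normr_eq0 gt_eqF.
(* Restrict to the complex line through v and v', with v at the first node. *)
pose w (a : R[i]) i := v i + (node 0 - a) * (e%:C^-1 * (v' i - v i)).
have wq a : cmod a < 1 -> forall i, cmod (w a i - (q 0 i)%:C) < eta.
  move=> a1 i; rewrite /w addrAC (le_lt_trans (cmodD _ _)) //.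
  have h1 : cmod (node 0 - a) <= 2.
    by rewrite (le_trans (cmodB _ _)) //; have := cmod_node_lt1 (R := R) 0; lra.
  have h2 : cmod (e%:C^-1 * (v' i - v i)) <= eta / 4.
    rewrite cmodM cmodV cmodR gtr0_norm // mulrC ler_pdivrMr //.
    by rewrite mulrC; exact: vv.
  have := vq i; have := ler_pM (cmod_ge0 _) (cmod_ge0 _) h1 h2; rewrite -cmodM; lra.
have dw a : cmod a < 1 -> differentiable (fun b => Phi (w b)) a.
  move=> a1; apply: dPhi; last exact: wq.
  move=> i; apply: differentiable_add; first exact: differentiable_const.
  apply: differentiable_mul; last exact: differentiable_const.
  by apply: differentiable_sub => //; exact: differentiable_const.
have w0 : w (node 0) = v by apply/funext => i; rewrite /w subrr mul0r addr0.
have w1 : w (node 0 - e%:C) = v'.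
  have nE : node 0 - (node 0 - e%:C) = e%:C by ring.
  by apply/funext => i; rewrite /w nE mulrA divff // mul1r addrC subrK.
have n16 : cmod (node 0 - e%:C) <= 1 / 16.
  rewrite /node -rmorphB cmodR mulr1 ler_norml -div1r; apply/andP; split; lra.
have := schwarz_bound dw (fun a a1 => bPhi _ (wq a a1)) n16.
rewrite w0 w1 mulr1 addrAC subrr add0r cmodN cmodR gtr0_norm //; lra.
Qed.

Section Chart.
Context {R : realType} {d m k : nat}.
Variables (rho : 'I_k -> 'rV[R]_d -> R) (J : 'M[R]_(k, d)).
Variables (P : 'M[R]_(m, d)) (T : 'M[R]_(d, m)) (Q : 'M[R]_(k, d)).
Variables (N : nat) (x0 : 'rV[R]_d).

Local Notation dirs := (rev (enum 'I_d)).

(** A zero x0 + v of rho with v T = t is a fixed point of this map, if rho is put in place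
    of its Taylor polynomials; J is close to the derivative of rho, so the second sum is
    a small perturbation. *)
Definition chart_step (L : comNzRingType) (iota : R -> L) (t : 'I_m -> L) (v : 'I_d -> L)
    (j : 'I_d) : L :=
  \sum_a t a * iota (P a j) +
  \sum_b (\sum_l iota (J b l) * v l -
          (taylor N x0 iota dirs (rho b) v - iota (rho b x0))) * iota (Q b j).

(** Picard iterates for the local graph of the common zero set through x0, with
    the equations replaced by their Taylor polynomials: these are polynomial in t
    and make sense for complex t. *)
Definition chart (L : comNzRingType) (iota : R -> L) n (t : 'I_m -> L) : 'I_d -> L :=
  iter n (chart_step iota t) (fun=> 0).

Lemma chart_real n (t : 'I_m -> R) :
  chart (real_complex R) n (fun a => (t a)%:C) = (fun j => (chart idfun n t j)%:C).
Proof.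
elim: n => [|n IH]; first by apply/funext.
apply/funext => j; rewrite /chart /= -/(chart _ n _) IH /chart_step rmorphD !rmorph_sum.
congr (_ + _); apply: eq_bigr => a _; first by rewrite rmorphM.
rewrite taylor_real rmorphM !rmorphB rmorph_sum; congr ((_ - _) * _).
by apply: eq_bigr => l _; rewrite rmorphM.
Qed.

Lemma chart_differentiable (V : normedModType R[i]) n (w : V -> 'I_m -> R[i]) (z : V) j :
  (forall a, differentiable (fun y => w y a) z) ->
  differentiable (fun y => chart (real_complex R) n (w y) j) z.
Proof.
move=> dw; elim: n j => [|n IH] j; first exact: differentiable_const.
rewrite /chart /=; apply: differentiable_add; apply: differentiable_bigsum => a.
  by apply: differentiable_mul => //; exact: differentiable_const.
apply: differentiable_mul; last exact: differentiable_const.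
apply: differentiable_sub.
  apply: differentiable_bigsum => l; apply: differentiable_mul; last exact: IH.
  exact: differentiable_const.
apply: differentiable_sub; last exact: differentiable_const.
by apply: taylor_differentiable.
Qed.

(* The letters: kappa bounds the variation of the first derivatives on K; nP and nQ
   bound the columns of P and Q; r is the radius of the chart and nu the weight N^(s-1), so
   that the Taylor polynomials converge geometrically with ratio mu. *)
Variables (U : set 'rV[R]_d) (q : 'rV[R]_d) (delta kappa C sigma r nu nP nQ : R).
Local Notation K := (box q delta).
Local Notation mu := (C * r * nu).
Hypothesis split1 : T *m P + J^T *m Q = 1%:M.
Hypothesis JE : forall b l, J b l = partial l (rho b) q.
Hypothesis smooth : forall b, smooth_on U (rho b).
Hypothesis KU : K `<=` U.
Hypothesis near : forall b i x, K x -> `|partial i (rho b) x - partial i (rho b) q| <= kappa.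
Hypothesis gb : forall b, gevrey_bound K C sigma dirs (rho b) C.
Hypothesis x0K : box x0 r `<=` K.
Hypotheses (C0 : 0 < C) (r0 : 0 <= r) (nu1 : 1 <= nu) (small : mu <= 1 / 2) (k0 : 0 <= kappa).
Hypothesis weight : forall a, (a < N)%N -> a.+1`!%:R `^ sigma <= a.+1`!%:R * nu ^+ a.
Hypothesis N1 : (1 < N)%N.
Hypothesis nPE : forall j, \sum_a `|P a j| <= nP.
Hypothesis nQE : forall j, \sum_b `|Q b j| <= nQ.
Hypotheses (nP0 : 0 < nP) (nQ0 : 0 <= nQ).
Hypothesis nQk : nQ * (d.+1%:R * kappa) <= 1 / 4.
Hypothesis quad : d%:R * (d.+1%:R * 2 ^+ d.+1) * C * C * mu <= kappa.

Let x0x0 : K x0.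
Proof. by apply: x0K => j; rewrite subrr normr0. Qed.

Let size_dirs : size dirs = d.
Proof. by rewrite size_rev size_enum_ord. Qed.

Let sum_dirs (V : nmodType) (F : 'I_d -> V) : \sum_(i <- dirs) F i = \sum_i F i.
Proof. by rewrite (perm_big (enum 'I_d)) ?perm_rev //= big_enum. Qed.

Lemma linear_part_bound b (v : 'I_d -> R[i]) : (forall i, cmod (v i) <= r) ->
  cmod (\sum_l (J b l)%:C * v l -
    (taylor N x0 (real_complex R) dirs (rho b) v - (rho b x0)%:C)) <= d.+1%:R * kappa * r.
Proof.
move=> vr.
have H := taylor_second_order C0 r0 nu1 small weight x0K (gb b) vr N1.
rewrite size_dirs sum_dirs in H.
set A := taylor _ _ _ _ _ _ in H *; set B := (rho b x0)%:C in H *.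
have -> : \sum_l (J b l)%:C * v l - (A - B) =
  \sum_l ((J b l)%:C - (partial l (rho b) x0)%:C) * v l -
  (A - B - \sum_i (partial i (rho b) x0)%:C * v i).
  under [in RHS]eq_bigr do rewrite mulrBl.
  by rewrite sumrB; ring.
rewrite (le_trans (cmodB _ _)) // -natr1 !mulrDl mul1r lerD //.
  apply: (le_trans (cmod_sum _ _ _)).
  rewrite -mulrA mulr_natl -[in leRHS](card_ord d) -sumr_const; apply: ler_sum => l _.
  rewrite cmodM ler_pM ?cmod_ge0 // -rmorphB cmodR distrC JE near //.
apply: (le_trans H).
by have := ler_wpM2r r0 quad; lra.
Qed.

(** Complex parameters of size r / (2 nP) contribute at most r / 2 to a step, and the
    perturbation at most r / 4. *)
Lemma chart_bound n (t : 'I_m -> R[i]) : (forall a, cmod (t a) <= r / (2 * nP)) ->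
  forall j, cmod (chart (real_complex R) n t j) <= r.
Proof.
move=> tr; elim: n => [|n IH] j; first by rewrite cmod0.
rewrite /chart /= -/(chart _ n t) /chart_step (le_trans (cmodD _ _)) //.
have -> : r = r / (2 * nP) * nP + r / 2 by field; rewrite gt_eqF.
have q0 : 0 <= r / (2 * nP) by rewrite divr_ge0 // mulr_ge0 // ltW.
apply: lerD.
  apply: (@le_trans _ _ (r / (2 * nP) * \sum_a `|P a j|)); last by rewrite ler_wpM2l.
  rewrite mulr_sumr (le_trans (cmod_sum _ _ _)) // ler_sum // => a _.
  by rewrite cmodM cmodR ler_wpM2r.
apply: (@le_trans _ _ (d.+1%:R * kappa * r * \sum_b `|Q b j|)).
  rewrite mulr_sumr (le_trans (cmod_sum _ _ _)) // ler_sum // => b _.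
  by rewrite cmodM cmodR ler_wpM2r // linear_part_bound.
have p : 0 <= d.+1%:R * kappa * r by rewrite !mulr_ge0.
apply: (le_trans (ler_wpM2l p (nQE j))).
by have := ler_wpM2r r0 nQk; have := r0; lra.
Qed.

Lemma chart_real_bound n (t : 'I_m -> R) : (forall a, `|t a| <= r / (2 * nP)) ->
  forall j, `|chart idfun n t j| <= r.
Proof.
move=> tr j; have := @chart_bound n (fun a => (t a)%:C); rewrite chart_real.
by move=> /(_ _ j); rewrite cmodR; apply => a; rewrite cmodR.
Qed.

Lemma K_shift (v : 'I_d -> R) : (forall j, `|v j| <= r) -> K (x0 + \row_j v j).
Proof. by move=> vr; apply: x0K => j; rewrite !mxE addrAC subrr add0r. Qed.

Lemma strict_rho b x y (w : R) : K x -> K y -> (forall i, `|x 0 i - y 0 i| <= w) ->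
  `|\sum_l J b l * (x 0 l - y 0 l) - (rho b x - rho b y)| <= d%:R * (kappa * w).
Proof.
move=> Kx Ky xy; have := strict_difference (smooth b) KU (near b) Kx Ky xy.
rewrite distrC; under eq_bigr do rewrite -JE.
by [].
Qed.

Lemma zero_set_fixpoint x j : (forall b, rho b x0 = 0) -> (forall b, rho b x = 0) ->
  x 0 j - x0 0 j = \sum_a ((x - x0) *m T) 0 a * P a j +
    \sum_b (\sum_l J b l * (x 0 l - x0 0 l) - (rho b x - rho b x0)) * Q b j.
Proof.
move=> z0 zx.
have E : x - x0 = (x - x0) *m T *m P + (x - x0) *m J^T *m Q.
  by rewrite -!mulmxA -mulmxDr split1 mulmx1.
have -> : x 0 j - x0 0 j = (x - x0) 0 j by rewrite !mxE.
rewrite [in LHS]E mxE; congr (_ + _); first by rewrite mxE.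
rewrite mxE; apply: eq_bigr => b _; rewrite zx z0 !subr0 mxE; congr (_ * _).
by apply: eq_bigr => l _; rewrite !mxE mulrC.
Qed.

(** The zero set is a Lipschitz graph over the parameters t = (x - x0) T. *)
Lemma zero_set_lipschitz x tau : (forall b, rho b x0 = 0) -> (forall b, rho b x = 0) -> K x ->
  0 <= tau -> (forall a, `|((x - x0) *m T) 0 a| <= tau) ->
  forall j, `|x 0 j - x0 0 j| <= 2 * nP * tau.
Proof.
move=> z0 zx Kx tau0 tT.
pose w := \big[Num.max/0]_i `|x 0 i - x0 0 i|.
have w0 : 0 <= w by exact: bigmax_ge_id.
have hw i : `|x 0 i - x0 0 i| <= w by exact: (le_bigmax _ (fun i => `|x 0 i - x0 0 i|)).
suff H : w <= 2 * nP * tau by move=> j; exact: le_trans (hw j) H.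
have step j : `|x 0 j - x0 0 j| <= tau * nP + 1 / 4 * w.
  rewrite (zero_set_fixpoint j z0 zx) (le_trans (ler_normD _ _)) // lerD //.
    apply: (@le_trans _ _ (tau * \sum_a `|P a j|)); last by rewrite ler_wpM2l.
    rewrite mulr_sumr (le_trans (ler_norm_sum _ _ _)) // ler_sum // => a _.
    by rewrite normrM ler_wpM2r.
  apply: (@le_trans _ _ (d%:R * (kappa * w) * \sum_b `|Q b j|)).
    rewrite mulr_sumr (le_trans (ler_norm_sum _ _ _)) // ler_sum // => b _.
    by rewrite normrM ler_wpM2r // strict_rho.
  have p : 0 <= d%:R * (kappa * w) by rewrite !mulr_ge0.
  apply: (le_trans (ler_wpM2l p (nQE j))).
  have := ler_wpM2r w0 nQk; have : 0 <= nQ * kappa * w by rewrite !mulr_ge0.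
  by rewrite -natr1; lra.
have : w <= tau * nP + 1 / 4 * w.
  apply: bigmax_le => //; rewrite addr_ge0 ?mulr_ge0 // ?ltW //; lra.
have : 0 <= tau * nP by rewrite mulr_ge0 // ltW.
lra.
Qed.

(** At real points the step with rho itself contracts by 1 / 2; the Taylor error enters
    as a geometric series. *)
Lemma chart_error x n : (forall b, rho b x0 = 0) -> (forall b, rho b x = 0) -> K x ->
  (forall a, `|((x - x0) *m T) 0 a| <= r / (2 * nP)) ->
  forall j, `|x 0 j - x0 0 j - chart idfun n (fun a => ((x - x0) *m T) 0 a) j| <=
    r * (1 / 2) ^+ n + 2 * nQ * (4 ^+ d * C * mu ^+ N).
Proof.
move=> z0 zx Kx tT.
have q0 : 0 <= r / (2 * nP) by rewrite divr_ge0 // mulr_ge0 // ltW.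
have vr j : `|x 0 j - x0 0 j| <= r.
  apply: (le_trans (zero_set_lipschitz z0 zx Kx q0 tT j)).
  by rewrite le_eqVlt; apply/orP; left; apply/eqP; field; rewrite gt_eqF.
set t := fun a => _; set e := 4 ^+ d * C * mu ^+ N.
have mu0 : 0 <= mu by rewrite !mulr_ge0 // ?ltW // (lt_le_trans ltr01).
have e0 : 0 <= e by rewrite !mulr_ge0 ?exprn_ge0 // ltW.
elim: n => [|n IH] j.
  by rewrite subr0 expr0 mulr1 (le_trans (vr j)) // lerDl mulr_ge0 // mulr_ge0.
pose V := chart idfun n t.
have Vr i : `|V i| <= r by exact: chart_real_bound.
pose y := x0 + \row_j V j.
have Ky : K y by exact: K_shift.
pose w := r * (1 / 2) ^+ n + 2 * nQ * e.
have hp : 0 <= (1 / 2 : R) ^+ n by rewrite exprn_ge0 // divr_ge0.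
have w0 : 0 <= w by rewrite addr_ge0 // mulr_ge0 // mulr_ge0.
have xy i : `|x 0 i - y 0 i| <= w.
  by rewrite !mxE opprD addrA; exact: IH.
have tay b : `|rho b y - taylor N x0 idfun dirs (rho b) V| <= e.
  have := taylor_error C0 r0 nu1 small weight x0K KU _ (smooth b) (gb b) Vr.
  rewrite size_dirs rev_uniq enum_uniq => /(_ isT).
  have -> // : corner x0 dirs V = y.
  by apply/rowP => i; rewrite !mxE mem_rev mem_enum.
have -> : x 0 j - x0 0 j - chart idfun n.+1 t j = \sum_b
   ((\sum_l J b l * (x 0 l - y 0 l) - (rho b x - rho b y)) -
    (rho b y - taylor N x0 idfun dirs (rho b) V)) * Q b j.
  rewrite (zero_set_fixpoint j z0 zx) /chart /= -/(chart _ n t) -/V /chart_step opprD addrACA subrr add0r.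
  rewrite -sumrB; apply: eq_bigr => b _; rewrite -mulrBl; congr (_ * _).
  have -> : \sum_l J b l * (x 0 l - y 0 l) =
     \sum_l J b l * (x 0 l - x0 0 l) - \sum_l J b l * V l.
    by rewrite -sumrB; apply: eq_bigr => l _; rewrite !mxE; ring.
  rewrite /=; ring.
apply: (@le_trans _ _ ((d%:R * (kappa * w) + e) * \sum_b `|Q b j|)).
  rewrite mulr_sumr (le_trans (ler_norm_sum _ _ _)) // ler_sum // => b _.
  rewrite normrM ler_wpM2r // (le_trans (ler_normB _ _)) // lerD // strict_rho //.
have p : 0 <= d%:R * (kappa * w) + e by rewrite addr_ge0 // !mulr_ge0.
apply: (le_trans (ler_wpM2l p (nQE j))).
have h1 := ler_wpM2r w0 nQk; have h2 : 0 <= nQ * kappa * w by rewrite !mulr_ge0.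
have h3 : nQ * (d%:R * kappa) * w <= 1 / 4 * w.
  by move: h1; rewrite -natr1; lra.
have h4 : 0 <= r * (1 / 2) ^+ n by rewrite mulr_ge0.
have h5 : 0 <= nQ * e by rewrite mulr_ge0.
rewrite exprS; move: h3; rewrite /w.
by move: h4; move: ((1 / 2) ^+ n) => u h4 h3; lra.
Qed.

Variable eta : R.
Hypotheses (rpos : 0 < r) (rdelta : r <= delta) (deltaeta : 8 * delta <= eta).

Local Notation tau0 := (r / (2 * nP)).

Let tau00 : 0 < tau0. Proof. by rewrite divr_gt0 // mulr_gt0. Qed.

(** The factor w rescales the chart to the unit polydisc. *)
Definition chart_patch (w : R) (Phi : ('I_d -> R[i]) -> R[i]) (t : 'I_m -> R[i]) : R[i] :=
  Phi (fun i => (x0 0 i)%:C + chart (real_complex R) N (fun a => w%:C * t a) i).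

Let near_q (v : 'I_d -> R[i]) : (forall i, cmod (v i) <= r) ->
  forall i, cmod ((x0 0 i)%:C + v i - (q 0 i)%:C) <= eta / 4.
Proof.
move=> vr i; rewrite addrAC (le_trans (cmodD _ _)) // -rmorphB cmodR.
by move: rdelta deltaeta (x0x0 i) (vr i); lra.
Qed.

Let tau_le (t : 'I_m -> R[i]) : polydisc t -> forall a, cmod (tau0%:C * t a) <= tau0.
Proof.
move=> pt a; rewrite cmodM cmodR (gtr0_norm tau00) ler_piMr ?(ltW tau00) //.
exact: ltW.
Qed.

Lemma patch_holomorphic Phi : curve_holomorphic q eta Phi ->
  separately_holomorphic (chart_patch tau0 Phi).
Proof.
move=> [dPhi _] t i pt; apply: dPhi => [j|j].
  apply: differentiable_add; first exact: differentiable_const.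
  apply: chart_differentiable => a; apply: differentiable_mul; first exact: differentiable_const.
  by rewrite /upd; case: eqP => _ //; exact: differentiable_const.
rewrite upd_id; have := near_q (chart_bound N (tau_le pt)) j.
move: rpos rdelta deltaeta; lra.
Qed.

Lemma patch_bound Phi : curve_holomorphic q eta Phi -> bounded_on_polydisc (chart_patch tau0 Phi) 1.
Proof.
move=> [_ bPhi] t pt; apply: bPhi => j.
by have := near_q (chart_bound N (tau_le pt)) j; move: rpos rdelta deltaeta; lra.
Qed.

(** Near a point of the zero set, Phi differs from its composite with the chart by the
    Lipschitz estimate, and the composite is determined by its Newton functionals. *)
Lemma patch_norming Phi Psi tau e x :
  curve_holomorphic q eta Phi -> curve_holomorphic q eta Psi -> 0 <= tau ->
  (forall al : {ffun 'I_m -> 'I_N},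
     cmod (newton_functional al (chart_patch tau0 Phi) - newton_functional al (chart_patch tau0 Psi)) <= tau) ->
  0 < e -> r * (1 / 2) ^+ N + 2 * nQ * (4 ^+ d * C * mu ^+ N) <= e * (eta / 4) ->
  (forall b, rho b x0 = 0) -> (forall b, rho b x = 0) -> K x ->
  (forall a, `|((x - x0) *m T) 0 a| <= tau0 / 16) ->
  cmod (Phi (fun i => (x 0 i)%:C) - Psi (fun i => (x 0 i)%:C)) <=
    2 ^+ m * tau + 2 * (4 ^+ m * m%:R) * (3 / 4) ^+ N + 64 * e.
Proof.
move=> hPhi hPsi tau_ge0 close e0 He z0 zx Kx tT.
pose t a := ((x - x0) *m T) 0 a.
have tT' a : `|t a| <= tau0 by rewrite (le_trans (tT a)) //; move: tau00; lra.
pose u a : R[i] := (tau0^-1 * t a)%:C.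
have u16 a : cmod (u a) <= 1 / 16.
  rewrite cmodR normrM gtr0_norm ?invr_gt0 // mulrC ler_pdivrMr //.
  by rewrite mulrC mul1r -[leRHS]/(tau0 / 16); exact: tT.
have uE : (fun a => tau0%:C * u a) = (fun a => (t a)%:C).
  by apply/funext => a; rewrite -rmorphM mulrA divff ?mul1r // gt_eqF.
pose v i : R[i] := (x0 0 i)%:C + (chart idfun N t i)%:C.
have patchE Xi : chart_patch tau0 Xi u = Xi v by rewrite /chart_patch uE chart_real.
have main := newton_functional_norming (patch_holomorphic hPhi) (patch_bound hPhi)
  (patch_holomorphic hPsi) (patch_bound hPsi) tau_ge0 close u16.
rewrite !patchE in main.
have eta0 : 0 < eta by move: rpos rdelta deltaeta; lra.
have vq i : cmod (v i - (q 0 i)%:C) <= eta / 4.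
  apply: (@near_q (fun i => (chart idfun N t i)%:C)) => {}i.
  by rewrite cmodR; exact: chart_real_bound.
have xv i : cmod ((x 0 i)%:C - v i) <= e * (eta / 4).
  rewrite /v -rmorphD -rmorphB cmodR opprD addrA (le_trans _ He) //.
  exact: chart_error.
have xq i : cmod ((x 0 i)%:C - (q 0 i)%:C) <= eta / 2.
  by rewrite -rmorphB cmodR; have := Kx i; move: rpos rdelta deltaeta; lra.
have l1 := curve_holomorphic_lipschitz eta0 e0 hPhi vq xv xq.
have l2 := curve_holomorphic_lipschitz eta0 e0 hPsi vq xv xq.
set y := fun i => (x 0 i)%:C in l1 l2 *.
have -> : Phi y - Psi y = (Phi v - Psi v) + ((Phi y - Phi v) - (Psi y - Psi v)) by ring.
rewrite (le_trans (cmodD _ _)) // lerD // (le_trans (cmodB _ _)) //.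
by move: l1 l2; lra.
Qed.

End Chart.

(** * Functionals determining holomorphic functions on a piece of the manifold *)

Section GridCells.
Context {R : realType}.

(** Cells that meet S are represented by one of their points, the others by any point
    of S. *)
Lemma grid_cells (A : Type) (m : nat) (S : set A) (f : A -> 'I_m -> R) (L h : R) :
  0 < h -> S !=set0 -> (forall x, S x -> forall a, `|f x a| <= L) -> 0 <= L ->
  exists g (y : {ffun 'I_m -> 'I_g.+1} -> A),
    [/\ g.+1%:R <= 2 * L / h + 1, forall c, S (y c) &
      forall x, S x -> exists c, forall a, `|f x a - f (y c) a| <= h].
Proof.
move=> h0 [x1 Sx1] fL L0.
pose g := Num.truncn (2 * L / h).
pose u x a := (f x a + L) / h.
have Lh : 0 <= 2 * L / h by rewrite divr_ge0 ?(ltW h0) // mulr_ge0.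
have u0 x a : S x -> 0 <= u x a <= 2 * L / h.
  move=> Sx; have := fL x Sx a; rewrite ler_norml => /andP[l1 l2].
  rewrite divr_ge0 ?(ltW h0) //=; last lra.
  by rewrite ler_pM2r ?invr_gt0 //; lra.
pose cell x : {ffun 'I_m -> 'I_g.+1} := [ffun a => inord (Num.truncn (u x a))].
have cellE x a : S x -> (cell x a : nat) = Num.truncn (u x a).
  move=> Sx; rewrite ffunE inordK // ltnS; apply: le_truncn.
  by have /andP[] := u0 x a Sx.
have ch c : exists y, S y /\ ((exists2 x, S x & cell x = c) -> cell y = c).
  have [[x Sx xc]|N] := pselect (exists2 x, S x & cell x = c); first by exists x.
  by exists x1; split => // /N.
have [y Hy] := choice ch.
exists g, y; split => [|c|x Sx].
- by rewrite -natr1 lerD2r truncn_le.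
- by have [] := Hy c.
exists (cell x) => a; have [Sy /(_ (ex_intro2 _ _ x Sx erefl)) cy] := Hy (cell x).
set z := y (cell x) in Sy cy *.
have E : Num.truncn (u z a) = Num.truncn (u x a) by rewrite -!cellE // cy.
have /andP[z0 _] := u0 z a Sy; have /andP[x0 _] := u0 x a Sx.
have := truncn_itv z0; have := truncn_itv x0; rewrite E -natr1.
move: (Num.truncn _)%:R => T /andP[a1 a2] /andP[b1 b2].
have D : f x a - f z a = (u x a - u z a) * h.
  by rewrite /u -mulrBl mulfVK ?gt_eqF //; ring.
rewrite D normrM (gtr0_norm h0) ler_piMl ?(ltW h0) // ler_norml; apply/andP; split; lra.
Qed.

Lemma uniform_small (k : nat) (Pr : 'I_k -> R -> Prop) :
  (forall b, exists2 e : R, 0 < e & Pr b e) ->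
  (forall b (e e' : R), 0 < e' -> e' <= e -> Pr b e -> Pr b e') ->
  exists2 e : R, 0 < e & forall b, Pr b e.
Proof.
move=> ex mono; have [e He] := choice (fun b => let: ex_intro2 e h1 h2 := ex b in
  ex_intro (fun e => 0 < e /\ Pr b e) e (conj h1 h2)).
have s0 : 0 <= \sum_b (e b)^-1 by apply: sumr_ge0 => b _; rewrite invr_ge0 ltW //; case: (He b).
have p0 : 0 < 1 + \sum_b (e b)^-1 by rewrite ltr_pwDl.
exists (1 + \sum_b (e b)^-1)^-1; first by rewrite invr_gt0.
move=> b; have [eb Pb] := He b; apply: (mono b (e b)) => //; first by rewrite invr_gt0.
rewrite -[leRHS]invrK lef_pV2 ?posrE ?invr_gt0 // (bigD1 b) //= addrCA lerDl addr_ge0 //.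
by apply: sumr_ge0 => i _; rewrite invr_ge0 ltW //; case: (He i).
Qed.

Lemma uniform_large (k : nat) (Pr : 'I_k -> R -> Prop) :
  (forall b, exists2 e : R, 0 < e & Pr b e) ->
  (forall b (e e' : R), 0 < e -> e <= e' -> Pr b e -> Pr b e') ->
  exists2 e : R, 0 < e & forall b, Pr b e.
Proof.
move=> ex mono; have [e He] := choice (fun b => let: ex_intro2 e h1 h2 := ex b in
  ex_intro (fun e => 0 < e /\ Pr b e) e (conj h1 h2)).
have s0 : 0 <= \sum_b e b by apply: sumr_ge0 => b _; rewrite ltW //; case: (He b).
exists (1 + \sum_b e b); first by rewrite ltr_pwDl.
move=> b; have [eb Pb] := He b; apply: (mono b (e b)) => //.
rewrite (bigD1 b) //= addrCA lerDl addr_ge0 //.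
by apply: sumr_ge0 => i _; rewrite ltW //; case: (He i).
Qed.

End GridCells.

Section LocalApproximation.
Context {R : realType}.

Lemma sum_norm_le (p d : nat) (A : 'M[R]_(p, d)) j :
  \sum_a `|A a j| <= \sum_i \sum_a `|A a i|.
Proof. by rewrite [leRHS](bigD1 j) //= lerDl sumr_ge0 // => i _; exact: sumr_ge0. Qed.

(** Charts have size of the order of N^(1-s), so a neighbourhood of q in S is covered by
    about N^(m (s-1)) of them, each with N^m Newton functionals. *)
Theorem local_approximation (d m : nat) (s : R) (S : set 'rV[R]_d) (q : 'rV[R]_d) (eta : R) :
  1 <= s -> gevrey_submanifold s m S -> S q -> 0 < eta ->
  exists2 delta : R, 0 < delta & exists2 Cst : R, 1 <= Cst & forall N, (1 < N)%N ->
    exists (I : finType) (lam : I -> (('I_d -> R[i]) -> R[i]) -> R[i]),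
    [/\ #|I|%:R <= Cst * N%:R `^ (m%:R * s),
      forall Phi, curve_holomorphic q eta Phi -> forall i, cmod (lam i Phi) <= Cst ^+ N &
      forall Phi Psi tau, curve_holomorphic q eta Phi -> curve_holomorphic q eta Psi ->
        0 <= tau -> (forall i, cmod (lam i Phi - lam i Psi) <= tau) ->
        forall x, S x -> box q delta x ->
          cmod (Phi (fun i => (x 0 i)%:C) - Psi (fun i => (x 0 i)%:C)) <=
            Cst * tau + Cst * (3 / 4) ^+ N].
Proof.
move=> s1 [md HS] Sq eta0.
have [U [rho [oU Uq grho SU free]]] := HS q Sq.
have smooth b : smooth_on U (rho b) by case: (grho b).
pose J := \matrix_(i, j) partial j (rho i) q.
have JE b l : J b l = partial l (rho b) q by rewrite mxE.
have fJ : row_free J.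
  have := free q Uq; congr is_true; congr row_free.
  by apply/matrixP => i j; rewrite !mxE (diff_partial _ oU Uq (smooth i)).
have [P [T [Q split1]]] := transverse_splitting md fJ.
pose nP : R := 1 + \sum_j \sum_a `|P a j|; pose nQ : R := \sum_j \sum_b `|Q b j|.
have sum2_ge0 (p p' : nat) (A : 'M[R]_(p, p')) : 0 <= \sum_j \sum_a `|A a j|.
  by apply: sumr_ge0 => i _; exact: sumr_ge0.
have nP0 : 0 < nP by rewrite ltr_pwDl.
have nQ0 : 0 <= nQ by exact: sum2_ge0.
have nPE j : \sum_a `|P a j| <= nP by rewrite (le_trans (sum_norm_le _ j)) // lerDr.
have nQE j : \sum_a `|Q a j| <= nQ by exact: sum_norm_le.
pose D1 : R := d.+1%:R.
have D10 : 0 < D1 by rewrite ltr0n.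
pose kappa : R := (4 * (nQ + 1) * D1)^-1.
have kap0 : 0 < kappa by rewrite invr_gt0 !mulr_gt0 // ltr_wpDl.
have nQk : nQ * (D1 * kappa) <= 1 / 4.
  rewrite /kappa invfM [D1 * _]mulrC mulfVK ?gt_eqF // ler_pdivrMr ?mulr_gt0 // ?ltr_wpDl //.
  by lra.
have [delta1 delta10 near1] : exists2 e : R, 0 < e & forall b, box q e `<=` U /\
    forall i x, box q e x -> `|partial i (rho b) x - partial i (rho b) q| <= kappa.
  apply: (@uniform_small _ _ (fun b e => box q e `<=` U /\
    forall i x, box q e x -> `|partial i (rho b) x - partial i (rho b) q| <= kappa)).
    by move=> b; exact: (partial_near oU Uq (smooth b)).
  move=> b e e' e0 ee [h1 h2]; split => [x bx|i x bx]; first by apply: h1; exact: box_sub bx.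
  by apply: h2; exact: box_sub bx.
have [deltaU deltaU0 KU'] := near_box (open_nbhs_nbhs (conj oU Uq)).
pose delta : R := Num.min (Num.min delta1 deltaU) (eta / 8).
have delta0 : 0 < delta by rewrite !lt_min delta10 deltaU0 divr_gt0.
have deltaeta : 8 * delta <= eta.
  have : delta <= eta / 8 by rewrite ge_min lexx orbT.
  lra.
have dd1 : delta <= delta1 by rewrite !ge_min lexx.
have ddU : delta <= deltaU by rewrite !ge_min lexx orbT.
have KU : box q delta `<=` U by move=> x bx; apply: KU'; exact: box_sub bx.
have near b i x : box q delta x -> `|partial i (rho b) x - partial i (rho b) q| <= kappa.
  by move=> bx; apply: (near1 b).2; exact: box_sub bx.
have [C C0 gb] : exists2 C : R, 0 < C & forall b,
    gevrey_bound (box q delta) C s (rev (enum 'I_d)) (rho b) C.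
  apply: (@uniform_large _ _ (fun b C => gevrey_bound (box q delta) C s (rev (enum 'I_d)) (rho b) C)).
    by move=> b; exact: (gevrey_boundE (grho b) (@box_compact _ _ q delta) KU).
  by move=> b e e' e0 ee; apply: gevrey_bound_mono => //; rewrite ltW.
pose c2 : R := d%:R * (d.+1%:R * 2 ^+ d.+1) * C * C.
have c20 : 0 <= c2 by rewrite /c2 !mulr_ge0 ?exprn_ge0 ?(ltW C0).
(* the value of r * nu; the three summands enforce c0 <= delta / 2, C * c0 <= 1 / 2
   and quadratic smallness of the nonlinear part *)
pose c0 : R := (2 / delta + 2 * C + c2 * C / kappa)^-1.
have t1 : 0 < 2 / delta by rewrite divr_gt0.
have t2 : 0 < 2 * C by rewrite mulr_gt0.
have t3 : 0 <= c2 * C / kappa by rewrite divr_ge0 ?(ltW kap0) // mulr_ge0 // ltW.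
have den0 : 0 < 2 / delta + 2 * C + c2 * C / kappa by lra.
have c00 : 0 < c0 by rewrite invr_gt0.
have cden : c0 * (2 / delta + 2 * C + c2 * C / kappa) = 1 by rewrite mulVf // gt_eqF.
have c0_le w : w <= 2 / delta + 2 * C + c2 * C / kappa -> c0 * w <= 1.
  by move=> wl; rewrite -cden ler_pM2l.
have c0d : c0 <= delta / 2.
  have := c0_le (2 / delta); move=> /(_ ltac:(lra)).
  by rewrite mulrA ler_pdivrMr // mul1r; lra.
have c0C : C * c0 <= 1 / 2.
  by have := c0_le (2 * C); move=> /(_ ltac:(lra)); lra.
have c0k : c2 * (C * c0) <= kappa.
  have := c0_le (c2 * C / kappa); move=> /(_ ltac:(lra)).
  by rewrite mulrA ler_pdivrMr // mul1r; lra.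
pose nT : R := \sum_a \sum_j `|T j a|.
have nT0 : 0 <= nT by exact: sum2_ge0.
pose A := S `&` box q (delta / 2).
have Aq : A q by split => // j; rewrite subrr normr0 divr_ge0 // ltW.
have TA x : A x -> forall a, `|((x - q) *m T) 0 a| <= delta / 2 * nT.
  move=> [_ bx] a; rewrite mxE (le_trans (ler_norm_sum _ _ _)) //.
  apply: (@le_trans _ _ (delta / 2 * \sum_j `|T j a|)).
    rewrite mulr_sumr ler_sum // => j _; rewrite normrM ler_wpM2r //.
    by rewrite !mxE; exact: bx.
  by rewrite ler_wpM2l ?divr_ge0 ?(ltW delta0) // (sum_norm_le T a).
have AK x : A x -> box q delta x.
  by move=> [_ bx]; apply: box_sub bx; have := delta0; lra.
have zA x : A x -> forall b, rho b x = 0.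
  move=> Ax b; have : (S `&` U) x by split; [case: Ax|exact/KU/AK].
  by rewrite SU => -[_]; exact.
pose C3 : R := 2 * (delta / 2 * nT) * (32 * nP) / c0 + 1.
have C31 : 1 <= C3.
  by rewrite lerDr divr_ge0 ?(ltW c00) // !mulr_ge0 // ?ltW // divr_gt0.
pose E : R := 4 / eta * (c0 + 2 * nQ * (4 ^+ d * C)).
have E0 : 0 < E.
  by rewrite mulr_gt0 ?divr_gt0 // ltr_pwDl // !mulr_ge0 ?exprn_ge0 // ltW.
exists (delta / 2); first by rewrite divr_gt0.
pose Cst : R := 6 ^+ m + C3 ^+ m + 2 ^+ m + (2 * (4 ^+ m * m%:R) + 64 * E).
have e1 : 1 <= 6 ^+ m :> R by rewrite exprn_ege1 // ler1n.
have e2 : 1 <= C3 ^+ m by rewrite exprn_ege1.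
have e3 : 1 <= 2 ^+ m :> R by rewrite exprn_ege1 // ler1n.
have e4 : 0 <= 2 * (4 ^+ m * m%:R) :> R by rewrite !mulr_ge0 ?exprn_ge0.
exists Cst; first by rewrite /Cst; lra.
move=> N N1.
pose nu : R := N%:R `^ (s - 1).
have nu1 : 1 <= nu by apply: powR_ge1 => //; exact: ltnW.
have nu0 : 0 < nu by exact: lt_le_trans nu1.
pose r : R := c0 / nu.
have r0 : 0 < r by rewrite divr_gt0.
have rc0 : r <= c0 by rewrite ler_pdivrMr // ler_peMr // ltW.
have muE : C * r * nu = C * c0 by rewrite /r -mulrA mulfVK // gt_eqF.
have small : C * r * nu <= 1 / 2 by rewrite muE.
have quad : d%:R * (d.+1%:R * 2 ^+ d.+1) * C * C * (C * r * nu) <= kappa by rewrite muE.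
have weight a : (a < N)%N -> a.+1`!%:R `^ s <= a.+1`!%:R * nu ^+ a by exact: gevrey_weight.
pose tau0 : R := r / (2 * nP).
have tau00 : 0 < tau0 by rewrite divr_gt0 // mulr_gt0.
have h0 : 0 < tau0 / 16 by rewrite divr_gt0.
have L0 : 0 <= delta / 2 * nT by rewrite mulr_ge0 // divr_ge0 // ltW.
have [g [y [gC Ay cover]]] := grid_cells h0 (ex_intro A q Aq) TA L0.
exists ({ffun 'I_m -> 'I_g.+1} * {ffun 'I_m -> 'I_N})%type.
exists (fun ca Phi => newton_functional ca.2
  (chart_patch rho J P Q N (y ca.1) tau0 Phi)).
have yK c : box (y c) r `<=` box q delta.
  move=> x bx j; have := bx j; have := (Ay c).2 j.
  have := ler_normD (x 0 j - y c 0 j) (y c 0 j - q 0 j); rewrite addrA subrK; lra.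
have rdelta : r <= delta by have := delta0; lra.
have kap0' := ltW kap0; have r0' := ltW r0.
split.
- rewrite card_prod !card_ffun !card_ord natrM !natrX.
  have gN : g.+1%:R <= C3 * nu.
    apply: (le_trans gC); rewrite /C3 [leRHS]mulrDl mul1r lerD //.
    rewrite le_eqVlt; apply/orP; left; apply/eqP; rewrite /tau0 /r.
    by field; rewrite !gt_eqF.
  have -> : N%:R `^ (m%:R * s) = nu ^+ m * N%:R ^+ m :> R.
    have N0 : 0 <= N%:R :> R by [].
    have -> : m%:R * s = (s - 1) * m%:R + m%:R by ring.
    rewrite powRD; last by apply/implyP => _; rewrite pnatr_eq0 -lt0n ltnW.
    by rewrite powRrM powR_mulrn ?powR_ge0 // powR_mulrn.
  rewrite mulrA ler_wpM2r ?exprn_ge0 //.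
  apply: (@le_trans _ _ ((C3 * nu) ^+ m)).
    by rewrite lerXn2r ?nnegrE // mulr_ge0 ?ltW // (lt_le_trans ltr01).
  rewrite exprMn ler_wpM2r ?exprn_ge0 ?(ltW nu0) // /Cst; lra.
- move=> Phi hPhi [c al] /=.
  apply: (@le_trans _ _ (6 ^+ (m * N))); last first.
    by rewrite exprM lerXn2r ?nnegrE //; rewrite /Cst; lra.
  apply: newton_functional_bound.
    exact: (patch_holomorphic JE near gb (yK c) C0 r0' nu1 small kap0' weight N1 nPE nQE nP0 nQk quad r0 rdelta deltaeta hPhi).
  exact: (patch_bound JE near gb (yK c) C0 r0' nu1 small kap0' weight N1 nPE nQE nP0 nQk quad r0 rdelta deltaeta hPhi).
move=> Phi Psi tau hPhi hPsi tau_ge0 close x Sx bx.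
have Ax : A x by split.
have [c cx] := cover x Ax.
have q34 : 0 < (3 / 4 : R) ^+ N by rewrite exprn_gt0 // divr_gt0.
have := @patch_norming _ _ _ _ rho J P T Q N (y c) U q delta kappa C s r nu nP nQ split1 JE smooth KU near gb (yK c) C0 r0' nu1
  small kap0' weight N1 nPE nQE nP0 nQ0 nQk quad eta r0 rdelta deltaeta Phi Psi tau (E * (3 / 4) ^+ N) x
  hPhi hPsi tau_ge0 (fun al => close (c, al)) (mulr_gt0 E0 q34).
move=> /(_ _ (zA _ (Ay c)) (zA _ Ax) (AK _ Ax) _)/wrap[||].
- have -> : E * (3 / 4) ^+ N * (eta / 4) = (c0 + 2 * nQ * (4 ^+ d * C)) * (3 / 4) ^+ N.
    by rewrite /E; field; rewrite gt_eqF.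
  have h34 : (1 / 2 : R) ^+ N <= (3 / 4) ^+ N.
    by rewrite lerXn2r ?nnegrE ?divr_ge0 //; lra.
  have hmu : (C * r * nu) ^+ N <= (3 / 4) ^+ N.
    apply: le_trans h34; rewrite lerXn2r ?nnegrE ?divr_ge0 //.
    by rewrite muE mulr_ge0 // ltW.
  rewrite [leRHS]mulrDl lerD //.
    by rewrite ler_pM // ?(ltW r0) // exprn_ge0 // divr_ge0.
  by rewrite mulrA ler_wpM2l // mulr_ge0 ?mulr_ge0 ?exprn_ge0 // ltW.
- move=> a; have -> : x - y c = (x - q) - (y c - q) by rewrite opprB addrA subrK.
  by rewrite mulmxBl mxE [X in _ + X]mxE; exact: cx.
move=> /le_trans; apply.
have p1 : 0 <= (6 ^+ m + C3 ^+ m + (2 * (4 ^+ m * m%:R) + 64 * E)) * tau.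
  by rewrite mulr_ge0 //; lra.
have p2 : 0 <= (6 ^+ m + C3 ^+ m + 2 ^+ m) * (3 / 4) ^+ N.
  by rewrite mulr_ge0 ?(ltW q34) //; lra.
by rewrite /Cst; move: p1 p2; move: ((3 / 4) ^+ N) => u; lra.
Qed.

End LocalApproximation.

(** * From real to complex coordinates, and compactness *)

Section ComplexCoordinates.
Context {R : realType} {n : nat}.
Implicit Types (z p : 'rV[R[i]]_n) (D : set 'rV[R[i]]_n) (F : 'rV[R[i]]_n -> R[i]).

(** The complex linear extension to C^(2n) of the inverse of realify. *)
Definition complexify (v : 'I_(n + n) -> R[i]) : 'rV[R[i]]_n :=
  \row_j (v (lshift n j) + 'i * v (rshift n j)).

Lemma realifyK z : complexify (fun i => (realify z 0 i)%:C) = z.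
Proof.
by apply/rowP => j; rewrite mxE row_mxEl row_mxEr !mxE -complexE.
Qed.

Lemma differentiable_row (V : normedModType R[i]) (w : V -> 'I_n -> R[i]) y :
  (forall j, differentiable (fun x => w x j) y) ->
  differentiable (fun x => \row_j w x j : 'rV[R[i]]_n) y.
Proof.
move=> dw.
have -> : (fun x => \row_j w x j : 'rV[R[i]]_n) =
   (fun x => \sum_j w x j *: (delta_mx 0 j : 'rV[R[i]]_n)).
  apply/funext => x; rewrite [LHS]row_sum_delta.
  by apply: eq_bigr => j _; rewrite mxE.
elim: (index_enum _) => [|j s IH].
  by under eq_fun do rewrite big_nil; exact: differentiable_cst.
under eq_fun do rewrite big_cons.
by apply: differentiableD => //; exact: differentiableZl.
Qed.

Lemma near_complex_box p (B : set 'rV[R[i]]_n) : nbhs p B ->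
  exists2 e : R, 0 < e & forall z, (forall j, cmod (z 0 j - p 0 j) < e) -> B z.
Proof.
move=> /nbhs_ballP [[e ei] /=]; rewrite ltcE /= => /andP[/eqP -> e0] eB.
exists e => // z zp; apply: eB; split => [|i j]; first by rewrite ltcE /= eqxx.
by rewrite ord1 /ball /= distrC normE ltcR.
Qed.

Definition holomorphic_unit_ball_on D F :=
  holomorphic_on D F /\ forall z, D z -> `|F z| <= 1.

Lemma curve_holomorphic_complexify D p : open D -> D p ->
  exists2 eta : R, 0 < eta & forall F, holomorphic_unit_ball_on D F ->
    curve_holomorphic (realify p) eta (F \o complexify).
Proof.
move=> oD Dp; have [e e0 He] := near_complex_box (open_nbhs_nbhs (conj oD Dp)).
exists (e / 2); first by rewrite divr_gt0.
have inD v : (forall i, cmod (v i - (realify p 0 i)%:C) < e / 2) -> D (complexify v).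
  move=> vp; apply: He => j; rewrite mxE.
  have -> : p 0 j = (realify p 0 (lshift n j))%:C + 'i * (realify p 0 (rshift n j))%:C.
    by rewrite -[in LHS](realifyK p) mxE.
  rewrite opprD addrACA -mulrBr (le_lt_trans (cmodD _ _)) // cmodM cmod_i mul1r.
  by have := vp (lshift n j); have := vp (rshift n j); lra.
move=> F [hF F1]; split => [w z dw wz|v vp].
  apply: differentiable_comp; last by apply: hF; exact: inD.
  apply: differentiable_row => j; apply: differentiable_add => //.
  by apply: differentiable_mul => //; exact: differentiable_const.
by rewrite -cmod1 cmod_le normr1 F1 //; exact: inD.
Qed.

(** The exponent a plays the role of a dimension: it is what the entropy sees of A, and
    it is stable under finite unions. *)
Definition finitely_determined D (a : R) (A : set 'rV[R[i]]_n) :=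
  exists2 Cst : R, 1 <= Cst & forall N, (1 < N)%N ->
    exists (I : finType) (lam : I -> ('rV[R[i]]_n -> R[i]) -> R[i]),
    [/\ #|I|%:R <= Cst * N%:R `^ a,
      forall F, holomorphic_unit_ball_on D F -> forall i, cmod (lam i F) <= Cst ^+ N &
      forall F G tau, holomorphic_unit_ball_on D F -> holomorphic_unit_ball_on D G ->
        0 <= tau -> (forall i, cmod (lam i F - lam i G) <= tau) ->
        forall x, A x -> cmod (F x - G x) <= Cst * tau + Cst * (3 / 4) ^+ N].

Lemma finitely_determined_sub D a (A B : set 'rV[R[i]]_n) : A `<=` B ->
  finitely_determined D a B -> finitely_determined D a A.
Proof.
move=> AB [Cst C1 H]; exists Cst => // N /H [I [lam [h1 h2 h3]]].
by exists I, lam; split => // F G tau hF hG t0 cl x /AB; exact: h3.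
Qed.

Lemma finitely_determined_set0 D a : finitely_determined D a set0.
Proof.
exists 1 => // N _; exists 'I_0, (fun _ _ => 0); split => //; last by move=> ? _ [].
by rewrite card_ord mul1r powR_ge0.
Qed.

Lemma finitely_determinedU D a (A B : set 'rV[R[i]]_n) :
  finitely_determined D a A -> finitely_determined D a B ->
  finitely_determined D a (A `|` B).
Proof.
move=> [C1 C11 H1] [C2 C21 H2]; exists (C1 + C2); first lra.
move=> N N1; have [I [lam [h1 h2 h3]]] := H1 N N1; have [J [lam' [k1 k2 k3]]] := H2 N N1.
have q0 : 0 <= (3 / 4 : R) ^+ N by rewrite exprn_ge0 // divr_ge0.
exists (I + J)%type, (fun ij => match ij with inl i => lam i | inr j => lam' j end); split.
- by rewrite card_sum natrD mulrDl lerD.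
- move=> F hF [i|j].
    by rewrite (le_trans (h2 F hF i)) // lerXn2r ?nnegrE; lra.
  by rewrite (le_trans (k2 F hF j)) // lerXn2r ?nnegrE; lra.
move=> F G tau hF hG t0 cl x [Ax|Bx].
  rewrite (le_trans (h3 F G tau hF hG t0 (fun i => cl (inl i)) x Ax)) //.
  by rewrite lerD // ler_wpM2r //; lra.
rewrite (le_trans (k3 F G tau hF hG t0 (fun j => cl (inr j)) x Bx)) //.
by rewrite lerD // ler_wpM2r //; lra.
Qed.

Lemma finitely_determined_near D (M : set 'rV[R[i]]_n) m (s : R) p : 1 <= s ->
  gevrey_submanifold s m (realify @` M) -> open D -> M p -> D p ->
  exists2 W : set 'rV[R[i]]_n, nbhs p W & finitely_determined D (m%:R * s) (M `&` W).
Proof.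
move=> s1 HM oD Mp Dp; have [eta eta0 Heta] := curve_holomorphic_complexify oD Dp.
have Sp : (realify @` M) (realify p) by exists p.
have [delta d0 [Cst C1 H]] := local_approximation s1 HM Sp eta0.
exists [set z | box (realify p) delta (realify z)].
  apply/nbhs_ballP; exists delta%:C => /=; first by rewrite ltr0c.
  move=> z [_ bz] j; have E k : cmod (z 0 k - p 0 k) <= delta.
    by have := bz 0 k; rewrite /ball /= distrC normE ltcR => /ltW.
  case: (split_ordP j) => k ->; rewrite ?row_mxEl ?row_mxEr !mxE -raddfB /=.
    exact: le_trans (cmod_Re _) (E k).
  exact: le_trans (cmod_Im _) (E k).
exists Cst => // N /H [I [lam [h1 h2 h3]]].
exists I, (fun i F => lam i (F \o complexify)); split => // [F hF i|F G tau hF hG t0 cl x [Mx bx]].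
  by apply: h2; exact: Heta.
have := h3 _ _ tau (Heta F hF) (Heta G hG) t0 cl (realify x) (ex_intro2 _ _ x Mx erefl) bx.
by rewrite /= realifyK.
Qed.

Lemma finitely_determined_compact D (M X : set 'rV[R[i]]_n) m (s : R) : 1 <= s ->
  gevrey_submanifold s m (realify @` M) -> open D -> compact X -> X `<=` M -> X `<=` D ->
  finitely_determined D (m%:R * s) X.
Proof.
move=> s1 HM oD cX XM XD.
have ch p : exists W : set 'rV[R[i]]_n, X p ->
    nbhs p W /\ finitely_determined D (m%:R * s) (M `&` W).
  have [Xp|nXp] := pselect (X p); last by exists set0.
  by have [W h1 h2] := finitely_determined_near s1 HM oD (XM p Xp) (XD p Xp); exists W.
have [W HW] := choice ch.
move: cX; rewrite compact_cover => cX.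
have [Y YX XY] : finite_subset_cover X (fun p => (W p)°) X.
  apply: cX => [p _|p Xp]; first exact: open_interior.
  by exists p => //; have [+ _] := HW p Xp.
have {YX XY} [t tX XY] : exists2 t : seq 'rV[R[i]]_n, (forall p, p \in t -> X p) &
    forall x, X x -> exists2 p, p \in t & W p x.
  exists (finmap.enum_fset Y) => [p /YX|x /XY [p pY /interior_subset Wx]].
    by rewrite inE.
  by exists p.
apply: (@finitely_determined_sub _ _ _ [set x | M x /\ exists2 p, p \in t & W p x]).
  by move=> x Xx; split; [exact: XM|exact: XY].
move: tX {XY}; elim: t => [|p t IH] tX.
  by apply: finitely_determined_sub (finitely_determined_set0 _ _) => x [_ []].
have [_ hp] := HW p (tX p (mem_head _ _)).
have ht := IH (fun p' h => tX p' (mem_behead (s := p :: t) h)).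
apply: finitely_determined_sub (finitely_determinedU hp ht) => x [Mx [p' ]].
rewrite inE => /orP[/eqP ->|p't] Wx; [left|right] => //.
by split => //; exists p'.
Qed.

End ComplexCoordinates.

(** * Entropy *)

Section EntropyBound.
Context {R : realType} {n : nat}.
Implicit Types (X D : set 'rV[R[i]]_n).

Lemma covering_number_le (T : Type) (d : T -> T -> \bar R) (E : set T) (eps : R) (J : finType)
    (C : J -> set T) : (forall c, (diameter d (C c) <= (2 * eps)%:E)%E) ->
  (forall u, E u -> exists c, C c u) -> (covering_number d E eps <= #|J|%:R%:E)%E.
Proof.
move=> dC cov; apply: ereal_inf_lbound; exists #|J| => //.
exists (fun i => C (enum_val i)); split => [i|u /cov [c Cu]]; first exact: dC.
by exists (enum_rank c) => //; rewrite enum_rankK.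
Qed.

Lemma sup_dist_le (T : Type) (f g : T -> R[i]) (e : R) :
  (forall x, cmod (f x - g x) <= e) -> (sup_dist f g <= e%:E)%E.
Proof. by move=> H; apply: ge_ereal_sup => _ [x _ <-]; rewrite lee_fin; exact: H. Qed.

(** Round the real and imaginary parts of the functionals to multiples of eps / (4 Cst):
    functions in the same cell differ by at most eps from a common one. *)
Lemma covering_number_determined X D (a Cst eps : R) N : D !=set0 ->
  1 <= Cst -> 0 < eps -> Cst * (3 / 4) ^+ N <= eps / 2 ->
  (exists (I : finType) (lam : I -> ('rV[R[i]]_n -> R[i]) -> R[i]),
    [/\ #|I|%:R <= Cst * N%:R `^ a,
      forall F, holomorphic_unit_ball_on D F -> forall i, cmod (lam i F) <= Cst ^+ N &
      forall F G tau, holomorphic_unit_ball_on D F -> holomorphic_unit_ball_on D G ->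
        0 <= tau -> (forall i, cmod (lam i F - lam i G) <= tau) ->
        forall x, X x -> cmod (F x - G x) <= Cst * tau + Cst * (3 / 4) ^+ N]) ->
  exists k K : nat, [/\ K%:R <= Cst * N%:R `^ a,
    k.+1%:R <= 8 * Cst ^+ N.+1 / eps + 1 &
    (covering_number sup_dist (@holomorphic_unit_ball R n X D) eps <= (k.+1 ^ (K * 2))%:R%:E)%E].
Proof.
move=> [z0 Dz0] C1 eps0 small [I [lam [cardI lamB close]]].
have C0 : 0 < Cst by lra.
pose B := holomorphic_unit_ball_on D.
have B0 : B !=set0.
  exists (fun=> 0); split => [z _|z _]; first exact: differentiable_cst.
  by rewrite normr0.
pose m := #|{: I * bool}|.
pose f (F : 'rV[R[i]]_n -> R[i]) (j : 'I_m) : R :=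
  let ib := enum_val j in
  if ib.2 then complex.Re (lam ib.1 F) else complex.Im (lam ib.1 F).
have fL F : B F -> forall j, `|f F j| <= Cst ^+ N.
  move=> BF j; apply: le_trans (lamB F BF (enum_val j).1).
  by rewrite /f; case: ifP => _; [exact: cmod_Re|exact: cmod_Im].
pose h := eps / (4 * Cst).
have h0 : 0 < h by rewrite divr_gt0 // mulr_gt0.
have L0 : 0 <= Cst ^+ N by rewrite exprn_ge0 // ltW.
have [g [y [gC By cover]]] := grid_cells h0 B0 fL L0.
exists g, #|I|; split => //.
  apply: (le_trans gC); rewrite lerD2r le_eqVlt; apply/orP; left; apply/eqP.
  by rewrite /h exprS; field; rewrite !gt_eqF.
have -> : (g.+1 ^ (#|I| * 2) = #|{: {ffun 'I_m -> 'I_g.+1}}|)%N.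
  by rewrite card_ffun !card_ord /m card_prod card_bool.
apply: (@covering_number_le _ _ _ _ _
  (fun c => [set u : X -> R[i] | forall x : X, cmod (u x - y c (val x)) <= eps])).
  move=> c; apply: ge_ereal_sup => _ [u hu [v hv <-]].
  apply: sup_dist_le => x.
  have -> : u x - v x = (u x - y c (val x)) - (v x - y c (val x)) by ring.
  by rewrite (le_trans (cmodB _ _)) //; have := hu x; have := hv x; lra.
move=> _ [F BF <-]; have [c Hc] := cover F BF; exists c => x.
have t0 : 0 <= 2 * h by rewrite mulr_ge0 // ltW.
have cl i : cmod (lam i F - lam i (y c)) <= 2 * h.
  rewrite (le_trans (cmod_ReIm _)) // !raddfB /=.
  have := Hc (enum_rank (i, true)); have := Hc (enum_rank (i, false)).
  by rewrite /f !enum_rankK /=; lra.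
have := close F (y c) (2 * h) BF (By c) t0 cl (val x) (set_valP x).
move/le_trans; apply.
have -> : Cst * (2 * h) = eps / 2 by rewrite /h; field; rewrite gt_eqF.
lra.
Qed.

Lemma ln_natX (k e : nat) : ln ((k.+1 ^ e)%:R : R) = e%:R * ln k.+1%:R.
Proof. by rewrite natrX lnXn ?ltr0n // mulr_natl. Qed.

(** Take N proportional to log (1 / eps), so that Cst * (3 / 4) ^ N <= eps / 2.  There are
    N^a functionals up to a constant, and rounding one of size Cst ^ N to precision eps
    leaves exp (O (log (1 / eps))) possibilities. *)
Lemma entropy_bound X D (a : R) : 0 <= a -> D !=set0 -> finitely_determined D a X ->
  exists2 K : R, 0 < K & forall eps, 0 < eps -> 1 <= ln eps^-1 ->
    (entropy sup_dist (@holomorphic_unit_ball R n X D) eps <= (K * ln eps^-1 `^ (a + 1))%:E)%E.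
Proof.
move=> a0 D0 [Cst C1 H].
have C0 : 0 < Cst by lra.
have q1 : 0 < ln (4 / 3 : R) by rewrite ln_gt0 //; lra.
have lC : 0 <= ln Cst by rewrite ln_ge0.
have l2C : 0 <= ln (2 * Cst) by rewrite ln_ge0 //; lra.
pose b := (1 + ln (2 * Cst)) / ln (4 / 3).
have b0 : 0 <= b by rewrite divr_ge0 ?(ltW q1) // addr_ge0.
pose A := ln 9 + (b + 3) * ln Cst + 1.
have l9 : 0 <= ln (9 : R) by rewrite ln_ge0 //; lra.
have A0 : 0 < A by rewrite /A ltr_wpDl // addr_ge0 // mulr_ge0 //; lra.
exists (2 * Cst * (b + 2) `^ a * A).
  by rewrite !mulr_gt0 // powR_gt0; lra.
move=> eps eps0; set l := ln eps^-1 => l1.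
have l0 : 0 < l by lra.
have lE : ln eps = - l by rewrite /l lnV ?opprK.
pose N := (Num.truncn (b * l)).+2.
have bl0 : 0 <= b * l by rewrite mulr_ge0 // ltW.
have /andP[tr1 tr2] := truncn_itv bl0.
have Nlow : b * l <= N%:R.
  by rewrite (le_trans (ltW tr2)) // ler_nat.
have Nup : N%:R <= (b + 2) * l.
  rewrite /N -addn2 natrD mulrDl lerD //; lra.
have N1 : (1 < N)%N by [].
clearbody N.
have small : Cst * (3 / 4) ^+ N <= eps / 2.
  have p1 : 0 < Cst * (3 / 4) ^+ N by rewrite mulr_gt0 // exprn_gt0 // divr_gt0.
  have l34 : ln (3 / 4 : R) = - ln (4 / 3) by rewrite -lnV ?posrE ?divr_gt0 // invf_div.
  have lN : ln ((3 / 4 : R) ^+ N) = - (N%:R * ln (4 / 3)).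
    by rewrite lnXn ?divr_gt0 // l34 mulNrn -[ln _ *+ N]mulr_natl.
  have l2 : ln (2 * Cst) = ln 2 + ln Cst by rewrite lnM ?posrE.
  have e2 : ln (eps / 2) = - l - ln 2 by rewrite lnM ?posrE ?invr_gt0 // lE lnV ?posrE.
  rewrite -ler_ln ?posrE ?divr_gt0 // e2 lnM ?posrE ?exprn_gt0 ?divr_gt0 // lN.
  have h : (1 + ln (2 * Cst)) * l <= N%:R * ln (4 / 3).
    by rewrite -ler_pdivrMr // mulrAC.
  have : ln (2 * Cst) <= ln (2 * Cst) * l by rewrite ler_peMr.
  by rewrite l2 in h *; lra.
have [k [K [hK hk cov]]] := covering_number_determined D0 C1 eps0 small (H N N1).
have k0 : 0 < (k.+1 ^ (K * 2))%:R :> R by rewrite ltr0n expn_gt0.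
have cov0 : (0 <= covering_number sup_dist (@holomorphic_unit_ball R n X D) eps)%E.
  by apply: le_ereal_inf_tmp => _ [j _ <-]; rewrite lee_fin.
rewrite /entropy (@le_trans _ _ (lne (k.+1 ^ (K * 2))%:R%:E)) //.
  by rewrite lee_lne // in_itv /= ?leey ?andbT //.
rewrite (lne_EFin k0) lee_fin ln_natX natrM mulrC.
have eps1 : eps <= 1.
  rewrite -ler_ln ?posrE //; rewrite ln1 lE; lra.
have C1' : 1 <= Cst ^+ N.+1 by rewrite exprn_ege1.
have lk : ln k.+1%:R <= A * l.
  apply: (@le_trans _ _ (ln (9 * Cst ^+ N.+1 * eps^-1))).
    rewrite ler_ln ?posrE ?ltr0n //; last first.
      by rewrite !mulr_gt0 ?invr_gt0 // (lt_le_trans ltr01).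
    apply: (le_trans hk).
    have : 1 <= Cst ^+ N.+1 * eps^-1.
      by rewrite mulr_ege1 // invf_ge1.
    lra.
  have p : 0 < Cst ^+ N.+1 by rewrite exprn_gt0.
  have lC1 : ln (Cst ^+ N.+1) = ln Cst * (N%:R + 1) by rewrite lnXn // natr1 mulr_natr.
  rewrite lnM ?posrE ?mulr_gt0 ?invr_gt0 // lnM ?posrE // -/l lC1.
  rewrite /A !mulrDl mul1r.
  have i1 : ln 9 <= ln 9 * l by rewrite ler_peMr.
  have i2 : ln Cst * (N%:R + 1) <= (b + 3) * ln Cst * l.
    have : ln Cst * (N%:R + 1) <= ln Cst * ((b + 3) * l) by rewrite ler_wpM2l //; lra.
    by lra.
  lra.
have lk0 : 0 <= ln (k.+1%:R : R) by rewrite ln_ge0 // ler1n.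
apply: (@le_trans _ _ (A * l * (Cst * ((b + 2) * l) `^ a * 2))).
  apply: ler_pM => //.
  rewrite ler_pM2r // (le_trans hK) // ler_wpM2l ?(ltW C0) //.
  by rewrite ge0_ler_powR ?nnegrE // mulr_ge0 ?(ltW l0) //; lra.
rewrite powRM ?(ltW l0) //; last lra.
rewrite powRD; last by apply/implyP => _; rewrite gt_eqF.
rewrite powRr1 ?(ltW l0) // le_eqVlt; apply/orP; left; apply/eqP; ring.
Qed.

Lemma kolmogorov_dim_le X D (a : R) : 0 <= a -> D !=set0 -> finitely_determined D a X ->
  (kolmogorov_dim X D <= a%:E)%E.
Proof.
move=> a0 D0 /(entropy_bound a0 D0) [K K0 H].
rewrite /kolmogorov_dim leeBlDr // -EFinD.
apply/lee_addgt0Pr => e e0; rewrite -EFinD.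
(* log K is at most e log log (1/eps) as soon as 1/eps is large *)
pose l0 := expR (`|ln K| / e + 1).
have l00 : 1 < l0 by rewrite expR_gt1 ltr_pwDr // divr_ge0 // ltW.
pose e1 := expR (- l0).
have e10 : 0 < e1 by exact: expR_gt0.
have near0 : (0 : R)^'+ [set eps | 0 < eps < e1].
  near=> t; apply/andP; split; first by near: t; exact: nbhs_right_gt.
  by near: t; exact: nbhs_right_lt.
rewrite limf_esupE; apply: (@le_trans _ _ (ereal_sup
   [set (lne (entropy sup_dist (@holomorphic_unit_ball R n X D) eps)
       * ((ln (ln eps^-1))^-1)%:E)%E | eps in [set eps : R | 0 < eps < e1]])).
  by apply: ereal_inf_lbound; exists [set eps | 0 < eps < e1].
apply: ge_ereal_sup => _ [eps /andP[eps0 epse] <-].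
set l := ln eps^-1.
have ll0 : l0 < l.
  by rewrite /l lnV ?posrE // ltrNr -[- l0]expRK ltr_ln ?posrE.
have l1 : 1 < l by exact: lt_trans ll0.
have lnl : `|ln K| / e + 1 < ln l by rewrite -[X in X < _]expRK ltr_ln ?posrE ?expR_gt0 ?(lt_trans ltr01).
have lnl0 : 0 < ln l by rewrite ln_gt0.
have lp : 0 < l := lt_trans ltr01 l1.
have Kl0 : 0 < K * l `^ (a + 1) by rewrite mulr_gt0 // powR_gt0.
have h := H eps eps0 (ltW l1).
apply: (@le_trans _ _ ((ln (K * l `^ (a + 1)))%:E * ((ln l)^-1)%:E)%E).
  rewrite lee_wpmul2r ?lee_fin ?invr_ge0 ?(ltW lnl0) //.
  have [en|en] := leP (entropy sup_dist (@holomorphic_unit_ball R n X D) eps) 0%E.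
    by rewrite le0_lneNy ?leNye.
  by rewrite -lne_EFin // lee_lne // in_itv /= ?leey ?andbT ?(ltW en) // lee_fin ltW.
rewrite -EFinM lee_fin ler_pdivrMr // lnM ?posrE ?powR_gt0 // ln_powR.
have : ln K <= e * ln l.
  rewrite (le_trans (ler_norm _)) // mulrC -ler_pdivrMr //; lra.
lra.
Unshelve. all: by end_near. Qed.

End EntropyBound.

Theorem theorem1p3 (R : realType) (n m : nat) (s : R)
    (M X : set 'rV[R[i]]_n) :
  1 <= s ->
  gevrey_submanifold s m (realify @` M) ->
  totally_real s m M ->
  compact X -> X !=set0 -> X `<=` M ->
  forall D : set 'rV[R[i]]_n, bounded_domain D -> X `<=` D ->
    (kolmogorov_dim X D <= (m%:R * s)%:E)%E.
Proof.
move=> s1 HM _ cX [x Xx] XM D [oD _ _] XD.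
apply: kolmogorov_dim_le.
- by rewrite mulr_ge0 // (le_trans ler01).
- by exists x; exact: XD.
- exact: finitely_determined_compact HM oD cX XM XD.
Qed.
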